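(* Let $M\subset\mathbb C^{2p}$ be a quadratic submanifold defined by $$z_{p+j}=h_j(z',\bar z')+q_j(\bar z'),\qquad 1\le j\le p,\quad z'=(z_1,\dots,z_p),$$ with $q^{-1}(0)=\{0\}$, $q=(q_1,\dots,q_p)$. Suppose that the branched covering $\pi_1$ of the complexification of $M$ has $2^p$ deck transformations and that the associated map $\sigma$ has $2p$ distinct eigenvalues. Then $M$ is holomorphically equivalent to $$Q_{\mathbf B,\boldsymbol\gamma}\colon\quad z_{p+j}=L_j^2(z',\bar z'),\quad 1\le j\le p,\qquad (L_1,\dots,L_p)^t=\mathbf B(z'-2\boldsymbol\gamma\bar z'),$$ where $\mathbf B\in GL_p(\mathbb C)$ and $$\boldsymbol\gamma=\begin{pmatrix}\boldsymbol\gamma_{e_*}&0&0&0\\0&\boldsymbol\gamma_{h_*}&0&0\\0&0&0&\boldsymbol\gamma_{s_*}\\0&0&\mathbf I_{s_*}-\bar{\boldsymbol\gamma}_{s_*}&0\end{pmatrix},\qquad p=e_*+h_*+2s_*,$$ $\mathbf I_{s_*}$ is the $s_*\times s_*$ identity matrix, $\boldsymbol\gamma_{e_*}=\mathrm{diag}(\gamma_1,\dots,\gamma_{e_*})$, $\boldsymbol\gamma_{h_*}=\mathrm{diag}(\gamma_{e_*+1},\dots,\gamma_{e_*+h_*})$, $\boldsymbol\gamma_{s_*}=\mathrm{diag}(\gamma_{e_*+h_*+1},\dots,\gamma_{p-s_*})$, with $$0<\gamma_e<1/2,\quad 1/2<\gamma_h<\infty,\quad \mathrm{Re}\,\gamma_s<1/2,\quad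 \mathrm{Im}\,\gamma_s>0$$ for $1\le e\le e_*<h\le e_*+h_*<s\le p-s_*$. Moreover, with the $\gamma_j$ listed in a fixed order, $\mathbf B$ is uniquely determined by $M$ up to the equivalence relation $\mathbf B\sim\mathbf C\mathbf B\mathbf R$: two quadrics $Q_{\mathbf B,\boldsymbol\gamma}$, $Q_{\tilde{\mathbf B},\boldsymbol\gamma}$ (with $\mathbf B,\tilde{\mathbf B}\in GL_p(\mathbb C)$ and the same $\boldsymbol\gamma$), each of which has $q^{-1}(0)=\{0\}$ for its anti-holomorphic quadratic part $q$, has $2^p$ deck transformations for the branched covering $\pi_1$ of its complexification, and has an associated map $\sigma$ with $2p$ distinct eigenvalues, are holomorphically equivalent if and only if $\tilde{\mathbf B}=\mathbf C\mathbf B\mathbf R$ for some non-singular $p\times p$ matrix $\mathbf C$ with exactly $p$ non-zero entries and some $\mathbf R=\mathrm{diag}(a_1,\dots,a_p)$ with $a_e,a_h\in\mathbb R\setminus\{0\}$ for $1\le e\le e_*<h\le e_*+h_*$, and $a_{s+s_*}=\overline{a_s}\in\mathbb C\setminus\{0\}$ for $e_*+h_*<s\le p-s_*$.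
   Context: Here each $h_j(z',\bar z')$ is a homogeneous quadratic polynomial in $z',\bar z'$ without holomorphic or anti-holomorphic terms, and each $q_j(\bar z')$ is a homogeneous quadratic polynomial in $\bar z'$. Put $E_j=h_j+q_j$. The complexification $\mathcal M\subset\mathbb C^{2p}\times\mathbb C^{2p}$ of $M$ is $\{z_{p+i}=E_i(z',w'),\ w_{p+i}=\bar E_i(w',z')\}$, with coordinates $(z',w')\in\mathbb C^{2p}$, and $\pi_1\colon\mathcal M\to\mathbb C^{2p}$ is the restriction of $(z,w)\mapsto z$. A deck transformation of $\pi_1$ is a germ of biholomorphism $\tau$ of $(\mathcal M,0)$ with $\pi_1\circ\tau=\pi_1$. When $q^{-1}(0)=\{0\}$ and there are $2^p$ deck transformations (the maximum number), their group is generated by a unique set of $p$ commuting involutions $\tau_{11},\dots,\tau_{1p}$ each of which fixes a hypersurface pointwise. Set $\tau_1=\tau_{11}\cdots\tau_{1p}$, $\rho_0(z',w')=(\overline{w'},\overline{z'})$, $\tau_2=\rho_0\tau_1\rho_0$, $\sigma=\tau_1\tau_2$; the eigenvalues of $\sigma$ are those of its linear part at $0$. Two germs of submanifolds at $0$ are holomorphically equivalent if a local biholomorphism of $\mathbb C^{2p}$ fixing $0$ maps one onto the other. *)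

(* Defs.v *)
From HB Require Import structures.
From mathcomp Require Import all_boot all_order all_algebra.
From mathcomp Require Import all_classical all_reals all_analysis.
From mathcomp.real_closed Require Import complex.

Set Implicit Arguments.
Unset Strict Implicit.
Unset Printing Implicit Defensive.

Import Order.TTheory GRing.Theory Num.Theory.
Import numFieldNormedType.Exports.

Local Open Scope classical_set_scope.
Local Open Scope ring_scope.

(* The complex numbers, ascribed to numClosedFieldType so that their norm
   topology (and that of the row spaces 'rV[Cplx R]_n) is found by inference;
   'differentiable' over this field is complex differentiability.  The order on
   Cplx R is partial: an inequality forces both sides to have the same
   imaginary part. *)
Definition Cplx (R : realType) : numClosedFieldType := (R[i])%C.

Section Germs.
Variable R : realType.
Local Notation C := (Cplx R).

Definition germ_eq (n : nat) (T : Type) (f g : 'rV[C]_n -> T) : Prop :=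
  \forall v \near (0 : 'rV[C]_n), f v = g v.

Definition holomorphic_at0 (n m : nat) (f : 'rV[C]_n -> 'rV[C]_m) : Prop :=
  \forall v \near (0 : 'rV[C]_n), differentiable f v.

Definition local_biholomorphism (n : nat) (F : 'rV[C]_n -> 'rV[C]_n) : Prop :=
  [/\ F 0 = 0, holomorphic_at0 F &
      exists G : 'rV[C]_n -> 'rV[C]_n,
        [/\ G 0 = 0, holomorphic_at0 G,
            germ_eq (G \o F) id & germ_eq (F \o G) id]].

Definition holomorphically_equivalent (n : nat) (M N : set 'rV[C]_n) : Prop :=
  exists2 F : 'rV[C]_n -> 'rV[C]_n, local_biholomorphism F &
    \forall z \near (0 : 'rV[C]_n), M z <-> N (F z).

(* f = 0 with f 0 = 0 and 'd f 0 != 0 is a (smooth) hypersurface germ at 0. *)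
Definition fixes_hypersurface (n : nat) (t : 'rV[C]_n -> 'rV[C]_n) : Prop :=
  exists f : 'rV[C]_n -> 'rV[C]_1,
    [/\ holomorphic_at0 f, f 0 = 0, jacobian f 0 != 0 &
        \forall v \near (0 : 'rV[C]_n), f v = 0 -> t v = v].

Definition involution (n : nat) (t : 'rV[C]_n -> 'rV[C]_n) : Prop :=
  germ_eq (t \o t) id /\ ~ germ_eq t id.

End Germs.

Section Quadrics.
Variables (R : realType) (p : nat).
Local Notation C := (Cplx R).

Definition conj_rV (n : nat) (v : 'rV[C]_n) : 'rV[C]_n := map_mx Num.conj v.

(* A quadric z_{p+j} = E_j(z', conj z') is given by E : (z', w') |-> E(z', w'),
   homogeneous quadratic in the independent variables z', w'. *)
Implicit Type E : 'rV[C]_p -> 'rV[C]_p -> 'rV[C]_p.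

(* h_j(z', w') + q_j(w') in terms of coefficient matrices. *)
Definition hq_map (h q : 'I_p -> 'M[C]_p) (z w : 'rV[C]_p) : 'rV[C]_p :=
  \row_j (\sum_k \sum_l h j k l * z 0 k * w 0 l
          + \sum_k \sum_l q j k l * w 0 k * w 0 l).

(* The real submanifold of C^{2p}. *)
Definition quadric E : set 'rV[C]_(p + p) :=
  [set z | rsubmx z = E (lsubmx z) (conj_rV (lsubmx z))].

(* q(w'): every monomial involving z' vanishes at z' = 0. *)
Definition antihol_part E (w : 'rV[C]_p) : 'rV[C]_p := E 0 w.

(* The polynomial map with conjugated coefficients. *)
Definition conj_map E (w z : 'rV[C]_p) : 'rV[C]_p :=
  conj_rV (E (conj_rV w) (conj_rV z)).

Definition complexification E : set ('rV[C]_(p + p) * 'rV[C]_(p + p)) :=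
  [set zw | rsubmx zw.1 = E (lsubmx zw.1) (lsubmx zw.2) /\
            rsubmx zw.2 = conj_map E (lsubmx zw.2) (lsubmx zw.1)].

(* The point of the complexification with coordinates v = (z', w'). *)
Definition chart E (v : 'rV[C]_(p + p)) : 'rV[C]_(p + p) * 'rV[C]_(p + p) :=
  let z := lsubmx v in let w := rsubmx v in
  (row_mx z (E z w), row_mx w (conj_map E w z)).

Lemma range_chart E : range (chart E) = complexification E.
Proof.
apply/seteqP; split=> [_ [v _ <-] | [z w] [/= zE wE]].
  by rewrite /complexification /= !row_mxKl !row_mxKr.
exists (row_mx (lsubmx z) (lsubmx w)) => //.
by rewrite /chart row_mxKl row_mxKr -zE -wE !hsubmxK.
Qed.

(* Maps of the complexification are read in the coordinates (z', w'). *)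
Definition pi1 E (v : 'rV[C]_(p + p)) : 'rV[C]_(p + p) := (chart E v).1.

Definition deck_transformation E (t : 'rV[C]_(p + p) -> 'rV[C]_(p + p)) : Prop :=
  local_biholomorphism t /\ germ_eq (pi1 E \o t) (pi1 E).

Definition number_of_decks E (n : nat) : Prop :=
  exists t : 'I_n -> 'rV[C]_(p + p) -> 'rV[C]_(p + p),
    [/\ forall i, deck_transformation E (t i),
        forall i j, germ_eq (t i) (t j) -> i = j &
        forall d, deck_transformation E d -> exists i, germ_eq d (t i)].

(* The involutions tau_{11}, ..., tau_{1p}.  Generation is by words, inverses
   being superfluous for involutions. *)
Definition deck_generators E
    (t : 'I_p -> 'rV[C]_(p + p) -> 'rV[C]_(p + p)) : Prop :=
  [/\ forall j, deck_transformation E (t j),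
      forall j, involution (t j) /\ fixes_hypersurface (t j),
      forall j k, germ_eq (t j \o t k) (t k \o t j) &
      forall d, deck_transformation E d ->
        exists s : seq 'I_p, germ_eq d (\big[comp/id]_(j <- s) t j)].

Definition rho0 (v : 'rV[C]_(p + p)) : 'rV[C]_(p + p) :=
  row_mx (conj_rV (rsubmx v)) (conj_rV (lsubmx v)).

Definition sigma_of (t : 'I_p -> 'rV[C]_(p + p) -> 'rV[C]_(p + p)) :
    'rV[C]_(p + p) -> 'rV[C]_(p + p) :=
  let tau1 := \big[comp/id]_(j < p) t j in
  let tau2 := rho0 \o tau1 \o rho0 in
  tau1 \o tau2.

Definition sigma_distinct_eigenvalues E : Prop :=
  exists2 t, deck_generators E t &
    exists2 l : 'I_(p + p) -> C, injective l &
      forall i, eigenvalue (jacobian (sigma_of t) 0) (l i).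

Definition nondegenerate_quadric E : Prop :=
  [/\ antihol_part E @^-1` [set 0] = [set 0],
      number_of_decks E (2 ^ p) &
      sigma_distinct_eigenvalues E].

(* (L_1^2, ..., L_p^2) with (L_1, ..., L_p)^t = B (z' - 2 gamma w'). *)
Definition L_map (B gamma : 'M[C]_p) (z w : 'rV[C]_p) : 'cV[C]_p :=
  B *m (z^T - 2 *: (gamma *m w^T)).

Definition Lsq_map (B gamma : 'M[C]_p) (z w : 'rV[C]_p) : 'rV[C]_p :=
  \row_j (L_map B gamma z w j 0) ^+ 2.

End Quadrics.

Section NormalForm.
Variables (R : realType) (p e h s : nat).
Hypothesis p_ehs : (e + h + (s + s) = p)%N.
Local Notation C := (Cplx R).

Definition gamma_mx (ge : 'rV[C]_e) (gh : 'rV[C]_h) (gs : 'rV[C]_s) : 'M[C]_p :=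
  castmx (p_ehs, p_ehs)
    (block_mx
      (block_mx (diag_mx ge) 0 0 (diag_mx gh)) 0
      0 (block_mx 0 (diag_mx gs) (1%:M - diag_mx (conj_rV gs)) 0)).

Definition gamma_range (ge : 'rV[C]_e) (gh : 'rV[C]_h) (gs : 'rV[C]_s) : Prop :=
  [/\ forall i, 0 < ge 0 i < 1 / 2,
      forall i, 1 / 2 < gh 0 i &
      forall i, 'Re (gs 0 i) < 1 / 2 /\ 0 < 'Im (gs 0 i)].

(* The matrices diag(a_1, ..., a_p), the last s entries being the conjugates
   of the preceding s ones. *)
Definition scaling_mx (D : 'M[C]_p) : Prop :=
  exists (ae : 'rV[C]_e) (ah : 'rV[C]_h) (as_ : 'rV[C]_s),
    [/\ forall i, ae 0 i \is Num.real /\ ae 0 i != 0,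
        forall i, ah 0 i \is Num.real /\ ah 0 i != 0,
        forall i, as_ 0 i != 0 &
        D = castmx (p_ehs, p_ehs)
              (diag_mx (row_mx (row_mx ae ah) (row_mx as_ (conj_rV as_))))].

End NormalForm.

Definition monomial_mx (R : realType) (p : nat) (A : 'M[Cplx R]_p) : Prop :=
  A \in unitmx /\ #|[set ij : 'I_p * 'I_p | A ij.1 ij.2 != 0]%SET| = p.

(* Main.v *)
Require Import Defs.
From HB Require Import structures.
From mathcomp Require Import all_boot all_order all_algebra.
From mathcomp Require Import boolp ring lra zify.

Set Implicit Arguments.
Unset Strict Implicit.
Unset Printing Implicit Defensive.

Import Order.TTheory GRing.Theory Num.Theory.

Local Open Scope ring_scope.

(** The quadrics are given by homogeneous quadratic maps, so the derivatives at
    the origin of the maps involved carry all the information.  Vectors are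
    rows: a matrix T acts by v |-> v T.

    Existence of the normal form.  The quadratic map E is preserved by the
    derivatives T_k = [1 A_k; 0 B_k] of the generating deck transformations
    ([quad_map_linear_part]); these are commuting involutions which fix a
    hyperplane ([fixes_hypersurface_tangent]).  The eigenvalues of sigma being
    distinct, the product of the T_k is (z, w) |-> (z, z A - w) with A
    invertible: a common fixed vector of tau_1 and tau_2 is fixed by sigma, and
    such vectors would abound otherwise ([fixed_space_forces_minus1]).  In
    suitable coordinates y on the fibres of (z, w) |-> z, centred at z A / 2,
    the k-th deck transformation changes the sign of y_k, so E is the sum of a
    function of z and of linear combinations of the y_k^2
    ([reflection_invariant_squares]); these can be solved for the y_k^2 because
    q vanishes only at 0.  What remains is to simplify y = (w - z A / 2) U^-1
    at w = conj z by a linear change of z.  With G = A^-1 this amounts to a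
    normal form for the antilinear operator x |-> conj(x) G, whose square
    conj(G) G has the p distinct eigenvalues l / (l + 1)^2, where l runs over
    the eigenvalues of sigma ([sigma_spectrum]).  Real eigenvalues nu give the
    entries sqrt(nu) of gamma, and pairs of conjugate nonreal eigenvalues
    nu = g (1 - g) give the pairs of entries g, 1 - conj(g)
    ([antilinear_normal_form]).

    Uniqueness.  Let F be an equivalence of two quadrics with the same gamma.
    The last p components of F are of second order along the quadric, so the
    derivative of F is block triangular, with diagonal blocks c and b.
    Comparing the terms of second order along the curves (s v, s^2 E(v)) only
    yields E'(v c) = E(v) b up to second derivatives of F in the direction v.
    These form a holomorphic quadratic expression in v, so they are multiplied
    by w^2 when v is replaced by w v with |w| = 1, whereas E(v) involves conj v
    ([rotation_identity], [equivalence_linear_data]).  Thus the mixed terms and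
    the antiholomorphic terms of E' and E match under c and b
    ([rotations_split]).  As the L_j^2 are squares of independent linear forms,
    the forms correspond to each other up to order and factors
    ([square_forms_matching]): this is the matrix C.  The matrix R obtained from
    c satisfies R gamma = gamma conj(R), hence commutes with
    gamma conj(gamma), a diagonal matrix whose entries are distinct because the
    eigenvalues of sigma are ([nondegenerate_deck]); so R is diagonal, with the
    stated symmetry ([scaling_of_commutation]).  The converse is a direct
    computation ([monomial_equivalence]).

    Holomorphic maps are only assumed to be complex differentiable near the
    origin.  The facts about functions of one variable on which the argument
    rests ([holomorphic_lip], [nonvanishing_lower], [second_order_expansion])
    are derived from Cauchy's formula on a square, which is proved by Goursat's
    method. *)

(** * Simple spectra and the linear part of sigma *)

Section Eigenspaces.
Variable K : fieldType.

Lemma eigenvalue_count n (S : 'M[K]_n) (s : seq K) : uniq s ->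
  (forall a, a \in s -> eigenvalue S a) -> (size s <= n)%N.
Proof.
move=> us sS; have := @max_poly_roots _ (char_poly S) s.
rewrite size_char_poly monic_neq0 ?char_poly_monic // ltnS; apply=> //.
by apply/allP => a /sS; rewrite eigenvalue_root_char.
Qed.

(** Eigenspaces for distinct eigenvalues form a direct sum, and n of them
    already use up the n dimensions. *)
Lemma eigenspace_rank_le1 n (S : 'M[K]_n) (l : 'I_n -> K) : injective l ->
  (forall i, eigenvalue S (l i)) -> forall a, (\rank (eigenspace S a) <= 1)%N.
Proof.
move=> linj lS a.
have rk_gt0 i : (0 < \rank (eigenspace S (l i)))%N by rewrite lt0n mxrank_eq0; exact: lS.
have [/existsP [i /eqP <-]|] := boolP [exists i, l i == a].
  have /mxdirectP /= E : mxdirect (\sum_i eigenspace S (l i)).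
    by apply: mxdirect_sum_eigenspace => ? ? _ _; exact: linj.
  have := rank_leq_col (\sum_i eigenspace S (l i))%MS; rewrite E (bigD1 i) //= => h.
  have : (n.-1 <= \sum_(j < n | j != i) \rank (eigenspace S (l j)))%N.
    apply: leq_trans (_ : \sum_(j < n | j != i) 1 <= _)%N; last exact: leq_sum.
    by rewrite sum1_card cardC1 card_ord.
  have ar (r t : nat) : (r + t <= n)%N -> (n.-1 <= t)%N -> (0 < n)%N -> (r <= 1)%N by lia.
  by move=> /(ar _ _ h); apply; apply: leq_ltn_trans (ltn_ord i).
rewrite negb_exists => /forallP na.
have [->|ea] := eqVneq (eigenspace S a) 0; first by rewrite mxrank0.
have := @eigenvalue_count _ S (a :: map l (enum 'I_n)).
rewrite /= size_map size_enum_ord ltnn map_inj_uniq // enum_uniq andbT => H.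
have : false; last by [].
apply: H => [|b]; first by apply/mapP => -[i _ e]; have := na i; rewrite e eqxx.
by rewrite inE => /orP [/eqP -> //|/mapP [i _ ->]].
Qed.

(** Counting p + p elements fibre by fibre leaves no room: p values with at
    most two preimages each force every fibre to have exactly two elements, so
    a value b with at most one preimage is not taken at all. *)
Lemma two_to_one (p : nat) (f : 'I_(p + p) -> K) (b : K) :
  (size (undup (codom f)) <= p)%N ->
  (forall y, #|[pred i | f i == y]| <= 2)%N -> (#|[pred i | f i == b]| <= 1)%N ->
  size (undup (codom f)) = p /\ b \notin codom f.
Proof.
set s := undup _ => sp fib2 fibb.
have fs i : f i \in s by rewrite mem_undup codom_f.
have lt_s i : (index (f i) s < size s)%N by rewrite index_mem.
pose g i := Ordinal (lt_s i).
have gE i k : (g i == k) = (f i == nth 0 s k).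
  apply/eqP/eqP => [<-|e]; first by rewrite /= nth_index.
  by apply: val_inj; rewrite /= e index_uniq // undup_uniq.
have E : (p + p = \sum_(k < size s) #|[pred i | f i == nth 0%R s k]|)%N.
  rewrite -{1}[(p + p)%N]card_ord -sum1_card (partition_big g xpredT) //=.
  by apply: eq_bigr => k _; rewrite -sum1_card; apply: eq_bigl => i; rewrite !inE gE.
have U : (\sum_(k < size s) #|[pred i | f i == nth 0%R s k]| <= \sum_(k < size s) 2)%N.
  by apply: leq_sum => k _; exact: fib2.
rewrite sum_nat_const card_ord in U.
have sE : size s = p by lia.
split=> //; apply/negP; rewrite -mem_undup -/s => bs.
have lt_b : (index b s < size s)%N by rewrite index_mem.
pose k0 := Ordinal lt_b.
have nb : nth 0 s k0 = b by rewrite /= nth_index.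
move: E; rewrite (bigD1 k0) //= nb.
have : (\sum_(i < size s | i != k0) #|[pred i0 | f i0 == nth 0%R s i]| <= \sum_(i < size s | i != k0) 2)%N.
  by apply: leq_sum => k _; exact: fib2.
rewrite sum_nat_const cardC1 card_ord.
have ar (q r t : nat) : (q <= 1)%N -> (r <= t.-1 * 2)%N -> (p + p = q + r)%N ->
  (t <= p)%N -> (0 < t)%N -> False by lia.
by move=> h1 h2; apply: ar fibb h1 h2 sp (leq_ltn_trans (leq0n _) lt_b).
Qed.

End Eigenspaces.

Section Reflections.
Variables (K : numClosedFieldType) (p : nat).
Implicit Types (B D : 'I_p -> 'M[K]_p).

(** The product of all the 1 - D_j is annihilated by every D_j, so it
    vanishes; expanding it writes the identity as a sum of matrices whose row
    spaces lie in those of the D_j.  Hence every D_j has rank 1, and vectors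
    spanning their row spaces form a basis of common eigenvectors. *)
Lemma common_eigenbasis D :
  (forall j, D j *m D j = D j) -> (forall j k, D j *m D k = D k *m D j) ->
  (forall j, \rank (D j) <= 1)%N ->
  (forall x : 'rV_p, (forall j, x *m D j = 0) -> x = 0) ->
  exists2 U : 'M[K]_p, U \in unitmx & forall j, U *m D j = delta_mx j j *m U.
Proof.
move=> DD Dcom Drk ker0.
pose X := foldr (fun j Y => Y *m (1%:M - D j)) (1%:M : 'M[K]_p) (enum 'I_p).
have Xker j : X *m D j = 0.
  have : j \in enum 'I_p by rewrite mem_enum.
  rewrite /X; elim: (enum 'I_p) => //= k s ih; rewrite inE -mulmxA mulmxBl mul1mx.
  move=> /orP[/eqP <-|/ih h]; first by rewrite DD subrr mulmx0.
  by rewrite Dcom mulmxBr mulmxA h mul0mx subr0.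
have X0 : X = 0.
  apply/row_matrixP => i; rewrite row0; apply: ker0 => j.
  by rewrite -row_mul Xker row0.
have full : (1%:M <= \sum_j D j)%MS.
  suff : (1%:M - X <= \sum_j D j)%MS by rewrite X0 subr0.
  rewrite /X; elim: (enum 'I_p) => /= [|k s ih]; first by rewrite subrr sub0mx.
  rewrite mulmxBr mulmx1 opprB addrCA; apply: addmx_sub => //.
  by apply: submx_trans (submxMl _ _) _; exact: (sumsmx_sup k).
have rk_sum : (p <= \sum_j \rank (D j))%N.
  have := mxrankS full; rewrite mxrank1 => h; apply: leq_trans h _.
  elim/big_rec2: _ => [|j M r _ ih]; first by rewrite mxrank0.
  by have [le _] := mxrank_adds_leqif (D j) M; apply: leq_trans le _; rewrite leq_add2l.
have rk1 j : \rank (D j) = 1.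
  apply/eqP; rewrite eqn_leq Drk lt0n; apply/eqP => r0.
  move: rk_sum; rewrite (bigD1 j) //= r0 add0n leqNgt => /negP; apply.
  apply: leq_ltn_trans (_ : \sum_(i < p | i != j) 1 < p)%N; first exact: leq_sum.
  by rewrite sum1_card cardC1 card_ord; case: (p) j {r0} => [[] //|n _]; rewrite /=.
pose u j := nz_row (D j).
have u0 j : u j != 0 by rewrite nz_row_eq0 -mxrank_eq0 rk1.
have uD j : (u j <= D j)%MS by exact: nz_row_sub.
have Du j : (D j <= u j)%MS.
  have := mxrank_leqif_sup (uD j); rewrite rk1 => h.
  by rewrite -(geq_leqif h) rank_rV u0.
pose U := \matrix_j u j.
have Urow j : row j U = u j by rewrite rowK.
have Ufull : row_full U.
  rewrite -sub1mx; apply: submx_trans full _; apply/sumsmx_subP => j _.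
  by apply: submx_trans (Du j) _; rewrite -Urow row_sub.
have Uu : U \in unitmx by rewrite -row_full_unit.
exists U => // j.
apply/row_matrixP => k; rewrite !row_mul Urow.
have idem i : u i *m D i = u i.
  by have /submxP [x ->] := uD i; rewrite -mulmxA DD.
have [->|kj] := eqVneq k j.
  have -> : row j (delta_mx j j : 'M[K]_p) = delta_mx 0 j.
    by apply/rowP => i; rewrite !mxE eqxx.
  by rewrite -rowE Urow idem.
have -> : row k (delta_mx j j) = 0 :> 'rV[K]_p.
  by apply/rowP => i; rewrite !mxE (negbTE kj).
rewrite mul0mx.
have s1 : (u k *m D j <= u j)%MS by apply: submx_trans (submxMl _ _) (Du j).
have s2 : (u k *m D j <= u k)%MS.
  rewrite -{1}(idem k) -mulmxA Dcom mulmxA.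
  by apply: submx_trans (submxMl _ _) (Du k).
have /sub_rVP [a Ea] := s1; have /sub_rVP [b Eb] := s2.
have : (a *: (delta_mx 0 j : 'rV_p) - b *: delta_mx 0 k) *m U = 0.
  by rewrite mulmxBl -!scalemxAl -!rowE !Urow -Ea -Eb subrr.
move=> /(congr1 (mulmx^~ (invmx U))); rewrite mulmxK // mul0mx => /rowP /(_ j).
rewrite !mxE !eqxx /= eq_sym (negbTE kj) mulr0 subr0 mulr1 => a0.
by rewrite Ea a0 scale0r.
Qed.

End Reflections.

Section SwapMatrix.
Variables (K : comUnitRingType) (n : nat).

Definition swap_mx : 'M[K]_(n + n) := block_mx 0 1%:M 1%:M 0.

Lemma swap_mxK : swap_mx *m swap_mx = 1%:M.
Proof.
rewrite mulmx_block !mul0mx !mulmx0 !mul1mx !addr0 !add0r.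
by rewrite -scalar_mx_block.
Qed.

Lemma swap_mx_unit : swap_mx \in unitmx.
Proof. by case: (mulmx1_unit swap_mxK). Qed.

Lemma swap_block (X Y Z W : 'M[K]_n) :
  swap_mx *m block_mx X Y Z W *m swap_mx = block_mx W Z Y X.
Proof. by rewrite !mulmx_block !mul0mx !mulmx0 !mul1mx !mulmx1 !addr0 !add0r. Qed.

End SwapMatrix.

Section Sigma.
Variables (K : numClosedFieldType) (p : nat).
Local Notation conj X := (map_mx Num.conj X).
Implicit Types A B : 'M[K]_p.

(** Conjugating a map by (z, w) |-> (conj w, conj z) conjugates the entries of
    its derivative and exchanges the two blocks, so this is the derivative of
    sigma when T is that of tau_1. *)
Definition sigma_mx (T : 'M[K]_(p + p)) : 'M[K]_(p + p) :=
  swap_mx K p *m conj T *m swap_mx K p *m T.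

(** A row vector fixed by T and by the conjugate T' of T is an eigenvector of
    sigma for the eigenvalue 1, so the fixed spaces of T and T', which have the
    same dimension, meet in dimension at most 1.  Hence T - 1 has rank at least
    p, its second block column is row full, and (T - 1)(T + 1) = 0 forces
    B + 1 = 0. *)
Lemma fixed_space_forces_minus1 A B : let T := block_mx 1%:M A 0 B in
  T *m T = 1%:M -> (\rank (eigenspace (sigma_mx T) 1) <= 1)%N -> B = - 1%:M.
Proof.
move=> T TT rk1; pose T' := swap_mx K p *m conj T *m swap_mx K p.
have E' : T' - 1%:M = swap_mx K p *m conj (T - 1%:M) *m swap_mx K p.
  by rewrite map_mxB map_mx1 mulmxBr mulmxBl mulmx1 swap_mxK.
have rE : \rank (T' - 1%:M) = \rank (T - 1%:M).
  rewrite E' mxrankMfree ?row_free_unit ?swap_mx_unit //.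
  rewrite (eqmxMfull _ (_ : row_full _)) ?row_full_unit ?swap_mx_unit //.
  exact: mxrank_map.
pose X := (kermx (T - 1%:M) :&: kermx (T' - 1%:M))%MS.
have X1 : X *m T = X.
  have /sub_kermxP := capmxSl (kermx (T - 1%:M)) (kermx (T' - 1%:M)).
  by rewrite mulmxBr mulmx1 => /eqP; rewrite subr_eq0 => /eqP.
have X2 : X *m T' = X.
  have /sub_kermxP := capmxSr (kermx (T - 1%:M)) (kermx (T' - 1%:M)).
  by rewrite mulmxBr mulmx1 => /eqP; rewrite subr_eq0 => /eqP.
have /mxrankS rkX : (X <= eigenspace (sigma_mx T) 1)%MS.
  by apply/sub_kermxP; rewrite mulmxBr mulmx1 /sigma_mx -/T' mulmxA X2 X1 subrr.
have rr : (p <= \rank (T - 1%:M)%R)%N.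
  have := mxrank_sum_cap (kermx (T - 1%:M)) (kermx (T' - 1%:M)); rewrite -/X.
  have := rank_leq_col (kermx (T - 1%:M) + kermx (T' - 1%:M))%MS.
  have := rank_leq_col (T - 1%:M).
  rewrite !mxrank_ker rE; have := leq_trans rkX rk1.
  have ar (x a r : nat) : (x <= 1)%N -> (r <= p + p)%N -> (a <= p + p)%N ->
    (a + x = p + p - r + (p + p - r))%N -> (p <= r)%N by lia.
  exact: ar.
pose G := col_mx A (B - 1%:M).
have TE : T - 1%:M = row_mx 0 G.
  rewrite /T /G scalar_mx_block opp_block_mx add_block_mx !oppr0 !addr0 subrr.
  by rewrite block_mxEh col_mx0.
have Gfull : row_full G.
  rewrite /row_full eqn_leq rank_leq_col /=; apply: leq_trans rr _.
  have -> : T - 1%:M = G *m row_mx 0 1%:M by rewrite TE mul_mx_row mulmx0 mulmx1.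
  exact: mxrankM_maxl.
have /row_fullP [G' G'G] := Gfull.
have : G *m (B + 1%:M) = 0.
  have : (T - 1%:M) *m (T + 1%:M) = 0.
    by rewrite mulmxBl mulmxDr TT mulmx1 mul1mx [T + _]addrC subrr.
  have -> : T + 1%:M = col_mx (row_mx (1%:M + 1%:M) A) (row_mx 0 (B + 1%:M)).
    by rewrite /T scalar_mx_block add_block_mx !addr0.
  rewrite TE mul_row_col mul0mx add0r mul_mx_row mulmx0.
  by move=> /(congr1 rsubmx); rewrite row_mxKr => ->; rewrite -[0 in LHS]row_mx0 row_mxKr.
move=> /(congr1 (mulmx G')); rewrite mulmxA G'G mul1mx mulmx0 => /eqP.
by rewrite addr_eq0 => /eqP.
Qed.

Lemma sigma_mxE A : sigma_mx (block_mx 1%:M A 0 (- 1%:M)) =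
  block_mx (- 1%:M) (- A) (conj A) (conj A *m A - 1%:M).
Proof.
rewrite /sigma_mx map_block_mx map_mx1 map_mxN map_mx1 map_mx0 swap_block mulmx_block.
by rewrite !mulNmx !mul1mx !mulmx1 !mulmx0 !mul0mx !addr0.
Qed.

(** A kernel vector x of A yields two independent eigenvectors of sigma for
    the eigenvalue -1, one from x and one from conj x. *)
Lemma sigma_unit_block A :
  (\rank (eigenspace (sigma_mx (block_mx 1%:M A 0 (- 1%:M))) (-1)) <= 1)%N ->
  A \in unitmx.
Proof.
rewrite sigma_mxE => rk; apply: contraLR rk => nA; rewrite -ltnNge.
have [x x0 xA] : exists2 x : 'rV_p, x != 0 & x *m A = 0.
  exists (nz_row (kermx A)).
    by rewrite nz_row_eq0 kermx_eq0 row_free_unit.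
  by apply/sub_kermxP; exact: nz_row_sub.
pose y := conj x; have y0 : y != 0.
  apply: contraNneq x0 => /(congr1 (fun z => conj z)); rewrite map_mx0 => <-.
  by apply/eqP/rowP => j; rewrite !mxE conjCK.
have yA : y *m conj A = 0 by rewrite -map_mxM xA map_mx0.
pose V := block_mx x 0 0 y.
apply: leq_trans (_ : \rank V <= _)%N; first by rewrite rank_diag_block_mx !rank_rV x0 y0.
apply: mxrankS; apply/sub_kermxP.
rewrite mulmxBr mul_mx_scalar /V mulmx_block scale_block_mx !scaler0 !mul0mx !addr0 !add0r.
rewrite !mulmxN !mulmx1 xA mulmxBr mulmxA yA mul0mx oppr0 mulmx1 sub0r !scaleN1r subrr.
by [].
Qed.

(** If (x, y) is an eigenvector of sigma for l, then y conj(A) = (l + 1) x and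
    l x A = (l + 1) y, so x is an eigenvector of conj(A)^-1 A^-1 for
    l / (l + 1)^2.  The function l / (l + 1)^2 identifies l with 1 / l only and
    takes the value 1/4 only at l = 1, so [two_to_one] applies. *)
Lemma sigma_spectrum A (l : 'I_(p + p) -> K) : injective l ->
  (forall i, eigenvalue (sigma_mx (block_mx 1%:M A 0 (- 1%:M))) (l i)) ->
  A \in unitmx /\ exists2 nu : 'I_p -> K, injective nu &
    forall j, eigenvalue (conj (invmx A) *m invmx A) (nu j) /\ nu j != 4^-1.
Proof.
move=> linj lS; have rk := eigenspace_rank_le1 linj lS.
have uA : A \in unitmx by apply: sigma_unit_block; exact: rk.
split=> //; set G := invmx A; set N := conj G *m G.
have uA' : conj A \in unitmx by rewrite map_unitmx.
have AN : A *m conj A *m N = 1%:M.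
  rewrite /N mulmxA -[A *m conj A *m conj G]mulmxA -map_mxM.
  by rewrite mulmxV // map_mx1 mulmx1 mulmxV.
have ev i : [/\ l i != -1, l i != 0 & eigenvalue N (l i / (l i + 1) ^+ 2)].
  have /eigenvalueP [v] := lS i; rewrite sigma_mxE -[v]hsubmxK.
  set x := lsubmx v; set y := rsubmx v; set a := l i.
  rewrite mul_row_block scale_row_mx => /eq_row_mx [].
  rewrite !mulmxN !mulmx1 mulmxBr mulmx1 mulmxA => e1 e2 v0.
  have e1' : y *m conj A = (a + 1) *: x.
    by rewrite scalerDl scale1r -e1 addrC addrA subrr add0r.
  have e2' : a *: (x *m A) = (a + 1) *: y.
    rewrite [RHS]scalerDl scale1r -e2 e1' -scalemxAl.
    by move: (x *m A) => X; apply/rowP => k; rewrite !mxE; ring.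
  have x0 : x != 0.
    apply: contraNneq v0 => x0; rewrite x0 mul0mx !scaler0 in e1' e2'.
    have y0 : y = 0 by rewrite -[y](mulmxK uA') e1' mul0mx.
    by rewrite x0 y0 row_mx0.
  have a1 : a + 1 != 0.
    apply: contraNneq x0 => a1; rewrite a1 scale0r in e1' e2'.
    have : a != 0 by apply: contra_eq_neq a1 => ->; rewrite add0r oner_neq0.
    move=> a0; have /eqP xA : x *m A == 0.
      have : a *: (x *m A) == 0 by rewrite e2' scale0r.
      by rewrite scalemx_eq0 (negbTE a0).
    by rewrite -[x](mulmxK uA) xA mul0mx.
  have xAA : a *: (x *m A *m conj A) = (a + 1) ^+ 2 *: x.
    by rewrite scalemxAl e2' -scalemxAl e1' scalerA expr2.
  have xN : x *m N = (a / (a + 1) ^+ 2) *: x.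
    have := congr1 (fun M => (a + 1) ^- 2 *: (M *m N)) xAA.
    rewrite -!scalemxAl -!mulmxA [A *m _]mulmxA AN mulmx1 !scalerA mulVf ?expf_neq0 //.
    by rewrite scale1r mulrC => <-.
  split; first by rewrite -subr_eq0 opprK.
    apply: contraNneq x0 => a0; rewrite a0 scale0r expr2 add0r mul1r scale1r in xAA.
    by rewrite -xAA.
  by apply/eigenvalueP; exists x.
pose f i := l i / (l i + 1) ^+ 2.
have l1 i : l i + 1 != 0 by have [h _ _] := ev i; rewrite -subr_eq0 opprK in h.
have ff i j : f i = f j -> l i = l j \/ l i = (l j)^-1.
  move=> /eqP; rewrite /f eqr_div ?expf_neq0 ?l1 // -subr_eq0.
  have -> : l i * (l j + 1) ^+ 2 - l j * (l i + 1) ^+ 2 = (l i - l j) * (1 - l i * l j) by ring.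
  rewrite mulf_eq0 !subr_eq0 => /orP[/eqP|/eqP e]; first by left.
  right; have [_ lj0 _] := ev j; apply: (mulIf lj0); rewrite -e mulVf //.
have fib (s : seq 'I_(p + p)) (c : seq K) : uniq s ->
    (forall i, i \in s -> l i \in c) -> (size s <= size c)%N.
  move=> us sc; rewrite -(size_map l); apply: uniq_leq_size.
    by rewrite map_inj_uniq.
  by move=> _ /mapP [i /sc h ->].
have fib2 y : (#|[pred i | f i == y]| <= 2)%N.
  have [/existsP [i0 /eqP e0]|] := boolP [exists i, f i == y]; last first.
    rewrite negb_exists => /forallP h; rewrite eq_card0 // => i; rewrite inE.
    by apply: negbTE; exact: h.
  rewrite cardE; apply: leq_trans (fib _ [:: l i0; (l i0)^-1] (enum_uniq _) _) _ => //.
  move=> i; rewrite mem_enum inE -e0 => /eqP /ff [->|->]; rewrite !inE eqxx ?orbT //.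
have fib1 : (#|[pred i | f i == 4^-1]| <= 1)%N.
  rewrite cardE.
  apply: leq_trans (fib _ [:: 1] (enum_uniq _) _) _ => //.
  move=> i; rewrite mem_enum !inE /f => /eqP e.
  have : (l i - 1) ^+ 2 = 0.
    have e' : l i = 4^-1 * (l i + 1) ^+ 2 by rewrite -e divfK // expf_neq0.
    have -> : (l i - 1) ^+ 2 = (l i + 1) ^+ 2 - 4 * l i by ring.
    by rewrite {2}e' mulrA divff ?mul1r ?subrr // pnatr_eq0.
  by move/eqP; rewrite expf_eq0 /= subr_eq0.
have sz : (size (undup (codom f)) <= p)%N.
  apply: (@eigenvalue_count _ _ N); first exact: undup_uniq.
  move=> a; rewrite mem_undup => /codomP [i ->]; by have [] := ev i.
have [szE nb] := two_to_one sz fib2 fib1.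
exists (fun j : 'I_p => nth 0 (undup (codom f)) j).
  move=> i j /eqP; rewrite nth_uniq ?szE ?ltn_ord ?undup_uniq // => /eqP e.
  exact: val_inj.
move=> j; have : nth 0 (undup (codom f)) j \in codom f.
  by rewrite -mem_undup mem_nth // szE.
move=> h; split; last by apply: contraNneq nb => <-.
by case/codomP: h => i ->; have [] := ev i.
Qed.

End Sigma.

(** * Quadratic maps invariant under commuting reflections *)

Section Quadratic.
Variable K : numClosedFieldType.

Definition quad_map n m (M : 'I_m -> 'M[K]_n) (v : 'rV[K]_n) : 'rV[K]_m :=
  \row_j (v *m M j *m v^T) 0 0.

Lemma quad_mapE n m (M : 'I_m -> 'M[K]_n) v j :
  quad_map M v 0 j = (v *m M j *m v^T) 0 0.
Proof. by rewrite mxE. Qed.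

Definition sqr_row n (v : 'rV[K]_n) : 'rV[K]_n := map_mx (fun x => x ^+ 2) v.

Lemma form_entry n (M : 'M[K]_n) i j :
  ((delta_mx 0 i : 'rV_n) *m M *m (delta_mx 0 j : 'rV_n)^T) 0 0 = M i j.
Proof. by rewrite trmx_delta -rowE -colE !mxE. Qed.

Lemma alternating_form n (M : 'M[K]_n) :
  (forall v : 'rV_n, (v *m M *m v^T) 0 0 = 0) -> M + M^T = 0.
Proof.
move=> H; apply/matrixP => i j; rewrite [LHS]mxE [X in _ + X]mxE [RHS]mxE.
have aD (X Y : 'M[K]_1) : (X + Y) 0 0 = X 0 0 + Y 0 0 by rewrite mxE.
have := H (delta_mx 0 i + delta_mx 0 j).
by rewrite linearD /= !mulmxDl !mulmxDr !aD !H !form_entry add0r addr0 addrC.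
Qed.

Lemma form_diff n (M : 'M[K]_n) (x y : 'rV[K]_n) :
  (x *m M *m x^T) 0 0 - (y *m M *m y^T) 0 0 =
  ((x - y) *m M *m x^T) 0 0 + (y *m M *m (x - y)^T) 0 0.
Proof.
have aD (X Y : 'M[K]_1) : X 0 0 - Y 0 0 = (X - Y) 0 0 by rewrite !mxE.
by rewrite linearB mulmxBr !mulmxBl -!aD addrA subrK.
Qed.

Lemma quad_mapZ n m (M : 'I_m -> 'M[K]_n) (k : K) v :
  quad_map M (k *: v) = k ^+ 2 *: quad_map M v.
Proof.
apply/rowP => j; rewrite [RHS]mxE !quad_mapE linearZ /= -!scalemxAl -!scalemxAr.
by rewrite scalerA -expr2 [LHS]mxE.
Qed.

Lemma quad_map_sym n m (M : 'I_m -> 'M[K]_n) v :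
  quad_map (fun j => 2^-1 *: (M j + (M j)^T)) v = quad_map M v.
Proof.
apply/rowP => j; rewrite !quad_mapE.
have trE : (v *m (M j)^T *m v^T) 0 0 = (v *m M j *m v^T) 0 0.
  rewrite -[in RHS](trmxK (v *m M j *m v^T)) [in RHS]mxE.
  by rewrite !trmx_mul trmxK mulmxA.
rewrite -scalemxAr -scalemxAl mulmxDr mulmxDl [LHS]mxE [X in _ * X]mxE trE.
by move: ((v *m M j *m v^T) 0 0) => a; field.
Qed.

Section ReflectionInvariants.
Variables (p m : nat) (M : 'I_m -> 'M[K]_(p + p)).
Variables (A U : 'M[K]_p) (A_ B_ : 'I_p -> 'M[K]_p).
Local Notation T k := (block_mx 1%:M (A_ k) 0 (B_ k)).
Hypotheses (comT : forall k, T k *m block_mx 1%:M A 0 (- 1%:M) = block_mx 1%:M A 0 (- 1%:M) *m T k).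
Hypotheses (Uu : U \in unitmx).
Hypothesis UB : forall k, U *m B_ k = (1%:M - 2 *: delta_mx k k) *m U.
Hypothesis inv : forall k v, quad_map M (v *m T k) = quad_map M v.

(** Coordinates on the fibre of (z, w) |-> z, centred at the fixed point
    w = z A / 2 of the reflection w |-> z A - w and adapted to a basis U of
    common eigenvectors of the B_k. *)
Definition fibre_coord (z w : 'rV[K]_p) : 'rV[K]_p :=
  (w - 2^-1 *: (z *m A)) *m invmx U.

(** Commuting with w |-> z A - w, the k-th reflection fixes the centre z A / 2
    of each fibre. *)
Lemma reflection_offdiag k : A_ k = 2^-1 *: (A *m (1%:M - B_ k)).
Proof.
have := comT k; rewrite !mulmx_block => /eq_block_mx [_ + _ _].
rewrite !mul1mx mulmxN mulmx1 => e.
rewrite mulmxBr mulmx1.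
have -> : A - A *m B_ k = A_ k + A_ k.
  by apply/eqP; rewrite subr_eq -addrA -e addrC subrK.
by rewrite -mulr2n -scaler_nat scalerA mulVf ?scale1r // pnatr_eq0.
Qed.

Let Theta : 'M[K]_(p + p) := block_mx 1%:M (2^-1 *: A) 0 U.
Let D k : 'M[K]_p := 1%:M - 2 *: delta_mx k k.

Lemma reflection_diagonalised k : Theta *m T k = block_mx 1%:M 0 0 (D k) *m Theta.
Proof.
rewrite !mulmx_block !mul0mx !mulmx0 !mul1mx !addr0 !add0r UB.
by rewrite reflection_offdiag -scalemxAl mulmxBr mulmx1 scalerBr subrK.
Qed.

Lemma fibre_coordE z w : row_mx z w = row_mx z (fibre_coord z w) *m Theta.
Proof.
rewrite mul_row_block mulmx0 mulmx1 addr0 /fibre_coord mulmxKV //.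
by rewrite -scalemxAr addrC subrK.
Qed.

(** In the coordinates z and [fibre_coord] the reflections are the changes of
    sign of single fibre coordinates, so an invariant quadratic form contains
    the fibre coordinates only through their squares. *)
Lemma reflection_invariant_squares : exists Cm : 'M[K]_(p, m), forall z w,
  quad_map M (row_mx z w) = quad_map M (row_mx z (2^-1 *: (z *m A)))
    + sqr_row (fibre_coord z w) *m Cm.
Proof.
pose M' j := Theta *m M j *m Theta^T.
have ME v : quad_map M (v *m Theta) = quad_map M' v.
  by apply/rowP => j; rewrite !quad_mapE /M' trmx_mul !mulmxA.
pose F k : 'M[K]_(p + p) := block_mx 1%:M 0 0 (D k).
have M'F k v : quad_map M' (v *m F k) = quad_map M' v.
  by rewrite -!ME -mulmxA -reflection_diagonalised mulmxA inv.
clearbody M'.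
have DT k : (D k)^T = D k.
  by rewrite /D linearB /= trmx1 linearZ /= trmx_delta.
have FT k : (F k)^T = F k by rewrite /F tr_block_mx trmx1 !trmx0 DT.
pose S j := M' j + (M' j)^T.
have SF k j : F k *m S j *m F k = S j.
  have H (v : 'rV_(p + p)) : (v *m (F k *m M' j *m F k - M' j) *m v^T) 0 0 = 0.
    have := congr1 (fun r : 'rV[K]_m => r 0 j) (M'F k v); rewrite !quad_mapE.
    rewrite trmx_mul FT !mulmxA => e; rewrite mulmxBr mulmxBl !mulmxA.
    by rewrite [LHS]mxE e [X in _ + X]mxE subrr.
  have := alternating_form H; rewrite linearB /= !trmx_mul FT mulmxA.
  rewrite /S mulmxDr mulmxDl => h; apply/subr0_eq; rewrite -[RHS]h.
  by rewrite opprD addrACA.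
have ST j : (S j)^T = S j by rewrite /S linearD /= trmxK addrC.
pose S1 j := ulsubmx (S j); pose S2 j := ursubmx (S j); pose S4 j := drsubmx (S j).
have SE j : S j = block_mx (S1 j) (S2 j) (S2 j)^T (S4 j).
  by rewrite -{1}[S j]submxK /S1 /S2 /S4; congr block_mx; rewrite trmx_ursub ST.
clearbody S1 S2 S4.
have two x : x + x = 0 -> x = 0 :> K.
  by move/eqP; rewrite -mulr2n mulrn_eq0 /= => /eqP.
have blocks k j : S2 j *m D k = S2 j /\ D k *m S4 j *m D k = S4 j.
  have := SF k j; rewrite SE /F !mulmx_block !mul0mx !mulmx0 !mul1mx !mulmx1 !addr0 !add0r.
  by move=> /eq_block_mx [].
have S20 j : S2 j = 0.
  apply/matrixP => a k; have [+ _] := blocks k j.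
  rewrite /D mulmxBr mulmx1 -scalemxAr => /matrixP /(_ a k); rewrite !mxE.
  rewrite (bigD1 k) //= big1 => [|i ik]; last by rewrite !mxE (negbTE ik) mulr0.
  rewrite !mxE !eqxx mulr1 addr0 => e; apply: two.
  set x := S2 j a k in e *; have -> : x + x = x - (x - 2 * x) by ring.
  by rewrite e subrr.
have S4d j a k : a != k -> S4 j a k = 0.
  move=> ak; have [_] := blocks k j.
  have -> : D k = diag_mx (\row_i (if i == k then -1 else 1)).
    apply/matrixP => i i'; rewrite !mxE; case: (eqVneq i i') => [<-|ii'].
      by case: eqVneq => _ /=; [rewrite !mulr1n; ring|rewrite mulr0 subr0].
    case: (eqVneq i k) => [ik|_] /=; last by rewrite mulr0 subr0.
    by rewrite -ik eq_sym (negbTE ii') mulr0 subr0.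
  move=> /matrixP /(_ a k); rewrite mul_mx_diag mxE mul_diag_mx !mxE (negbTE ak) eqxx mul1r mulrN1 => e.
  by apply: two; rewrite -{1}e addNr.
exists (\matrix_(k, j) (2^-1 * S4 j k k)) => z w.
have quadE u v : quad_map M (row_mx u v *m Theta) =
    \row_j (2^-1 * (u *m S1 j *m u^T) 0 0) + sqr_row v *m \matrix_(k, j) (2^-1 * S4 j k k).
  rewrite ME -quad_map_sym; apply/rowP => j; rewrite [LHS]quad_mapE -/(S j) SE S20 trmx0.
  rewrite -scalemxAr -scalemxAl tr_row_mx mul_row_block !mulmx0 addr0 add0r mul_row_col.
  have aD (X Y : 'M[K]_1) : (X + Y) 0 0 = X 0 0 + Y 0 0 by rewrite mxE.
  have aZ c (X : 'M[K]_1) : (c *: X) 0 0 = c * X 0 0 by rewrite mxE.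
  rewrite aZ aD mulrDr [RHS]mxE; congr (_ + _); first by rewrite [RHS]mxE.
  rewrite mxE [RHS]mxE mulr_sumr; apply: eq_bigr => k _.
  rewrite !mxE (bigD1 k) //= big1 => [|i ik]; last by rewrite S4d ?mulr0.
  by rewrite addr0 expr2; ring.
have -> : row_mx z (2^-1 *: (z *m A)) = row_mx z 0 *m Theta.
  by rewrite mul_row_block !mul0mx mulmx1 !addr0 -scalemxAr.
rewrite (fibre_coordE z w) !quadE -addrA; congr (_ + _).
rewrite /sqr_row (_ : map_mx _ 0 = 0) ?mul0mx ?add0r //.
by apply/rowP => j; rewrite !mxE expr0n.
Qed.

End ReflectionInvariants.

(** Every row vector is a row of squares, so a row vector killed by Cm would
    give a common zero of the quadratic forms. *)
Lemma squares_coefficients_unit p (Cm U : 'M[K]_p) : U \in unitmx ->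
  (forall w : 'rV_p, sqr_row (w *m invmx U) *m Cm = 0 -> w = 0) -> Cm \in unitmx.
Proof.
move=> Uu H; apply: contraT => nC.
pose x := nz_row (kermx Cm).
have x0 : x != 0 by rewrite nz_row_eq0 kermx_eq0 row_free_unit.
have xC : x *m Cm = 0 by apply/sub_kermxP; exact: nz_row_sub.
pose y : 'rV_p := map_mx sqrtC x.
have yx : sqr_row y = x by apply/rowP => j; rewrite !mxE sqrtCK.
have := H (y *m U); rewrite mulmxK // yx => /(_ xC) yU.
have y0 : y = 0 by rewrite -[y](mulmxK Uu) yU mul0mx.
by move: x0; rewrite -yx y0 (_ : sqr_row 0 = 0) ?eqxx //; apply/rowP => j; rewrite !mxE expr0n.
Qed.

End Quadratic.

(** * Normal form of an antilinear operator *)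

Section QuadraticRoot.
Variable K : numClosedFieldType.
Implicit Types nu g : K.

(** A root of g (1 - g) = nu.  The two roots add up to 1, and the test on the
    sign selects the one to the left of 1/2. *)
Definition quad_root nu : K :=
  let d := sqrtC (1 - 4 * nu) in if 'Re d < 0 then (1 + d) / 2 else (1 - d) / 2.

Lemma ReB1 g : 'Re (1 - g) = 1 - 'Re g.
Proof. by rewrite raddfB /= (Creal_ReP 1 _) // rpred1. Qed.

Lemma quad_rootP nu : nu \isn't Num.real ->
  [/\ quad_root nu * (1 - quad_root nu) = nu, 'Re (quad_root nu) < 2^-1 &
      'Im (quad_root nu) != 0].
Proof.
move=> nr; rewrite /quad_root; set d := sqrtC _.
have dE : d ^+ 2 = 1 - 4 * nu by rewrite /d sqrtCK.
have nuE : nu = (1 - d ^+ 2) / 4 by rewrite dE; field.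
have Red : 'Re d != 0.
  apply: contraNneq nr => Rd; rewrite nuE [d]Crect Rd add0r exprMn sqrCi mulN1r opprK.
  by rewrite rpredM ?rpredV ?rpredD ?rpredX ?Creal_Im ?rpred1 ?rpred_nat.
have half_real : (2^-1 : K) \is Num.real by rewrite rpredV rpred_nat.
have ReZ (z : K) : 'Re (z / 2) = 'Re z / 2 by rewrite mulrC ReMl // mulrC.
have ImZ (z : K) : 'Im (z / 2) = 'Im z / 2 by rewrite mulrC ImMl // mulrC.
have root (t : K) : t = (1 + d) / 2 \/ t = (1 - d) / 2 -> t * (1 - t) = nu.
  by rewrite nuE => -[] ->; field.
have Imroot (t : K) : t * (1 - t) = nu -> 'Re t < 2^-1 -> 'Im t != 0.
  move=> tn _; apply: contraNneq nr => It; rewrite -tn.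
  have tr : t \is Num.real by apply/Creal_ImP.
  by rewrite rpredM // rpredB // rpred1.
have Re1 : 'Re (1 : K) = 1 by apply/Creal_ReP; exact: rpred1.
have lt_half (x : K) : x < 0 -> (1 + x) / 2 < 2^-1.
  by move=> x0; rewrite ltr_pdivrMr ?ltr0n // mulVf ?pnatr_eq0 // gtrDl.
have : [/\ (if 'Re d < 0 then (1 + d) / 2 else (1 - d) / 2) * (1 - (if 'Re d < 0 then (1 + d) / 2 else (1 - d) / 2)) = nu &
    'Re (if 'Re d < 0 then (1 + d) / 2 else (1 - d) / 2) < 2^-1].
  case: ifP => Rd.
    by split; [apply: root; left|rewrite ReZ raddfD /= Re1 lt_half].
  have Rd0 : - 'Re d < 0.
    rewrite oppr_lt0; have := Creal_Re d; rewrite realE => /orP[|le].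
      by rewrite le_eqVlt eq_sym (negbTE Red).
    by move: Rd; rewrite lt_neqAle Red le.
  by split; [apply: root; right|rewrite ReZ raddfB /= Re1 lt_half].
by case=> h1 h2; split=> //; exact: Imroot.
Qed.

Lemma quad_root_uniq nu g : nu \isn't Num.real -> g * (1 - g) = nu ->
  'Re g < 2^-1 -> g = quad_root nu.
Proof.
move=> nr gE gR; have [qE qR _] := quad_rootP nr.
have : (g - quad_root nu) * (1 - g - quad_root nu) = 0.
  have -> : (g - quad_root nu) * (1 - g - quad_root nu) =
    g * (1 - g) - quad_root nu * (1 - quad_root nu) by ring.
  by rewrite gE qE subrr.
move/eqP; rewrite mulf_eq0 !subr_eq0 => /orP[/eqP //|/eqP e].
move: qR; rewrite -e ReB1 ltrBlDr -ltrBlDl => h.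
have := lt_trans gR; have : 1 - 2^-1 = 2^-1 :> K by field.
move=> h2; rewrite h2 in h; by have := lt_trans h gR; rewrite ltxx.
Qed.

Lemma quad_root_conj nu : nu \isn't Num.real ->
  quad_root (nu^*) = (quad_root nu)^*.
Proof.
move=> nr; have [qE qR _] := quad_rootP nr; apply/esym/quad_root_uniq.
- by move: nr; rewrite !CrealE conjCK eq_sym.
- by rewrite -[in RHS]qE rmorphM rmorphB rmorph1.
- by rewrite Re_conj.
Qed.

End QuadraticRoot.

Lemma conj_mxK (K : numClosedFieldType) m n (X : 'M[K]_(m, n)) :
  map_mx Num.conj (map_mx Num.conj X) = X.
Proof. by apply/matrixP => i j; rewrite !mxE conjCK. Qed.

Section AntilinearNormalForm.
Variables (K : numClosedFieldType) (p : nat) (G : 'M[K]_p) (nu : 'I_p -> K).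
Local Notation conj X := (map_mx Num.conj X).
Hypotheses (Gu : G \in unitmx) (nu_inj : injective nu).
Hypothesis nuP : forall j, eigenvalue (conj G *m G) (nu j).
Hypothesis nu_quarter : forall j, nu j != 4^-1.

Let N := conj G *m G.
(* An antilinear operator with square N. *)
Let J (x : 'rV[K]_p) := conj x *m G.

Let JJ x : J (J x) = x *m N.
Proof. by rewrite /J map_mxM conj_mxK -mulmxA. Qed.

Let JZ a x : J (a *: x) = a^* *: J x.
Proof. by rewrite /J map_mxZ -scalemxAl. Qed.

Let J0 x : (J x == 0) = (x == 0).
Proof.
apply/eqP/eqP => [h|->]; last by rewrite /J map_mx0 mul0mx.
rewrite -[x]conj_mxK -[conj x](mulmxK Gu) [conj x *m G]h mul0mx map_mx0 //.
Qed.

Let JN x a : x *m N = a *: x -> J x *m N = a^* *: J x.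
Proof. by move=> h; rewrite -(JJ (J x)) (JJ x) h JZ. Qed.

Let simple a : (\rank (eigenspace N a) <= 1)%N.
Proof. exact: (eigenspace_rank_le1 nu_inj nuP). Qed.

Let proportional a (x y : 'rV[K]_p) : x != 0 -> x *m N = a *: x ->
  y *m N = a *: y -> exists c, y = c *: x.
Proof.
move=> x0 xN yN; apply/sub_rVP.
have xe : (x <= eigenspace N a)%MS by apply/eigenspaceP.
have ye : (y <= eigenspace N a)%MS by apply/eigenspaceP.
apply: submx_trans ye _; rewrite -(geq_leqif (mxrank_leqif_sup xe)).
by rewrite rank_rV x0 simple.
Qed.

(** The operator J maps eigenvectors of N for a to eigenvectors for conj a, and
    N has no room for an eigenvalue outside nu. *)
Let nu_conj i : exists k, nu k = (nu i)^*.
Proof.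
have /eigenvalueP [x xN x0] := nuP i.
apply: contrapT => no.
have := @eigenvalue_count _ _ N ((nu i)^* :: map nu (enum 'I_p)).
rewrite /= size_map size_enum_ord ltnn => H; have : false; last by [].
apply: H.
  rewrite map_inj_uniq // enum_uniq andbT; apply/mapP => -[k _ e].
  by apply: no; exists k.
move=> a; rewrite inE => /orP[/eqP ->|/mapP [k _ ->]]; last exact: nuP.
by apply/eigenvalueP; exists (J x); [exact: JN|rewrite J0].
Qed.

(** On the eigenline of a real eigenvalue, J is x |-> c x for some scalar c, so
    nu_i = |c|^2; multiplying x by a square root of c changes c into |c|. *)
Let real_vector i : exists y, [/\ y != 0, y *m N = nu i *: y &
  nu i \is Num.real -> [/\ J y = sqrtC (nu i) *: y, 0 < sqrtC (nu i) & sqrtC (nu i) != 2^-1]].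
Proof.
have /eigenvalueP [x xN x0] := nuP i.
have [nr|nr] := boolP (nu i \is Num.real); last by exists x; split.
have JxN : J x *m N = nu i *: J x by rewrite (JN xN) (CrealP nr).
have [c Jx] := proportional x0 xN JxN.
have nuE : nu i = `|c| ^+ 2.
  have : nu i *: x = (c^* * c) *: x.
    by rewrite -xN -[x *m N]JJ Jx JZ Jx scalerA.
  move/eqP; rewrite -subr_eq0 -scalerBl scaler_eq0 (negbTE x0) orbF subr_eq0 => /eqP ->.
  by rewrite normCK mulrC.
have c0 : c != 0.
  by apply: contraNneq x0 => c0; rewrite -J0 Jx c0 scale0r.
have sE : sqrtC (nu i) = `|c| by rewrite nuE sqrCK.
exists (sqrtC c *: x); split.
- by rewrite scaler_eq0 sqrtC_eq0 negb_or c0.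
- by rewrite -scalemxAl xN scalerA mulrC -scalerA.
move=> _; rewrite sE; split.
- rewrite JZ Jx !scalerA; congr (_ *: _).
  have h (d : K) : d^* * d ^+ 2 = `|d ^+ 2| * d by rewrite normrX normCK; ring.
  by have := h (sqrtC c); rewrite sqrtCK.
- by rewrite normr_gt0.
- by apply: contraNneq (nu_quarter i) => h; rewrite nuE h; apply/eqP; field.
Qed.

(** The real eigenvalues on either side of 1/4, and then two halves of the
    nonreal ones that conjugation exchanges. *)
Definition elliptic_index : pred 'I_p :=
  [pred i | (nu i \is Num.real) && (sqrtC (nu i) < 2^-1)].
Definition hyperbolic_index : pred 'I_p :=
  [pred i | (nu i \is Num.real) && ~~ (sqrtC (nu i) < 2^-1)].
Definition upper_index : pred 'I_p :=
  [pred i | (nu i \isn't Num.real) && (0 < 'Im (quad_root (nu i)))].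
Definition lower_index : pred 'I_p :=
  [pred i | (nu i \isn't Num.real) && ~~ (0 < 'Im (quad_root (nu i)))].

Lemma star_swaps (star : 'I_p -> 'I_p) : (forall i, nu (star i) = (nu i)^*) ->
  forall i, (lower_index i) = (upper_index (star i)).
Proof.
move=> starP i; rewrite /upper_index /lower_index /= starP.
have -> : ((nu i)^* \is Num.real) = (nu i \is Num.real).
  by rewrite !CrealE conjCK eq_sym.
have [//|nr /=] := boolP (nu i \is Num.real).
rewrite quad_root_conj // Im_conj oppr_gt0; have [_ _ I0] := quad_rootP nr.
by rewrite -real_leNgt ?rpred0 ?Creal_Im // le_eqVlt (negbTE I0).
Qed.

Lemma card_classes : (#|elliptic_index| + #|hyperbolic_index| + (#|upper_index| + #|upper_index|) = p)%N.
Proof.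
have [star starP] := choice nu_conj.
have star_inj : injective star.
  by move=> i j e; apply/nu_inj/(inv_inj (@conjCK K)); rewrite -!starP e.
have cE : #|lower_index| = #|upper_index|.
  rewrite -!sum1_card [RHS](reindex_inj star_inj) /=.
  by apply: eq_bigl => i; rewrite -[RHS](star_swaps starP).
rewrite -{2}cE -[RHS]card_ord -(cardC [pred i | nu i \is Num.real]).
rewrite -(cardID [pred i | sqrtC (nu i) < 2^-1] [pred i | nu i \is Num.real]).
rewrite -(cardID [pred i | 0 < 'Im (quad_root (nu i))] [predC [pred i | nu i \is Num.real]]).
by congr ((_ + _) + (_ + _))%N; apply: eq_card => i;
  rewrite /elliptic_index /hyperbolic_index /upper_index /lower_index !inE /= ?inE // andbC.
Qed.

(** The rows of X are eigenvectors of N.  For a real eigenvalue nu the row is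
    one on which J is the multiplication by the square root of nu.  A pair of
    nonreal eigenvalues, nu = g (1 - g) and its conjugate, contributes an
    eigenvector y for nu and J y / (1 - conj g), which J exchanges up to the
    factors 1 - conj g and g.  The rows span all the eigenspaces, and there are
    p of them. *)
Lemma antilinear_normal_form : exists (e h s : nat) (E : (e + h + (s + s))%N = p)
    (ge : 'rV[K]_e) (gh : 'rV[K]_h) (gs : 'rV[K]_s) (X : 'M[K]_(e + h + (s + s), p)),
  [/\ (forall i, 0 < ge 0 i < 2^-1), (forall i, 2^-1 < gh 0 i),
      (forall i, 'Re (gs 0 i) < 2^-1 /\ 0 < 'Im (gs 0 i)), row_free X &
      block_mx (block_mx (diag_mx ge) 0 0 (diag_mx gh)) 0
        0 (block_mx 0 (1%:M - diag_mx (conj gs)) (diag_mx gs) 0) *m X = conj X *m G].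
Proof.
have [y yP] := choice real_vector; have [star starP] := choice nu_conj.
have yN i : y i *m N = nu i *: y i by have [] := yP i.
have y0 i : y i != 0 by have [] := yP i.
have rE (a : 'I_#|elliptic_index|) : nu (enum_val a) \is Num.real /\ sqrtC (nu (enum_val a)) < 2^-1.
  by have := enum_valP a; rewrite unfold_in => /andP.
have rH (a : 'I_#|hyperbolic_index|) : nu (enum_val a) \is Num.real /\ ~~ (sqrtC (nu (enum_val a)) < 2^-1).
  by have := enum_valP a; rewrite unfold_in => /andP.
have rC (a : 'I_#|upper_index|) : nu (enum_val a) \isn't Num.real /\ 0 < 'Im (quad_root (nu (enum_val a))).
  by have := enum_valP a; rewrite unfold_in => /andP.
pose xe := \matrix_(a < #|elliptic_index|) y (enum_val a).
pose xh := \matrix_(a < #|hyperbolic_index|) y (enum_val a).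
pose xs := \matrix_(a < #|upper_index|) y (enum_val a).
pose xt := \matrix_(a < #|upper_index|) ((1 - (quad_root (nu (enum_val a)))^*)^-1 *: J (y (enum_val a))).
pose X := col_mx (col_mx xe xh) (col_mx xs xt).
have q1 (a : 'I_#|upper_index|) : 1 - (quad_root (nu (enum_val a)))^* != 0.
  have [nr _] := rC a; have [qE _ _] := quad_rootP nr.
  rewrite -(rmorph1 Num.conj) -rmorphB conjC_eq0; apply: contraNneq nr => q0.
  by rewrite -qE q0 mulr0 rpred0.
exists #|elliptic_index|, #|hyperbolic_index|, #|upper_index|, card_classes.
exists (\row_a sqrtC (nu (enum_val a))), (\row_a sqrtC (nu (enum_val a))).
exists (\row_a quad_root (nu (enum_val a))), X; split.
- move=> a; rewrite mxE; have [nr lt] := rE a.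
  by have [_ _ /(_ nr) [_ -> _]] := yP (enum_val a).
- move=> a; rewrite mxE; have [nr nlt] := rH a.
  have [_ _ /(_ nr) [_ g0 g2]] := yP (enum_val a).
  have gr : sqrtC (nu (enum_val a)) \is Num.real by exact: gtr0_real.
  have hr : (2^-1 : K) \is Num.real by rewrite rpredV rpred_nat.
  by rewrite lt_neqAle eq_sym g2 real_leNgt.
- move=> a; rewrite mxE; have [nr lt] := rC a; have [_ h _] := quad_rootP nr.
  by split.
- rewrite /row_free eqn_leq rank_leq_row /=.
  have cover i : (eigenspace N (nu i) <= X)%MS.
    have key (v : 'rV_p) : v != 0 -> v *m N = nu i *: v -> (v <= X)%MS -> (eigenspace N (nu i) <= X)%MS.
      move=> v0 vN; apply: submx_trans.
      have ve : (v <= eigenspace N (nu i))%MS by apply/eigenspaceP.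
      by rewrite -(geq_leqif (mxrank_leqif_sup ve)) rank_rV v0 simple.
    have up (Z : 'rV_p) : (Z <= col_mx xe xh)%MS -> (Z <= X)%MS.
      move=> h; apply: submx_trans h _; apply: submx_trans (addsmxSl _ (col_mx xs xt)) _.
      by rewrite addsmxE.
    have down (Z : 'rV_p) : (Z <= col_mx xs xt)%MS -> (Z <= X)%MS.
      move=> h; apply: submx_trans h _; apply: submx_trans (addsmxSr (col_mx xe xh) _) _.
      by rewrite addsmxE.
    have [nr|nr] := boolP (nu i \is Num.real).
      apply: (key (y i)) => //; apply: up; rewrite -addsmxE.
      have [lt|nlt] := boolP (sqrtC (nu i) < 2^-1).
        have ie : i \in elliptic_index by rewrite unfold_in nr.
        apply: submx_trans (addsmxSl _ _); rewrite -[i](enum_rankK_in ie) //.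
        by rewrite -(rowK (fun a : 'I_#|elliptic_index| => y (enum_val a))) row_sub.
      have ih : i \in hyperbolic_index by rewrite unfold_in nr.
      apply: submx_trans (addsmxSr _ _); rewrite -[i](enum_rankK_in ih) //.
      by rewrite -(rowK (fun a : 'I_#|hyperbolic_index| => y (enum_val a))) row_sub.
    have [lt|nlt] := boolP (0 < 'Im (quad_root (nu i))).
      have ic : i \in upper_index by rewrite unfold_in nr.
      apply: (key (y i)) => //; apply: down; rewrite -addsmxE.
      apply: submx_trans (addsmxSl _ _); rewrite -[i](enum_rankK_in ic) //.
      by rewrite -(rowK (fun a : 'I_#|upper_index| => y (enum_val a))) row_sub.
    have ic' : upper_index (star i) by rewrite -(star_swaps starP) /lower_index /= nr.
    have ic : star i \in upper_index by exact: ic'.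
    pose a := enum_rank_in ic (star i).
    have aE : enum_val a = star i by exact: enum_rankK_in.
    apply: (key (row a xt)).
    + by rewrite rowK scaler_eq0 invr_eq0 negb_or q1 J0 y0.
    + have e : (nu (enum_val a))^* = nu i by rewrite aE starP conjCK.
      by rewrite rowK -scalemxAl (JN (yN _)) e !scalerA mulrC.
    + apply: down; rewrite -addsmxE; apply: submx_trans (addsmxSr _ _).
      exact: row_sub.
  have /mxdirectP /= dE : mxdirect (\sum_i eigenspace N (nu i)).
    by apply: mxdirect_sum_eigenspace => ? ? _ _; exact: nu_inj.
  rewrite [X in (X <= _)%N]card_classes.
  apply: leq_trans (_ : \rank (\sum_i eigenspace N (nu i))%MS <= _)%N.
    rewrite dE; apply: leq_trans (_ : \sum_(i < p) 1 <= _)%N; first by rewrite sum1_card card_ord.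
    by apply: leq_sum => i _; rewrite lt0n mxrank_eq0; exact: nuP.
  by apply: mxrankS; apply/sumsmx_subP => i _.
rewrite /X mul_block_col !mul0mx addr0 add0r !mul_block_col !mul0mx !addr0 !add0r.
rewrite !map_col_mx !mul_col_mx.
have Jrow n (Z : 'M[K]_(n, p)) a : row a (conj Z *m G) = J (row a Z).
  by rewrite row_mul /J map_row.
have rowD n (d : 'rV_n) (Z : 'M[K]_(n, p)) a : row a (diag_mx d *m Z) = d 0 a *: row a Z.
  by rewrite row_mul row_diag_mx -scalemxAl -rowE.
congr (col_mx (col_mx _ _) (col_mx _ _)); apply/row_matrixP => a; rewrite Jrow.
- rewrite rowD mxE !rowK; have [nr _] := rE a.
  by have [_ _ /(_ nr) [-> _ _]] := yP (enum_val a).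
- rewrite rowD mxE !rowK; have [nr _] := rH a.
  by have [_ _ /(_ nr) [-> _ _]] := yP (enum_val a).
- rewrite mulmxBl mul1mx [LHS]linearB /= rowD -[X in X - _]scale1r -scalerBl.
  by rewrite !mxE !rowK scalerA divff ?scale1r.
- rewrite rowD !mxE !rowK JZ JJ yN scalerA; congr (_ *: _).
  have [nr _] := rC a; have [qE _ _] := quad_rootP nr.
  rewrite fmorphV rmorphB rmorph1 /= conjCK -[X in _ * X]qE mulrC -mulrA divff ?mulr1 //.
  by rewrite -conjC_eq0 rmorphB rmorph1; exact: q1.
Qed.

End AntilinearNormalForm.

(** * Linear deck transformations *)

Section LinearDecks.
Variable K : numClosedFieldType.

Lemma hyperplane_rank n (T : 'M[K]_n) (a : 'cV[K]_n) : a != 0 ->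
  (forall u : 'rV[K]_n, u *m a = 0 -> u *m T = u) -> (\rank (T - 1%:M)%R <= 1)%N.
Proof.
move=> a0 H.
have le : (kermx a <= kermx (T - 1%:M))%MS.
  apply/sub_kermxP/row_matrixP => i; rewrite row0 row_mul mulmxBr mulmx1 H ?subrr //.
  by rewrite -row_mul mulmx_ker row0.
have := mxrankS le; rewrite !mxrank_ker => h.
have ra : (\rank a <= 1)%N by exact: rank_leq_col.
have rT : (\rank (T - 1%:M)%R <= n)%N by exact: rank_leq_row.
have ran : (\rank a <= n)%N by exact: rank_leq_row.
have ar (x y : nat) : (n - x <= n - y)%N -> (x <= 1)%N -> (y <= n)%N -> (x <= n)%N -> (y <= 1)%N.
  by move=> h1 h2 h3 h4; rewrite leq_sub2lE // in h1; exact: leq_trans h1 h2.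
exact: ar h ra rT ran.
Qed.

Variables (p m : nat) (M : 'I_m -> 'M[K]_(p + p)).
Variables (T : 'I_p -> 'M[K]_(p + p)) (A_ B_ : 'I_p -> 'M[K]_p).
Hypothesis TE : forall j, T j = block_mx 1%:M (A_ j) 0 (B_ j).
Hypothesis TT : forall j, T j *m T j = 1%:M.
Hypothesis Tcom : forall j k, T j *m T k = T k *m T j.
Hypothesis Trk : forall j, (\rank (T j - 1%:M)%R <= 1)%N.
Hypothesis qT : forall j v, quad_map M (v *m T j) = quad_map M v.

(** With row vectors, the derivative of a composite f \o g is the product of
    the derivatives of g and f in this order. *)
Definition total_deck : 'M[K]_(p + p) := \big[(fun X Z => Z *m X)/1%:M]_(j < p) T j.

(** The simple spectrum of sigma makes the product of the reflections equal to
    (z, w) |-> (z, z A - w).  A vector fixed by all the B_k is then fixed by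
    -1, so it is zero, and the projections (1 - B_k) / 2 fulfil the hypotheses
    of [common_eigenbasis]. *)
Lemma linear_deck_structure (l : 'I_(p + p) -> K) : injective l ->
  (forall i, eigenvalue (sigma_mx total_deck) (l i)) ->
  exists (A U : 'M[K]_p) (nu : 'I_p -> K),
  [/\ A \in unitmx /\ U \in unitmx,
      forall k, U *m B_ k = (1%:M - 2 *: delta_mx k k) *m U,
      forall k, T k *m block_mx 1%:M A 0 (- 1%:M) = block_mx 1%:M A 0 (- 1%:M) *m T k,
      forall v, quad_map M (v *m block_mx 1%:M A 0 (- 1%:M)) = quad_map M v &
      injective nu /\ forall j, eigenvalue (map_mx Num.conj (invmx A) *m invmx A) (nu j)
        /\ nu j != 4^-1].
Proof.
move=> linj lS; pose Y := total_deck.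
have bl (A A' B B' : 'M[K]_p) : block_mx 1%:M A 0 B *m block_mx 1%:M A' 0 B'
    = block_mx 1%:M (A' + A *m B') 0 (B *m B').
  by rewrite mulmx_block !mul1mx !mul0mx !mulmx0 !addr0 !add0r.
have BB j : B_ j *m B_ j = 1%:M.
  by have := TT j; rewrite TE bl scalar_mx_block => /eq_block_mx [_ _ _].
have Bcom j k : B_ j *m B_ k = B_ k *m B_ j.
  by have := Tcom j k; rewrite !TE !bl => /eq_block_mx [_ _ _].
have [A [B [YE YT YY Yq Yfix]]] : exists A B, [/\ Y = block_mx 1%:M A 0 B,
    forall k, Y *m T k = T k *m Y, Y *m Y = 1%:M,
    forall v, quad_map M (v *m Y) = quad_map M v &
    forall x : 'rV[K]_p, (forall k, x *m B_ k = x) -> x *m B = x].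
  rewrite /Y /total_deck; elim/big_rec: _ => [|j Z _ [A [B [ZE ZT ZZ Zq Zfix]]]].
    exists 0, 1%:M; split.
    - by rewrite scalar_mx_block.
    - by move=> k; rewrite mul1mx mulmx1.
    - by rewrite mul1mx.
    - by move=> v; rewrite mulmx1.
    - by move=> x _; rewrite mulmx1.
  exists (A_ j + A *m B_ j), (B *m B_ j); split.
  - by rewrite ZE TE bl.
  - by move=> k; rewrite -mulmxA Tcom mulmxA ZT -mulmxA.
  - by rewrite -mulmxA [T j *m _]mulmxA -ZT -[Z *m T j *m T j]mulmxA TT mulmx1.
  - by move=> v; rewrite mulmxA qT Zq.
  - by move=> x hx; rewrite mulmxA Zfix ?hx.
have rk := eigenspace_rank_le1 linj lS.
have B1 : B = - 1%:M.
  apply: (@fixed_space_forces_minus1 K p A B); first by rewrite -YE.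
  by rewrite -YE; exact: rk.
rewrite B1 in YE Yfix; rewrite -/Y YE in lS.
have [Au [nu nu_inj nuP]] := sigma_spectrum linj lS.
pose D j : 'M[K]_p := 2^-1 *: (1%:M - B_ j).
have n2 : (2 : K) != 0 by rewrite pnatr_eq0.
have DD j : D j *m D j = D j.
  rewrite /D -scalemxAl -scalemxAr mulmxBl mul1mx mulmxBr mulmx1 BB.
  have -> : 1%:M - B_ j - (B_ j - 1%:M) = (2 : K) *: (1%:M - B_ j).
    by rewrite scaler_nat mulr2n opprB.
  by rewrite [X in _ *: X]scalerA mulVf // scale1r.
have Dcom j k : D j *m D k = D k *m D j.
  rewrite /D -!scalemxAl -!scalemxAr !mulmxBl !mulmxBr !mul1mx !mulmx1 Bcom.
  congr (_ *: (_ *: _)); rewrite !opprB !addrA [LHS]addrAC [RHS]addrAC.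
  by congr (_ + _); exact: addrAC.
have Drk j : (\rank (D j) <= 1)%N.
  have -> : D j = row_mx 0 1%:M *m (T j - 1%:M) *m col_mx 0 (- 2^-1)%:M.
    rewrite TE scalar_mx_block opp_block_mx add_block_mx !oppr0 !addr0 subrr.
    rewrite mul_row_block !mul0mx !mul1mx !add0r mul_row_col mul0mx add0r mul_mx_scalar.
    by rewrite /D scaleNr -scalerN opprB.
  by apply: leq_trans (mxrankM_maxl _ _) _; apply: leq_trans (mxrankM_maxr _ _) (Trk j).
have ker0 (x : 'rV[K]_p) : (forall j, x *m D j = 0) -> x = 0.
  move=> h; have : x *m - 1%:M = x.
    apply: Yfix => k; have := h k; rewrite /D -scalemxAr => /eqP.
    by rewrite scalemx_eq0 invr_eq0 (negbTE n2) /= mulmxBr mulmx1 subr_eq0 => /eqP <-.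
  rewrite mulmxN mulmx1 => /eqP; rewrite eq_sym -addr_eq0 -mulr2n -scaler_nat.
  by rewrite scalemx_eq0 (negbTE n2) => /eqP.
have [U Uu UD] := common_eigenbasis DD Dcom Drk ker0.
exists A, U, nu; split=> //.
- move=> k.
  have -> : B_ k = 1%:M - (2 : K) *: D k.
    by rewrite /D scalerA divff // scale1r opprB addrC subrK.
  by rewrite mulmxBr mulmx1 -scalemxAr UD mulmxBl mul1mx -scalemxAl.
- by move=> k; rewrite -YE YT.
- by move=> v; rewrite -YE Yq.
Qed.

End LinearDecks.

(** * Normal coordinates of a quadric *)

Section Shear.
Variables (K : fieldType) (n : nat).
Implicit Types (P Q : 'M[K]_n) (r : 'rV[K]_n -> 'rV[K]_n).

Definition shear P Q r (v : 'rV[K]_(n + n)) : 'rV[K]_(n + n) :=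
  row_mx (lsubmx v *m P) ((rsubmx v - r (lsubmx v)) *m Q).

Lemma shear0 P Q r : r 0 = 0 -> shear P Q r 0 = 0.
Proof. by move=> r0; rewrite /shear !linear0 r0 subr0 !mul0mx row_mx0. Qed.

Definition shear_inverse P Q r (x : 'rV[K]_n) : 'rV[K]_n := - (r (x *m invmx P) *m Q).

Lemma shear_inverse0 P Q r : r 0 = 0 -> shear_inverse P Q r 0 = 0.
Proof. by move=> r0; rewrite /shear_inverse mul0mx r0 mul0mx oppr0. Qed.

Lemma shearK P Q r : P \in unitmx -> Q \in unitmx ->
  cancel (shear P Q r) (shear (invmx P) (invmx Q) (shear_inverse P Q r)).
Proof.
move=> Pu Qu v; rewrite /shear row_mxKl row_mxKr /shear_inverse mulmxK //.
by rewrite opprK -mulmxDl subrK mulmxK // hsubmxK.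
Qed.

Lemma shearKV P Q r : P \in unitmx -> Q \in unitmx ->
  cancel (shear (invmx P) (invmx Q) (shear_inverse P Q r)) (shear P Q r).
Proof.
move=> Pu Qu v; rewrite /shear row_mxKl row_mxKr /shear_inverse mulmxKV // opprK.
by rewrite [_ *m invmx Q]mulmxDl mulmxK // addrK mulmxKV // hsubmxK.
Qed.

End Shear.

Section NormalCoordinates.
Variable K : numClosedFieldType.
Local Notation conj := (map_mx Num.conj).

(** In the basis X of [antilinear_normal_form], conj X = gamma^T X A, which
    turns w - z A / 2 at w = conj z into a multiple of z - 2 gamma conj z. *)
Lemma fibre_coord_normal_form p (A U : 'M[K]_p) (nu : 'I_p -> K) :
  A \in unitmx -> U \in unitmx -> injective nu ->
  (forall j, eigenvalue (conj (invmx A) *m invmx A) (nu j) /\ nu j != 4^-1) ->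
  exists (e h s : nat) (E : (e + h + (s + s))%N = p)
    (ge : 'rV[K]_e) (gh : 'rV[K]_h) (gs : 'rV[K]_s) (B P : 'M[K]_p),
  [/\ [/\ forall i, 0 < ge 0 i < 2^-1, forall i, 2^-1 < gh 0 i &
       forall i, 'Re (gs 0 i) < 2^-1 /\ 0 < 'Im (gs 0 i)],
      B \in unitmx, P \in unitmx &
      forall z : 'rV[K]_p, fibre_coord A U z (conj z) =
        (z *m P - 2 *: (conj (z *m P) *m (castmx (E, E)
          (block_mx (block_mx (diag_mx ge) 0 0 (diag_mx gh)) 0
            0 (block_mx 0 (diag_mx gs) (1%:M - diag_mx (conj gs)) 0)))^T)) *m B^T].
Proof.
move=> Au Uu nui nuP.
have Gu : invmx A \in unitmx by rewrite unitmx_inv.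
have [e [h [s [E [ge [gh [gs [X [h1 h2 h3 Xf XG]]]]]]]]] :=
  antilinear_normal_form Gu nui (fun j => (nuP j).1) (fun j => (nuP j).2).
subst p; rewrite row_free_unit in Xf.
exists e, h, s, erefl, ge, gh, gs, (- 2^-1 *: (X *m A *m invmx U))^T, (invmx X); split=> //.
- rewrite unitmx_tr unitmxZ ?unitfE ?oppr_eq0 ?invr_eq0 ?pnatr_eq0 //.
  by rewrite !unitmx_mul Xf Au unitmx_inv.
- by rewrite unitmx_inv.
move=> z; rewrite castmx_id trmxK !tr_block_mx !tr_diag_mx !trmx0 linearB /= tr_diag_mx trmx1.
set G0 := block_mx _ _ _ _ in XG *.
have cX : conj X = G0 *m X *m A by rewrite XG mulmxKV.
rewrite /fibre_coord; set u := z *m invmx X.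
have -> : z = u *m X by rewrite /u mulmxKV.
rewrite map_mxM cX; clearbody u G0.
rewrite !mulmxA.
have e1 : u *m X *m A *m invmx U = u *m (X *m A *m invmx U) by rewrite !mulmxA.
have e2 : conj u *m G0 *m X *m A *m invmx U = conj u *m G0 *m (X *m A *m invmx U) by rewrite !mulmxA.
rewrite mulmxBl -scalemxAl e1 e2; move: (X *m A *m invmx U) => Y.
rewrite -scalemxAr mulmxBl -[in RHS]scalemxAl scalerBr scalerA scaleNr mulNr mulVf ?pnatr_eq0 //.
by rewrite scaleNr scale1r opprK addrC.
Qed.

End NormalCoordinates.

Section QuadricForms.
Variable K : numClosedFieldType.

Lemma quad_map0 n m (M : 'I_m -> 'M[K]_n) : quad_map M 0 = 0.
Proof. by apply/rowP => j; rewrite quad_mapE mul0mx mul0mx mxE [RHS]mxE. Qed.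

Lemma quad_map_hq p (h q : 'I_p -> 'M[K]_p) (z w : 'rV[K]_p) :
  \row_j (\sum_k \sum_l h j k l * z 0 k * w 0 l + \sum_k \sum_l q j k l * w 0 k * w 0 l)
  = quad_map (fun j => block_mx 0 (h j) 0 (q j)) (row_mx z w).
Proof.
have fE (x y : 'rV[K]_p) (N : 'M[K]_p) :
    (x *m N *m y^T) 0 0 = \sum_k \sum_l N k l * x 0 k * y 0 l.
  rewrite exchange_big mxE; apply: eq_bigr => l _ /=.
  by rewrite !mxE mulr_suml; apply: eq_bigr => k _; rewrite (mulrC (x 0 k)).
apply/rowP => j; rewrite quad_mapE mxE -!fE.
rewrite mul_row_block !mulmx0 addr0 tr_row_mx mul_row_col mul0mx add0r mulmxDl [RHS]mxE //.
Qed.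

Lemma quad_map_squares p (W : 'M[K]_(p + p, p)) (z w : 'rV[K]_p) :
  sqr_row (row_mx z w *m W) = quad_map (fun j => col j W *m (col j W)^T) (row_mx z w).
Proof.
apply/rowP => j; rewrite quad_mapE mxE expr2; set v := row_mx z w.
have -> : v *m (col j W *m (col j W)^T) *m v^T = (v *m col j W) *m (v *m col j W)^T.
  by rewrite trmx_mul !mulmxA.
by rewrite colE mulmxA -colE [RHS]mxE big_ord1 [_^T _ _]mxE [col _ _ _ _]mxE.
Qed.

Lemma squares_linear_forms p (B gamma : 'M[K]_p) (z w : 'rV[K]_p) :
  \row_j ((B *m (z^T - 2 *: (gamma *m w^T))) j 0) ^+ 2
  = sqr_row ((z - 2 *: (w *m gamma^T)) *m B^T).
Proof.
have -> : B *m (z^T - 2 *: (gamma *m w^T)) = ((z - 2 *: (w *m gamma^T)) *m B^T)^T.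
  rewrite trmx_mul trmxK; congr (_ *m _); rewrite linearB /=; congr (_ - _).
  by apply/matrixP => i j; rewrite -[w in RHS]trmxK -trmx_mul !mxE.
by apply/rowP => j; rewrite !mxE.
Qed.

Definition square_forms_mx p (B gamma : 'M[K]_p) : 'I_p -> 'M[K]_(p + p) :=
  let W := col_mx B^T (- 2 *: (gamma^T *m B^T)) in fun j => col j W *m (col j W)^T.

Lemma square_forms_quad_map p (B gamma : 'M[K]_p) (z w : 'rV[K]_p) :
  sqr_row ((z - 2 *: (w *m gamma^T)) *m B^T) = quad_map (square_forms_mx B gamma) (row_mx z w).
Proof.
rewrite -quad_map_squares mul_row_col mulmxBl -scalemxAr -scalemxAl mulmxA.
by rewrite scaleNr.
Qed.

Local Notation conj := (map_mx Num.conj).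

(** The summand depending on z alone can be subtracted from z'' by a
    holomorphic change of coordinates, and Q can be absorbed in z''. *)
Lemma normal_coordinates p (M : 'I_p -> 'M[K]_(p + p)) (A U : 'M[K]_p)
    (A_ B_ : 'I_p -> 'M[K]_p) (nu : 'I_p -> K) :
  A \in unitmx /\ U \in unitmx ->
  (forall k, U *m B_ k = (1%:M - 2 *: delta_mx k k) *m U) ->
  (forall k, block_mx 1%:M (A_ k) 0 (B_ k) *m block_mx 1%:M A 0 (- 1%:M)
        = block_mx 1%:M A 0 (- 1%:M) *m block_mx 1%:M (A_ k) 0 (B_ k)) ->
  (forall k v, quad_map M (v *m block_mx 1%:M (A_ k) 0 (B_ k)) = quad_map M v) ->
  injective nu /\ (forall j, eigenvalue (conj (invmx A) *m invmx A) (nu j) /\ nu j != 4^-1) ->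
  (forall w, quad_map M (row_mx 0 w) = 0 -> w = 0) ->
  exists (e h s : nat) (E : (e + h + (s + s))%N = p)
    (ge : 'rV[K]_e) (gh : 'rV[K]_h) (gs : 'rV[K]_s) (B P Q : 'M[K]_p) (N : 'I_p -> 'M[K]_p),
  [/\ [/\ forall i, 0 < ge 0 i < 2^-1, forall i, 2^-1 < gh 0 i &
       forall i, 'Re (gs 0 i) < 2^-1 /\ 0 < 'Im (gs 0 i)],
      B \in unitmx, P \in unitmx /\ Q \in unitmx &
      forall z : 'rV[K]_p, quad_map M (row_mx z (conj z)) = quad_map N z +
        sqr_row ((z *m P - 2 *: (conj (z *m P) *m (castmx (E, E)
          (block_mx (block_mx (diag_mx ge) 0 0 (diag_mx gh)) 0
            0 (block_mx 0 (diag_mx gs) (1%:M - diag_mx (conj gs)) 0)))^T)) *m B^T) *m Q].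
Proof.
move=> [Au Uu] UB comT qT [nui nuP] anti.
have [Q QE] := reflection_invariant_squares comT Uu UB qT.
have Qu : Q \in unitmx.
  apply: squares_coefficients_unit Uu _ => w h; apply: anti.
  rewrite QE /fibre_coord mul0mx scaler0 subr0 h addr0 row_mx0.
  exact: quad_map0.
have [e [h [s [E [ge [gh [gs [B [P [rg Bu Pu FE]]]]]]]]]] := fibre_coord_normal_form Au Uu nui nuP.
pose L := row_mx (1%:M : 'M[K]_p) (2^-1 *: A).
exists e, h, s, E, ge, gh, gs, B, P, Q, (fun j => L *m M j *m L^T); split=> // z.
rewrite QE FE; congr (_ + _); apply/rowP => j; rewrite !quad_mapE.
have -> : row_mx z (2^-1 *: (z *m A)) = z *m L by rewrite mul_mx_row mulmx1 -scalemxAr.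
by rewrite trmx_mul !mulmxA.
Qed.

End QuadricForms.

(** * Monomial matrices and systems of squares *)

Section Monomial.
Variable K : numClosedFieldType.

Lemma unitmx_row_nonzero p (A : 'M[K]_p) i : A \in unitmx -> exists j, A i j != 0.
Proof.
move=> Au; apply/existsP; apply: contraT => /existsPn H.
have r0 : row i A = 0 by apply/rowP => j; rewrite !mxE; have /negPn/eqP := H j.
have : (delta_mx 0 i : 'rV[K]_p) = 0 by rewrite -[LHS](mulmxK Au) -rowE r0 mul0mx.
by move/rowP/(_ i)/eqP; rewrite !mxE !eqxx oner_eq0.
Qed.

(** Every row of an invertible matrix has a nonzero entry, so p nonzero entries
    in all means exactly one in each row. *)
Lemma monomial_rowP p (A : 'M[K]_p) : A \in unitmx ->
  #|[set ij : 'I_p * 'I_p | A ij.1 ij.2 != 0]%SET| = p <->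
  (forall i j k, j != k -> A i j * A i k = 0).
Proof.
move=> Au; pose N i := #|[set j | A i j != 0]|.
have N1 i : (1 <= N i)%N.
  have [j Aj] := unitmx_row_nonzero i Au.
  by rewrite /N card_gt0; apply/set0Pn; exists j; rewrite inE.
have -> : #|[set ij : 'I_p * 'I_p | A ij.1 ij.2 != 0]%SET| = (\sum_i N i)%N.
  rewrite -sum1_card (eq_bigl (fun ij => A ij.1 ij.2 != 0)) => [|ij]; last by rewrite inE.
  rewrite -(pair_big_dep xpredT (fun i j => A i j != 0) (fun _ _ => 1%N)) /=.
  by apply: eq_bigr => i _; rewrite /N -sum1_card; apply: eq_bigl => j; rewrite inE.
split=> [S i j k jk|H].
  apply/eqP; rewrite mulf_eq0; apply: contraT; rewrite negb_or => /andP [Aj Ak].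
  have N2 : (2 <= N i)%N.
    have <- : #|[set j; k]| = 2%N by rewrite cards2 jk.
    by apply: subset_leq_card; apply/subsetP => x; rewrite !inE => /orP [] /eqP ->.
  have : (p < \sum_i N i)%N; last by rewrite S ltnn.
  rewrite (bigD1 i) //= -[in X in (X < _)%N](card_ord p) -sum1_card (bigD1 i) //= -addSn.
  by apply: leq_add => //; apply: leq_sum.
rewrite -[RHS]card_ord -sum1_card; apply: eq_bigr => i _.
have [j Aj] := unitmx_row_nonzero i Au.
rewrite /N (_ : [set j | A i j != 0] = [set j]) ?cards1 //.
apply/setP => k; rewrite !inE; case: (eqVneq k j) => [->//|kj].
by have /eqP := H i _ _ kj; rewrite mulf_eq0 (negbTE Aj) orbF => ->.
Qed.

Lemma monomial_sqr_row p (A : 'M[K]_p) (x : 'rV[K]_p) :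
  (forall i j k, j != k -> A i j * A i k = 0) ->
  sqr_row (x *m A^T) = sqr_row x *m (map_mx (fun y => y ^+ 2) A)^T.
Proof.
move=> H; apply/rowP => i; rewrite [LHS]mxE expr2 [X in X * _]mxE [RHS]mxE.
rewrite mulr_suml; apply: eq_bigr => j _.
rewrite [X in _ * X]mxE mulr_sumr (bigD1 j) //= big1 => [|k kj].
  by rewrite !mxE addr0 !expr2; ring.
rewrite !mxE; have e := H i _ _ kj.
have -> : x 0 j * A i j * (x 0 k * A i k) = x 0 j * x 0 k * (A i k * A i j) by ring.
by rewrite e mulr0.
Qed.

Lemma monomial_squares_unit p (A : 'M[K]_p) : A \in unitmx ->
  (forall i j k, j != k -> A i j * A i k = 0) ->
  (map_mx (fun y => y ^+ 2) A)^T \in unitmx.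
Proof.
move=> Au H; apply: (squares_coefficients_unit (unitmx1 K p)) => w.
rewrite invmx1 mulmx1 -monomial_sqr_row // => e.
have wA : w *m A^T = 0.
  apply/rowP => i; rewrite [RHS]mxE; apply/eqP; rewrite -sqrf_eq0; apply/eqP.
  by have := congr1 (fun r : 'rV[K]_p => r 0 i) e; rewrite mxE [RHS]mxE.
by rewrite -[w](@mulmxK _ _ _ A^T) ?unitmx_tr // wA mul0mx.
Qed.

End Monomial.

Section Matching.
Variable K : numClosedFieldType.
Local Notation conj := (map_mx Num.conj).

(** Polarization: replacing v by v + w and by v + 'i w separates S_ij from
    S_ji. *)
Lemma sesquilinear_form0 p (S : 'M[K]_p) :
  (forall v : 'rV[K]_p, (v *m S *m (conj v)^T) 0 0 = 0) -> S = 0.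
Proof.
move=> H; apply/matrixP => i j; rewrite [RHS]mxE.
have aD (X Y : 'M[K]_1) : (X + Y) 0 0 = X 0 0 + Y 0 0 by rewrite mxE.
have aZ c (X : 'M[K]_1) : (c *: X) 0 0 = c * X 0 0 by rewrite mxE.
have pol (c : K) : c^* * S i j + c * S j i = 0.
  have := H (delta_mx 0 i + c *: delta_mx 0 j).
  have cd k : conj (delta_mx 0 k : 'rV[K]_p) = delta_mx 0 k by rewrite map_delta_mx.
  have Hd k : ((delta_mx 0 k : 'rV[K]_p) *m S *m (delta_mx 0 k : 'rV[K]_p)^T) 0 0 = 0.
    by rewrite -[in X in _ *m X^T]cd H.
  rewrite map_mxD map_mxZ !cd linearD linearZ /= !mulmxDl !mulmxDr.
  rewrite -!scalemxAl -!scalemxAr !aD !aZ !Hd !form_entry !mulr0 addr0 add0r.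
  by move=> <-.
have := pol 1; rewrite rmorph1 !mul1r => /eqP; rewrite addr_eq0 => /eqP e1.
have := pol 'i; rewrite conjCi e1 !mulNr mulrN opprK -mulr2n => /eqP.
by rewrite mulrn_eq0 mulf_eq0 /= (negbTE (neq0Ci K)) /= => /eqP ->; rewrite oppr0.
Qed.

Definition entrywise n (x y : 'rV[K]_n) : 'rV[K]_n := \row_j (x 0 j * y 0 j).

(** Let a' = n' R.  The squares of the linear forms y R are combinations of the
    y_k^2, without mixed products, so each column of R has a single nonzero
    entry, and b consists of the squares of the entries of R.  In the second
    identity v and conj v can be varied independently, by polarization, and
    this ties a to n by the same R. *)
Lemma square_forms_matching p (n n' a a' b : 'M[K]_p) :
  n' \in unitmx -> a' \in unitmx ->
  (forall y : 'rV[K]_p, sqr_row (y *m a') = sqr_row (y *m n') *m b) ->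
  (forall v : 'rV[K]_p, entrywise (v *m a) (conj v *m a') = entrywise (v *m n) (conj v *m n') *m b) ->
  exists R : 'M[K]_p, [/\ R \in unitmx, forall i j k, j != k -> R j i * R k i = 0,
    a = n *m R & a' = n' *m R].
Proof.
move=> nu au HQ HK; pose R := invmx n' *m a'.
have aR : a' = n' *m R by rewrite /R mulKVmx.
have Ru : R \in unitmx by rewrite unitmx_mul unitmx_inv nu.
clearbody R.
have Q (y : 'rV[K]_p) j : (y *m R) 0 j ^+ 2 = \sum_k y 0 k ^+ 2 * b k j.
  have := congr1 (fun r : 'rV[K]_p => r 0 j) (HQ (y *m invmx n')).
  rewrite aR !mulmxA mulmxKV // mxE => ->.
  by rewrite mxE; apply: eq_bigr => k _; rewrite [_ 0 k]mxE.
have b_sqr k j : b k j = R k j ^+ 2.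
  have := Q (delta_mx 0 k) j; rewrite -rowE mxE => ->.
  rewrite (bigD1 k) //= big1 => [|l lk]; first by rewrite mxE !eqxx expr1n mul1r addr0.
  by rewrite mxE (negbTE lk) andbF expr0n mul0r.
have RR j k l : k != l -> R k j * R l j = 0.
  move=> kl; have := Q (delta_mx 0 k + delta_mx 0 l) j.
  rewrite mulmxDl -!rowE mxE [row k _ _ _]mxE [row l _ _ _]mxE.
  rewrite (bigD1 k) //= (bigD1 l) //= 1?eq_sym // big1 => [|i /andP [ik il]]; last first.
    by rewrite !mxE (negbTE ik) (negbTE il) andbF addr0 expr0n mul0r.
  rewrite !mxE !eqxx /= (negbTE kl) eq_sym (negbTE kl) /= !addr0 add0r expr1n !mul1r !b_sqr.
  rewrite sqrrD addrAC => e; have {e} : R k j * R l j *+ 2 == 0.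
    by apply/eqP/(addrI (R k j ^+ 2 + R l j ^+ 2)); rewrite addr0.
  by rewrite mulrn_eq0 /= => /eqP.
exists R; split=> //.
have S0 j : a *m diag_mx (delta_mx 0 j) *m a'^T - n *m diag_mx (\row_k b k j) *m n'^T = 0.
  apply: sesquilinear_form0 => v.
  have aB (X Y : 'M[K]_1) : (X - Y) 0 0 = X 0 0 - Y 0 0 by rewrite !mxE.
  have dE (x y d : 'rV[K]_p) : (x *m diag_mx d *m y^T) 0 0 = \sum_k x 0 k * y 0 k * d 0 k.
    by rewrite mul_mx_diag mxE; apply: eq_bigr => k _; rewrite !mxE; ring.
  rewrite mulmxBr mulmxBl aB.
  have -> : v *m (a *m diag_mx (delta_mx 0 j) *m a'^T) *m (conj v)^T =
      (v *m a) *m diag_mx (delta_mx 0 j) *m (conj v *m a')^T.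
    by rewrite trmx_mul !mulmxA.
  have -> : v *m (n *m diag_mx (\row_k b k j) *m n'^T) *m (conj v)^T =
      (v *m n) *m diag_mx (\row_k b k j) *m (conj v *m n')^T.
    by rewrite trmx_mul !mulmxA.
  have := congr1 (fun r : 'rV[K]_p => r 0 j) (HK v); rewrite mxE [RHS]mxE => e.
  rewrite !dE (bigD1 j) //= big1 => [|l lj]; last by rewrite [delta_mx _ _ _ _]mxE (negbTE lj) andbF mulr0.
  rewrite [delta_mx _ _ _ _]mxE !eqxx mulr1 addr0 e; apply/eqP; rewrite subr_eq0; apply/eqP.
  by apply: eq_bigr => k _; rewrite !mxE.
apply/matrixP => i j; have [k Rk] : exists k, R k j != 0.
  by have [k] := @unitmx_row_nonzero K p R^T j (etrans (unitmx_tr R) Ru); rewrite mxE; exists k.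
have /matrixP /(_ i k) : a *m diag_mx (delta_mx 0 j) *m R^T = n *m diag_mx (\row_k b k j).
  have := S0 j; rewrite aR trmx_mul mulmxA -mulmxBl => e.
  by apply: subr0_eq; rewrite -[LHS](@mulmxK _ _ _ n'^T) ?unitmx_tr // e mul0mx.
have -> : (a *m diag_mx (delta_mx 0 j) *m R^T) i k = a i j * R k j.
  rewrite mul_mx_diag mxE (bigD1 j) //= big1 => [|l lj]; last first.
    by rewrite !mxE (negbTE lj) mulr0 mul0r.
  by rewrite !mxE !eqxx mulr1 addr0.
rewrite mul_mx_diag !mxE b_sqr expr2 mulrA => /(mulIf Rk) ->.
rewrite (bigD1 k) //= big1 ?addr0 // => l lk.
by have /eqP := RR j _ _ lk; rewrite mulf_eq0 (negbTE Rk) orbF => /eqP ->; rewrite mulr0.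
Qed.

End Matching.

(** * Rotations of the arguments of the linear forms *)

Section Rotations.
Variables (K : numClosedFieldType) (p : nat).
Local Notation conj := (map_mx Num.conj).
Implicit Types (B g c b : 'M[K]_p) (v x y : 'rV[K]_p).

(** The row (L_1, ..., L_p) at the real points w' = conj z'. *)
Definition real_forms B g v : 'rV[K]_p := (v - 2 *: (conj v *m g^T)) *m B^T.

Lemma real_formsZ B g (w : K) v :
  real_forms B g (w *: v) = w *: (v *m B^T) + w^* *: (- 2 *: (conj v *m g^T *m B^T)).
Proof.
rewrite /real_forms map_mxZ -scalemxAl mulmxBl -!scalemxAl scalerA.
by rewrite scalerA mulrN scaleNr [w^* * 2]mulrC.
Qed.

Lemma sqr_row_rotation (w : K) x y :
  sqr_row (w *: x + w^* *: y) - w ^+ 2 *: sqr_row (x + y)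
  = (2 * (w * w^* - w ^+ 2)) *: entrywise x y + (w^* ^+ 2 - w ^+ 2) *: sqr_row y.
Proof. by apply/rowP => j; rewrite !mxE; ring. Qed.

(** Under v |-> w v the holomorphic part x of the forms is multiplied by w and
    the antiholomorphic part y by conj w.  By [sqr_row_rotation], the rotation
    w = i isolates the products x_j y_j; once these are matched, any other
    rotation, here w = (3 + 4 i) / 5, isolates the squares y_j^2. *)
Lemma rotations_split B B' g c b :
  (forall w : K, w * w^* = 1 -> forall v,
     sqr_row (real_forms B' g (w *: v *m c)) - w ^+ 2 *: sqr_row (real_forms B' g (v *m c))
     = (sqr_row (real_forms B g (w *: v)) - w ^+ 2 *: sqr_row (real_forms B g v)) *m b) ->
  (forall v, entrywise (v *m c *m B'^T) (conj (v *m c) *m g^T *m B'^T)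
     = entrywise (v *m B^T) (conj v *m g^T *m B^T) *m b) /\
  (forall v, sqr_row (conj (v *m c) *m g^T *m B'^T) = sqr_row (conj v *m g^T *m B^T) *m b).
Proof.
move=> H.
have n2 : (- 2 : K) != 0 by rewrite oppr_eq0 pnatr_eq0.
pose S (B0 : 'M[K]_p) v := entrywise (v *m B0^T) (conj v *m g^T *m B0^T).
pose T (B0 : 'M[K]_p) v := sqr_row (conj v *m g^T *m B0^T).
have {}H (w : K) v : w * w^* = 1 ->
    (2 * (1 - w ^+ 2) * (- 2)) *: (S B' (v *m c) - S B v *m b)
    + ((w^* ^+ 2 - w ^+ 2) * (- 2) ^+ 2) *: (T B' (v *m c) - T B v *m b) = 0.
  move=> w1; have := H w w1 v.
  have E (B0 : 'M[K]_p) u : sqr_row (real_forms B0 g (w *: u)) - w ^+ 2 *: sqr_row (real_forms B0 g u) =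
      (2 * (1 - w ^+ 2) * (- 2)) *: S B0 u + ((w^* ^+ 2 - w ^+ 2) * (- 2) ^+ 2) *: T B0 u.
    rewrite real_formsZ -[u in X in _ - X]scale1r real_formsZ conjC1 !scale1r sqr_row_rotation w1.
    by apply/rowP => j; rewrite /S /T !mxE; ring.
  rewrite -scalemxAl !E mulmxDl -!scalemxAl => e.
  by rewrite !scalerBr addrACA -opprD e subrr.
have SE v : S B' (v *m c) = S B v *m b.
  have := H 'i v; rewrite conjCi mulrN -expr2 sqrCi opprK => /(_ erefl).
  rewrite [(- 'i) ^+ 2]sqrrN sqrCi addNr mul0r scale0r addr0 => /eqP.
  rewrite scalemx_eq0 !mulf_eq0 (negbTE n2) -[1 + 1]/(2%:R) !pnatr_eq0 /=.
  by rewrite subr_eq0 => /eqP.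
split=> // v.
pose w : K := (3 + 4 * 'i) / 5.
have n5 : (5 : K) != 0 by rewrite pnatr_eq0.
have wJ : w^* = (3 - 4 * 'i) / 5.
  by rewrite /w rmorphM rmorphD rmorphM fmorphV !rmorph_nat; congr ((_ + _) / _); rewrite -mulrN -conjCi.
have i2 : 'i * 'i = -1 :> K by rewrite -expr2 sqrCi.
have w1 : w * w^* = 1.
  have -> : w * w^* = (9 - 16 * ('i * 'i)) / 25 by rewrite wJ /w; field.
  by rewrite i2; field.
have := H w v w1; rewrite SE subrr scaler0 add0r => /eqP.
rewrite scalemx_eq0 mulf_eq0 [_ ^+ 2 == 0]sqrf_eq0 (negbTE n2) orbF.
have -> : w^* ^+ 2 - w ^+ 2 = - (48%:R * 'i) / 25%:R.
  by rewrite wJ /w; field.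
rewrite mulf_eq0 oppr_eq0 mulf_eq0 invr_eq0 !pnatr_eq0 (negbTE (neq0Ci K)) /= => /eqP.
by move/subr0_eq.
Qed.

End Rotations.

Section Blocks.
Variables (K : fieldType) (p : nat).

Lemma tangent_normal_part (J : 'M[K]_(p + p)) (v y : 'rV[K]_p) :
  row_mx v y *m (J *m col_mx 0 1%:M) = v *m ursubmx J + y *m drsubmx J.
Proof.
by rewrite -[J in LHS]submxK mul_block_col !mulmx0 !mulmx1 !add0r mul_row_col.
Qed.

Lemma lower_block_unit (J : 'M[K]_(p + p)) : J \in unitmx ->
  (forall v : 'rV[K]_p, v *m ursubmx J = 0) -> ulsubmx J \in unitmx.
Proof.
move=> Ju H; have u0 : ursubmx J = 0.
  by apply/row_matrixP => i; rewrite rowE H row0.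
move: Ju; rewrite -[J in J \in _]submxK u0 !unitmxE det_lblock unitrM.
by case/andP.
Qed.

End Blocks.

(** * Scalings commuting with gamma up to conjugation *)

Section Equivalences.
Variables (K : numClosedFieldType) (p : nat).
Local Notation conj := (map_mx Num.conj).
Implicit Types (A B g c b D : 'M[K]_p).

(** The holomorphic and the antiholomorphic parts of the two systems of forms
    are related by one and the same monomial matrix; comparing the two
    relations leaves conj(c) gamma^T = gamma^T c. *)
Lemma rotations_scaling B B' g c b :
  B \in unitmx -> B' \in unitmx -> g \in unitmx -> c \in unitmx ->
  (forall w : K, w * w^* = 1 -> forall v : 'rV[K]_p,
     sqr_row (real_forms B' g (w *: v *m c)) - w ^+ 2 *: sqr_row (real_forms B' g (v *m c))
     = (sqr_row (real_forms B g (w *: v)) - w ^+ 2 *: sqr_row (real_forms B g v)) *m b) ->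
  exists A D, [/\ A \in unitmx, forall i j k, j != k -> A i j * A i k = 0,
    B' = A *m B *m D & D *m g = g *m conj D].
Proof.
move=> Bu Bu' gu cu /rotations_split [HK HQ].
have ccu : conj c \in unitmx by rewrite map_unitmx.
have [||y|v|R [Ru RR aR aR']] := @square_forms_matching K p B^T (g^T *m B^T) (c *m B'^T)
  (conj c *m g^T *m B'^T) b.
- by rewrite unitmx_mul !unitmx_tr gu.
- by rewrite !unitmx_mul !unitmx_tr ccu gu.
- by have := HQ (conj y); rewrite map_mxM !conj_mxK !mulmxA.
- by have := HK v; rewrite map_mxM !mulmxA.
have cg : conj c *m g^T = g^T *m c.
  rewrite -[LHS](@mulmxK _ _ _ B'^T) ?unitmx_tr // aR' -mulmxA -aR !mulmxA.
  by rewrite mulmxK ?unitmx_tr.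
exists R^T, (invmx c)^T; split.
- by rewrite unitmx_tr.
- by move=> i j k jk; rewrite !mxE RR.
- apply: trmx_inj; rewrite !trmx_mul !trmxK -[B^T *m R]aR.
  by rewrite mulmxA mulVmx // mul1mx.
rewrite -map_trmx map_invmx; apply: trmx_inj; rewrite !trmx_mul !trmxK.
by rewrite -[RHS](mulmxK cu) -(mulmxA _ g^T) -cg mulmxA mulVmx // mul1mx.
Qed.

(** Invariance of each L_j^2 says that a product of two linear forms in (z, w)
    vanishes; w is chosen so that one of the factors takes the value 1. *)
Lemma reflection_inverse A B g : B \in unitmx -> g \in unitmx ->
  (forall z w : 'rV[K]_p, sqr_row ((z - 2 *: ((z *m A - w) *m g^T)) *m B^T)
     = sqr_row ((z - 2 *: (w *m g^T)) *m B^T)) -> A *m g^T = 1%:M.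
Proof.
move=> Bu gu H; have gBu : g^T *m B^T \in unitmx by rewrite unitmx_mul !unitmx_tr gu.
have n2 : (2 : K) != 0 by rewrite pnatr_eq0.
apply: (can_inj (@mulmxK _ _ _ B^T _)); rewrite ?unitmx_tr // mul1mx.
apply/row_matrixP => i; rewrite !rowE; set z := delta_mx 0 i.
pose w : 'rV[K]_p := 2^-1 *: (z *m A + const_mx 1 *m invmx (g^T *m B^T)).
have e : 2 *: (w *m g^T *m B^T) = z *m A *m g^T *m B^T + const_mx 1.
  by rewrite -mulmxA /w -scalemxAl scalerA divff // scale1r mulmxDl mulmxKV // !mulmxA.
apply/rowP => j; have := congr1 (fun r : 'rV[K]_p => r 0 j) (H z w).
rewrite !mulmxA; move: e; set X := z *m A *m g^T *m B^T; set Y := z *m B^T => e.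
have -> : (z - 2 *: ((z *m A - w) *m g^T)) *m B^T = Y - 2 *: X + (X + const_mx 1).
  by rewrite -e mulmxBl -scalemxAl mulmxBl mulmxBl scalerBr opprB addrA addrAC.
have -> : (z - 2 *: (w *m g^T)) *m B^T = Y - (X + const_mx 1).
  by rewrite -e mulmxBl -scalemxAl.
move/eqP; rewrite /sqr_row [X in X == _]mxE [X in _ == X]mxE.
rewrite (_ : (Y - 2 *: X + _) 0 j = Y 0 j - X 0 j + 1); last by rewrite !mxE; ring.
rewrite (_ : (Y - _) 0 j = Y 0 j - X 0 j - 1); last by rewrite !mxE; ring.
rewrite -subr_eq0 (_ : _ - _ = 4%:R * (Y 0 j - X 0 j)); last by ring.
by rewrite mulf_eq0 pnatr_eq0 /= subr_eq0 => /eqP ->.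
Qed.

Lemma antiholomorphic_unit B g :
  (forall w : 'rV[K]_p, sqr_row ((0 - 2 *: (w *m g^T)) *m B^T) = 0 -> w = 0) -> g \in unitmx.
Proof.
move=> H; rewrite -unitmx_tr -row_free_unit -kermx_eq0; apply/eqP/row_matrixP => i.
rewrite row0; apply: H; rewrite -row_mul mulmx_ker row0 scaler0 subr0 mul0mx.
by apply/rowP => j; rewrite !mxE expr0n.
Qed.

Lemma diag_eigenvalues_injective (d : 'rV[K]_p) (nu : 'I_p -> K) : injective nu ->
  (forall j, eigenvalue (diag_mx d) (nu j)) -> injective (d 0).
Proof.
move=> nui H.
have /fin_all_exists [f fE] j : exists k, d 0 k = nu j.
  have /eigenvalueP [v vd v0] := H j.
  have /existsP [k vk] : [exists k, v 0 k != 0].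
    apply: contraT => /existsPn h; case/eqP: v0; apply/rowP => k; rewrite [RHS]mxE.
    by have /negPn/eqP := h k.
  exists k; have := congr1 (fun r : 'rV[K]_p => r 0 k) vd.
  by rewrite mul_mx_diag !mxE mulrC => /(mulIf vk).
have fi : injective f by move=> j k fjk; apply: nui; rewrite -!fE fjk.
have [f' fK f'K] := injF_bij fi.
by move=> k l; rewrite -(f'K k) -(f'K l) !fE => /nui ->.
Qed.

Lemma commute_diag D (d : 'rV[K]_p) : injective (d 0) ->
  D *m diag_mx d = diag_mx d *m D -> D = diag_mx (\row_i D i i).
Proof.
move=> di; rewrite mul_mx_diag mul_diag_mx => /matrixP e; apply/matrixP => i j.
have := e i j; rewrite !mxE; case: (eqVneq i j) => [->//|ij] /eqP.
rewrite mulrC -subr_eq0 -mulrBl mulf_eq0 subr_eq0 => /orP [/eqP /di /eqP|/eqP -> //].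
by rewrite eq_sym (negbTE ij).
Qed.

End Equivalences.

Section Gamma.
Variables (K : numClosedFieldType) (e h s : nat).
Variables (ge : 'rV[K]_e) (gh : 'rV[K]_h) (gs : 'rV[K]_s).
Local Notation conj := (map_mx Num.conj).

Definition gamma_block : 'M[K]_(e + h + (s + s)) :=
  block_mx (block_mx (diag_mx ge) 0 0 (diag_mx gh)) 0
    0 (block_mx 0 (diag_mx gs) (1%:M - diag_mx (conj gs)) 0).

(** The off-diagonal blocks of gamma cancel here; the entries of d are the
    eigenvalues that distinguish the coordinates. *)
Lemma gamma_conj_gamma : exists d, gamma_block *m conj gamma_block = diag_mx d.
Proof.
pose sq n (x y : 'rV[K]_n) : 'rV[K]_n := \row_j (x 0 j * y 0 j).
exists (row_mx (row_mx (sq _ ge (conj ge)) (sq _ gh (conj gh)))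
  (row_mx (sq _ gs (const_mx 1 - gs)) (sq _ (const_mx 1 - conj gs) (conj gs)))).
have E n (x : 'rV[K]_n) : 1%:M - diag_mx x = diag_mx (const_mx 1 - x).
  by rewrite linearB /= diag_const_mx.
rewrite !diag_mx_row /gamma_block E !map_block_mx !map_diag_mx !map_mx0 !mulmx_block.
rewrite !mul0mx !mulmx0 !addr0 !add0r !mulmx_diag.
have c1 : conj (const_mx 1 : 'rV[K]_s) = const_mx 1 by apply/rowP => i; rewrite !mxE conjC1.
by rewrite map_mxB c1 conj_mxK.
Qed.

Hypothesis ge_gt0 : forall i, 0 < ge 0 i.
Hypothesis gh_gt0 : forall i, 0 < gh 0 i.
Hypothesis gs_neq0 : forall i, gs 0 i != 0.

Lemma diag_mx_inj n : injective (@diag_mx K n).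
Proof.
by move=> x y /matrixP E; apply/rowP => i; have := E i i; rewrite !mxE eqxx.
Qed.

Lemma gamma_scalingP (a : 'rV[K]_e) (b : 'rV[K]_h) (c d : 'rV[K]_s) :
  let D := diag_mx (row_mx (row_mx a b) (row_mx c d)) in
  D *m gamma_block = gamma_block *m conj D <->
  [/\ forall i, a 0 i \is Num.real, forall i, b 0 i \is Num.real & d = conj c].
Proof.
move=> D.
have -> : D *m gamma_block = gamma_block *m conj D <-> [/\
    diag_mx a *m diag_mx ge = diag_mx ge *m diag_mx (conj a),
    diag_mx b *m diag_mx gh = diag_mx gh *m diag_mx (conj b),
    diag_mx c *m diag_mx gs = diag_mx gs *m diag_mx (conj d) &
    diag_mx d *m (1%:M - diag_mx (conj gs)) = (1%:M - diag_mx (conj gs)) *m diag_mx (conj c)].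
  rewrite /D /gamma_block !diag_mx_row !map_block_mx !map_diag_mx !map_mx0 !mulmx_block.
  rewrite !mul0mx !mulmx0 !addr0 !add0r.
  split; last by case=> -> -> -> ->.
  by move=> /eq_block_mx [/eq_block_mx [-> _ _ ->] _ _ /eq_block_mx [_ -> -> _]].
have realP n (x y : 'rV[K]_n) : (forall i, 0 < y 0 i) ->
    diag_mx x *m diag_mx y = diag_mx y *m diag_mx (conj x) <-> forall i, x 0 i \is Num.real.
  move=> y0; rewrite !mulmx_diag; split=> [/diag_mx_inj /rowP E i|E].
    have := E i; rewrite !mxE mulrC => /(mulfI (lt0r_neq0 (y0 i))) xE.
    by apply/CrealP; rewrite -xE.
  by congr diag_mx; apply/rowP => i; rewrite !mxE mulrC (CrealP (E i)).
have rA := realP _ a ge ge_gt0; have rB := realP _ b gh gh_gt0.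
split=> [[/rA ha /rB hb hc _]|[/rA ha /rB hb ->]]; split=> //.
- move: hc; rewrite !mulmx_diag => /diag_mx_inj /rowP E; apply/rowP => i.
  have := E i; rewrite !mxE mulrC => /(mulfI (gs_neq0 i)) ->.
  by rewrite conjCK.
- by rewrite conj_mxK diag_mxC.
- by rewrite mulmxBr mulmxBl mulmx1 mul1mx diag_mxC.
Qed.

End Gamma.

Section Scalings.
Variable K : numClosedFieldType.
Local Notation conj := (map_mx Num.conj).

Lemma real_forms_monomial p (A B D g : 'M[K]_p) u : D^T = D -> D *m g = g *m conj D ->
  real_forms (A *m B *m D) g u = real_forms B g (u *m D) *m A^T.
Proof.
move=> DT Dg; rewrite /real_forms !trmx_mul DT map_mxM.
have -> : conj u *m conj D *m g^T = conj u *m g^T *m D.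
  by rewrite -[in LHS]DT -map_trmx -!mulmxA -trmx_mul -Dg trmx_mul DT.
by rewrite !mulmxA [_ *m D]mulmxBl -scalemxAl.
Qed.

Lemma deck_inverse p (A B g : 'M[K]_p) : B \in unitmx -> g \in unitmx ->
  (forall v, quad_map (square_forms_mx B g) (v *m block_mx 1%:M A 0 (- 1%:M))
     = quad_map (square_forms_mx B g) v) -> A *m g^T = 1%:M.
Proof.
move=> Bu gu qA; apply: reflection_inverse Bu gu _ => z w.
have := qA (row_mx z w); rewrite mul_row_block mulmx1 mulmx0 addr0 mulmxN mulmx1.
by rewrite -!square_forms_quad_map.
Qed.

Lemma quadric_rotations_scaling p (B B' g c b : 'M[K]_p) :
  B \in unitmx -> B' \in unitmx -> g \in unitmx -> c \in unitmx ->
  (forall w : K, w * w^* = 1 -> forall v : 'rV[K]_p,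
     quad_map (square_forms_mx B' g) (row_mx (w *: v *m c) (conj (w *: v *m c)))
       - w ^+ 2 *: quad_map (square_forms_mx B' g) (row_mx (v *m c) (conj (v *m c)))
     = (quad_map (square_forms_mx B g) (row_mx (w *: v) (conj (w *: v)))
       - w ^+ 2 *: quad_map (square_forms_mx B g) (row_mx v (conj v))) *m b) ->
  exists A D, [/\ A \in unitmx, forall i j k, j != k -> A i j * A i k = 0,
    B' = A *m B *m D & D *m g = g *m conj D].
Proof.
move=> Bu Bu' gu cu H; apply: (rotations_scaling Bu Bu' gu cu (b := b)) => w w1 v.
by have := H w w1 v; rewrite -!square_forms_quad_map.
Qed.

Variables (e h s : nat) (ge : 'rV[K]_e) (gh : 'rV[K]_h) (gs : 'rV[K]_s).
Hypothesis ge_gt0 : forall i, 0 < ge 0 i.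
Hypothesis gh_gt0 : forall i, 0 < gh 0 i.
Hypothesis gs_neq0 : forall i, gs 0 i != 0.
Local Notation n := (e + h + (s + s))%N.
Local Notation gamma := (gamma_block ge gh gs).

(** D commutes with gamma conj(gamma), a diagonal matrix whose entries are the
    p distinct eigenvalues, so D is diagonal; then [gamma_scalingP] applies. *)
Lemma scaling_of_commutation (A D : 'M[K]_n) (nu : 'I_n -> K) : D \in unitmx ->
  D *m gamma = gamma *m conj D -> A *m gamma^T = 1%:M -> injective nu ->
  (forall j, eigenvalue (conj (invmx A) *m invmx A) (nu j)) ->
  exists (a : 'rV[K]_e) (b : 'rV[K]_h) (c : 'rV[K]_s),
  [/\ forall i, a 0 i \is Num.real /\ a 0 i != 0,
      forall i, b 0 i \is Num.real /\ b 0 i != 0,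
      forall i, c 0 i != 0 &
      D = diag_mx (row_mx (row_mx a b) (row_mx c (conj c)))].
Proof.
move=> Du Dg Ag nui nuP; have [d dE] := gamma_conj_gamma ge gh gs.
have [Au _] := mulmx1_unit Ag.
have iA : invmx A = gamma^T by rewrite -[LHS]mulmx1 -Ag mulmxA mulVmx // mul1mx.
have di : injective (d 0).
  apply: (diag_eigenvalues_injective nui) => j; have := nuP j.
  by rewrite iA -map_trmx -trmx_mul dE tr_diag_mx.
have Dd : D *m diag_mx d = diag_mx d *m D.
  by rewrite -dE mulmxA Dg -!mulmxA -map_mxM Dg map_mxM conj_mxK.
have DE := commute_diag di Dd; set w : 'rV[K]_n := \row_i D i i in DE.
clearbody w; have w0 i : w 0 i != 0.
  have [j] := unitmx_row_nonzero i Du; rewrite DE mxE.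
  by case: (w 0 i =P 0) => // ->; rewrite mul0rn eqxx.
pose a := lsubmx (lsubmx w); pose b := rsubmx (lsubmx w).
pose c := lsubmx (rsubmx w); pose c' := rsubmx (rsubmx w).
have wE : w = row_mx (row_mx a b) (row_mx c c') by rewrite !hsubmxK.
move: Dg; rewrite DE wE => /(gamma_scalingP ge_gt0 gh_gt0 gs_neq0) [ra rb ->].
exists a, b, c; split=> // i; last by rewrite !mxE; exact: w0.
- by split; [exact: ra|rewrite !mxE; exact: w0].
- by split; [exact: rb|rewrite !mxE; exact: w0].
Qed.

Lemma scaling_commutation (a : 'rV[K]_e) (b : 'rV[K]_h) (c : 'rV[K]_s) :
  (forall i, a 0 i \is Num.real) -> (forall i, b 0 i \is Num.real) ->
  let D := diag_mx (row_mx (row_mx a b) (row_mx c (conj c))) in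
  D *m gamma = gamma *m conj D.
Proof. by move=> ra rb D; apply/gamma_scalingP. Qed.

End Scalings.

From mathcomp Require Import all_classical all_reals all_analysis.
From mathcomp.real_closed Require Import complex.

Import Order.TTheory GRing.Theory Num.Theory.
Import numFieldNormedType.Exports Normc.
Local Open Scope classical_set_scope.
Local Open Scope complex_scope.
Local Open Scope ring_scope.
Local Notation Re := complex.Re.
Local Notation Im := complex.Im.

(** * Modulus and integrals on a segment *)

Section Modulus.
Variable R : realType.
Implicit Types z w : R[i].

Lemma normc_ge0 z : 0 <= normc z.
Proof. by case: z => a b /=; exact: sqrtr_ge0. Qed.

Lemma normcD_le z w : normc (z + w) <= normc z + normc w.
Proof. exact: (le_normcD z w). Qed.

Lemma normc_opp z : normc (- z) = normc z.
Proof. exact: (@normcN R z). Qed.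

Lemma normc_subC z w : normc (z - w) = normc (w - z).
Proof. by rewrite -normc_opp opprB. Qed.

Lemma Re_normc z : `|Re z| <= normc z.
Proof.
case: z => a b /=; rewrite -sqrtr_sqr ler_wsqrtr // lerDl sqr_ge0 //.
Qed.

Lemma Im_normc z : `|Im z| <= normc z.
Proof.
case: z => a b /=; rewrite -sqrtr_sqr ler_wsqrtr // lerDr sqr_ge0 //.
Qed.

Lemma normc_real (x : R) : normc x%:C = `|x|.
Proof. by rewrite /= expr0n /= addr0 sqrtr_sqr. Qed.

Lemma normc_imag (x : R) : normc (0 +i* x) = `|x|.
Proof. by rewrite /= expr0n /= add0r sqrtr_sqr. Qed.

Lemma normc_ReIm z : normc z <= `|Re z| + `|Im z|.
Proof.
case: z => a b; have -> : a +i* b = a%:C + (0 +i* b) by simpc.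
by rewrite (le_trans (normcD_le _ _)) // normc_real normc_imag /= !(addr0, add0r).
Qed.

Lemma normc_gt0 z : (0 < normc z) = (z != 0).
Proof.
rewrite lt_def normc_ge0 andbT; congr negb; apply/eqP/eqP => [/eq0_normc //|->].
exact: normc0.
Qed.

Lemma normr_normc z : `|z| = (normc z)%:C.
Proof. by rewrite normc_def; case: z. Qed.

End Modulus.

Section Integral.
Variable R : realType.
Implicit Types (phi psi : R -> R) (a b c : R).

Lemma primitive_exists phi : continuous phi ->
  exists F : R -> R, forall x : R, -2 < x < 2 -> is_derive x 1 F (phi x).
Proof.
move=> cphi.
have int : (lebesgue_measure : {measure set (measurableTypeR R) -> \bar R}).-integrable `[-2, 2 : R] (EFin \o phi).
  apply: continuous_compact_integrable; first exact: segment_compact.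
  exact: continuous_subspaceT.
exists (fun x => (\int[lebesgue_measure]_(t in [set` `[(-2 : R), x]]) (phi t))%R) => x /andP[x1 x2].
have [d e] := continuous_FTC1_closed x2 int x1 (cphi x).
by apply: DeriveDef; [exact: d|rewrite -derive1E; exact: e].
Qed.

(** The integrals below are taken inside [-1, 1]; on the larger open interval
    ]-2, 2[ a primitive has two-sided derivatives up to the end points. *)
Definition primitive phi : R -> R :=
  if pselect (continuous phi) is left h then projT1 (cid (primitive_exists h))
  else 0.

Lemma primitiveP phi : continuous phi ->
  forall x : R, -2 < x < 2 -> is_derive x 1 (primitive phi) (phi x).
Proof.
by move=> h; rewrite /primitive; case: pselect => // h'; case: cid.
Qed.

(** The integral of phi over [a, b], for -1 <= a <= b <= 1. *)
Definition rint phi a b := primitive phi b - primitive phi a.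

Lemma is_derive_MVT (F f : R -> R) a b : -1 <= a -> a <= b -> b <= 1 ->
  (forall x : R, -2 < x < 2 -> is_derive x 1 F (f x)) ->
  exists2 c, a <= c <= b & F b - F a = f c * (b - a).
Proof.
move=> a1 ab b1 dF.
have [|||c cab e] := @MVT_segment _ F f a b => //.
- by move=> x; rewrite in_itv /= => /andP[x1 x2]; apply: dF; lra.
- apply: derivable_within_continuous => x; rewrite in_itv /= => /andP[x1 x2].
  have : -2 < x < 2 by lra.
  by move=> /dF [].
- by exists c => //; rewrite in_itv in cab.
Qed.

Lemma rint_unique phi F a b : -1 <= a -> a <= b -> b <= 1 ->
  continuous phi -> (forall x : R, -2 < x < 2 -> is_derive x 1 F (phi x)) ->
  rint phi a b = F b - F a.
Proof.
move=> a1 ab b1 cphi dF.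
have d0 : forall x : R, -2 < x < 2 -> is_derive x 1 (primitive phi - F) 0.
  move=> x hx; have h1 := primitiveP cphi hx; have h2 := dF x hx.
  by have := is_deriveB h1 h2; rewrite subrr.
have [c _] := @is_derive_MVT _ (fun=> 0) a b a1 ab b1 d0.
rewrite mul0r /rint !fctE => h; lra.
Qed.

Lemma rintD phi psi a b : -1 <= a -> a <= b -> b <= 1 ->
  continuous phi -> continuous psi ->
  rint (phi \+ psi) a b = rint phi a b + rint psi a b.
Proof.
move=> a1 ab b1 c1 c2.
have c12 : continuous (phi \+ psi).
  by move=> x; apply: cvgD; [exact: c1|exact: c2].
have d : forall x : R, -2 < x < 2 ->
    is_derive x 1 (primitive phi + primitive psi) ((phi \+ psi) x).
  move=> x hx; have h1 := primitiveP c1 hx; have h2 := primitiveP c2 hx.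
  exact: is_deriveD.
by have := rint_unique a1 ab b1 c12 d; rewrite /rint !fctE => ->; ring.
Qed.

Lemma rintZ phi k a b : -1 <= a -> a <= b -> b <= 1 ->
  continuous phi -> rint (fun x => k * phi x) a b = k * rint phi a b.
Proof.
move=> a1 ab b1 c1.
have ck : continuous (fun x => k * phi x).
  by move=> x; apply: cvgMr; exact: c1.
have d : forall x : R, -2 < x < 2 ->
    is_derive x 1 (k *: primitive phi) (k * phi x).
  by move=> x hx; have h1 := primitiveP c1 hx; exact: is_deriveZ.
have := rint_unique a1 ab b1 ck d; rewrite /rint => ->.
by rewrite mulrBr.
Qed.

Lemma rint_MVT phi a b : -1 <= a -> a <= b -> b <= 1 ->
  continuous phi -> exists2 c, a <= c <= b & rint phi a b = phi c * (b - a).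
Proof.
move=> a1 ab b1 cphi; apply: is_derive_MVT => //; exact: primitiveP.
Qed.

End Integral.

(** * Contour integrals over rectangles *)

Section ComplexIntegral.
Variable R : realType.
Implicit Types (f g : R -> R[i]) (a b c x y : R) (k z w : R[i]).

Definition curve_continuous f :=
  continuous (fun t => Re (f t)) /\ continuous (fun t => Im (f t)).

Lemma curve_continuousP f :
  (forall x e, 0 < e -> exists2 d, 0 < d &
     forall y, `|x - y| < d -> normc (f x - f y) < e) ->
  curve_continuous f.
Proof.
move=> H; split=> x; apply/cvgrPdist_lt => e e0; have [d d0 Hd] := H x e e0;
  near=> y; have /Hd : `|x - y| < d by near: y; exact: cvgr_dist_lt.
- by apply: le_lt_trans; have := Re_normc (f x - f y); case: (f x) (f y) => [? ?] [? ?].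
- by apply: le_lt_trans; have := Im_normc (f x - f y); case: (f x) (f y) => [? ?] [? ?].
Unshelve. all: by end_near. Qed.

Definition cint f a b : R[i] :=
  rint (fun t => Re (f t)) a b +i* rint (fun t => Im (f t)) a b.

Lemma cint_cat f a b c : cint f a b + cint f b c = cint f a c.
Proof. by rewrite /cint /rint; simpc; congr (_ +i* _); ring. Qed.

Lemma cint0 f a : cint f a a = 0.
Proof. by rewrite /cint /rint !subrr. Qed.

Section on_segment.
Variables a b : R.
Hypotheses (a1 : -1 <= a) (ab : a <= b) (b1 : b <= 1).

Lemma cintD f g : curve_continuous f -> curve_continuous g ->
  cint (fun t => f t + g t) a b = cint f a b + cint g a b.
Proof.
move=> [f1 f2] [g1 g2]; rewrite /cint; simpc.
rewrite -!rintD //; congr (rint _ a b +i* rint _ a b); apply/funext => t /=;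
  by case: (f t) (g t) => [? ?] [? ?].
Qed.

Lemma cintZ k f : curve_continuous f ->
  cint (fun t => k * f t) a b = k * cint f a b.
Proof.
move=> [f1 f2]; case: k => k1 k2; rewrite /cint.
have -> : (fun t => Re ((k1 +i* k2) * f t)) =
    (fun t => k1 * Re (f t)) \+ (fun t => - k2 * Im (f t)).
  by apply/funext => t /=; case: (f t) => ? ? /=; rewrite mulNr.
have -> : (fun t => Im ((k1 +i* k2) * f t)) =
    (fun t => k1 * Im (f t)) \+ (fun t => k2 * Re (f t)).
  by apply/funext => t /=; case: (f t).
have cM (h : R -> R) (r : R) : continuous h -> continuous (fun t => r * h t).
  by move=> ch x; apply: cvgMr; exact: ch.
rewrite !rintD ?rintZ //; try exact: cM.
by simpc.
Qed.

Lemma cint_cst k : cint (fun=> k) a b = (b - a)%:C * k.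
Proof.
rewrite /cint; have cc (r : R) : continuous (fun _ : R => r).
  by move=> x; exact: cvg_cst.
have [c1 _ ->] := rint_MVT a1 ab b1 (cc (Re k)).
have [c2 _ ->] := rint_MVT a1 ab b1 (cc (Im k)).
by case: k => ? ? /=; simpc; rewrite ![_ * (b - a)]mulrC.
Qed.

Lemma cint_le f (M : R) : curve_continuous f ->
  (forall t, a <= t <= b -> normc (f t) <= M) ->
  normc (cint f a b) <= 2 * M * (b - a).
Proof.
move=> [f1 f2] fM; apply: le_trans (normc_ReIm _) _ => /=.
have [c1 /fM h1 ->] := rint_MVT a1 ab b1 f1.
have [c2 /fM h2 ->] := rint_MVT a1 ab b1 f2.
rewrite !normrM (ger0_norm (_ : 0 <= b - a)) ?subr_ge0 // -mulrDl.
rewrite ler_wpM2r ?subr_ge0 //.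
have := Re_normc (f c1); have := Im_normc (f c2); lra.
Qed.

End on_segment.

End ComplexIntegral.

Section Contour.
Variable R : realType.
Implicit Types (f g : R[i] -> R[i]) (x y : R) (k z w : R[i]).

Definition clamp (t : R) : R :=
  if t < -1 then -1 else if 1 < t then 1 else t.

Lemma clampE t : -1 <= t <= 1 -> clamp t = t.
Proof. by move=> ?; rewrite /clamp; case: ltP => ?; [|case: ltP => ?]; lra. Qed.

Lemma clamp_itv t : -1 <= clamp t <= 1.
Proof. by rewrite /clamp; case: ltP => ?; [|case: ltP => ?]; lra. Qed.

Lemma clamp_lip t u : `|clamp t - clamp u| <= `|t - u|.
Proof.
have mono (v s : R) : v <= s -> 0 <= clamp s - clamp v <= s - v.
  rewrite /clamp => ?.
  case: (ltP s) => ?; case: (ltP v) => ?; try case: (ltP 1 s) => ?; try case: (ltP 1 v) => ?; lra.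
have [|/ltW] := leP t u => /[dup] h /mono m.
- by rewrite distrC (distrC t) !ger0_norm //; lra.
- by rewrite !ger0_norm //; lra.
Qed.

(** Functions on the sides of a rectangle.  The parameter goes through [clamp]
    so that the integrand is continuous on the whole line. *)
Definition hside f y := fun t : R => f (clamp t +i* y).
Definition vside f x := fun t : R => f (x +i* clamp t).

Definition contour f x0 x1 y0 y1 : R[i] :=
  cint (hside f y0) x0 x1 - cint (hside f y1) x0 x1
  + 'i%C * (cint (vside f x1) y0 y1 - cint (vside f x0) y0 y1).

Lemma contour_splitx f x0 x x1 y0 y1 :
  contour f x0 x1 y0 y1 = contour f x0 x y0 y1 + contour f x x1 y0 y1.
Proof.
rewrite /contour -(cint_cat _ x0 x x1) -(cint_cat (hside f y1) x0 x x1); ring.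
Qed.

Lemma contour_splity f x0 x1 y0 y y1 :
  contour f x0 x1 y0 y1 = contour f x0 x1 y0 y + contour f x0 x1 y y1.
Proof.
rewrite /contour -(cint_cat _ y0 y y1) -(cint_cat (vside f x0) y0 y y1); ring.
Qed.

Definition in_square z := (-1 <= Re z <= 1) && (-1 <= Im z <= 1).

(** Continuity relative to the square [-1, 1] + i [-1, 1]. *)
Definition scont f z := forall e : R, 0 < e -> exists2 d : R, 0 < d &
  forall w, in_square w -> normc (w - z) < d -> normc (f w - f z) < e.

Definition square_continuous f := forall z, in_square z -> scont f z.

Lemma hside_continuous f y : -1 <= y <= 1 ->
  (forall t, scont f (clamp t +i* y)) -> curve_continuous (hside f y).
Proof.
move=> hy cf; apply: curve_continuousP => x e e0.
have hsq t : in_square (clamp t +i* y) by rewrite /in_square /= clamp_itv hy.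
have [d d0 H] := cf x e e0; exists d => // t xt.
rewrite /hside normc_subC; apply: H => //; apply: le_lt_trans xt.
rewrite distrC; apply: le_trans (normc_ReIm _) _; simpc => /=.
by rewrite normr0 addr0; exact: clamp_lip.
Qed.

Lemma vside_continuous f x : -1 <= x <= 1 ->
  (forall t, scont f (x +i* clamp t)) -> curve_continuous (vside f x).
Proof.
move=> hx cf; apply: curve_continuousP => y e e0.
have hsq t : in_square (x +i* clamp t) by rewrite /in_square /= clamp_itv hx.
have [d d0 H] := cf y e e0; exists d => // t xt.
rewrite /vside normc_subC; apply: H => //; apply: le_lt_trans xt.
rewrite distrC; apply: le_trans (normc_ReIm _) _; simpc => /=.
by rewrite normr0 add0r; exact: clamp_lip.
Qed.

Lemma affine_square_continuous k z : square_continuous (fun w => z + k * w).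
Proof.
move=> w hw e e0; exists (e / (normc k + 1)).
  by rewrite divr_gt0 // ltr_wpDl // normc_ge0.
move=> w' _; rewrite ltr_pdivlMr ?ltr_wpDl ?normc_ge0 // => h.
have -> : z + k * w' - (z + k * w) = k * (w' - w) by ring.
rewrite normcM; apply: le_lt_trans h.
by rewrite mulrC ler_wpM2l ?normc_ge0 // lerDl.
Qed.

Lemma scontD f g z : scont f z -> scont g z -> scont (fun w => f w + g w) z.
Proof.
move=> cf cg e e0; have e2 : 0 < e / 2 by rewrite divr_gt0.
have [d1 d10 H1] := cf _ e2; have [d2 d20 H2] := cg _ e2.
exists (Num.min d1 d2); first by rewrite lt_min d10.
move=> w hw; rewrite lt_min => /andP[/(H1 _ hw) h1 /(H2 _ hw) h2].
have -> : f w + g w - (f z + g z) = (f w - f z) + (g w - g z) by ring.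
by apply: le_lt_trans (normcD_le _ _) _; lra.
Qed.

Lemma square_continuousD f g : square_continuous f -> square_continuous g ->
  square_continuous (fun w => f w + g w).
Proof. by move=> cf cg z hz; apply: scontD; [exact: cf|exact: cg]. Qed.

Section on_rectangle.
Variables x0 x1 y0 y1 : R.
Hypotheses (hx0 : -1 <= x0) (hx : x0 <= x1) (hx1 : x1 <= 1).
Hypotheses (hy0 : -1 <= y0) (hy : y0 <= y1) (hy1 : y1 <= 1).

Local Ltac side_lra :=
  move: hx0 hx hx1 hy0 hy hy1 => ? ? ? ? ? ?; lra.

Definition sides_continuous f := [/\ curve_continuous (hside f y0),
  curve_continuous (hside f y1), curve_continuous (vside f x0) &
  curve_continuous (vside f x1)].

Lemma square_sides f : square_continuous f -> sides_continuous f.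
Proof.
have b1 : -1 <= x0 <= 1 by side_lra.
have b2 : -1 <= x1 <= 1 by side_lra.
have b3 : -1 <= y0 <= 1 by side_lra.
have b4 : -1 <= y1 <= 1 by side_lra.
move=> cf; split; [apply: hside_continuous|apply: hside_continuous|
  apply: vside_continuous|apply: vside_continuous] => // t; apply: cf;
  by rewrite /in_square /= clamp_itv ?b1 ?b2 ?b3 ?b4.
Qed.

Lemma contourD f g : sides_continuous f -> sides_continuous g ->
  contour (fun z => f z + g z) x0 x1 y0 y1 =
  contour f x0 x1 y0 y1 + contour g x0 x1 y0 y1.
Proof.
move=> [f1 f2 f3 f4] [g1 g2 g3 g4]; rewrite /contour.
rewrite (cintD _ _ _ f1 g1) // (cintD _ _ _ f2 g2) //.
rewrite (cintD _ _ _ f3 g3) // (cintD _ _ _ f4 g4) //.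
ring.
Qed.

Lemma contourZ k f : sides_continuous f ->
  contour (fun z => k * f z) x0 x1 y0 y1 = k * contour f x0 x1 y0 y1.
Proof.
move=> [f1 f2 f3 f4]; rewrite /contour.
rewrite (cintZ _ _ _ k f1) // (cintZ _ _ _ k f2) //.
rewrite (cintZ _ _ _ k f3) // (cintZ _ _ _ k f4) //.
ring.
Qed.

Definition on_sides z :=
  [&& x0 <= Re z <= x1, y0 <= Im z <= y1 &
   [|| Re z == x0, Re z == x1, Im z == y0 | Im z == y1]].

Lemma contour_le f (M : R) : sides_continuous f ->
  (forall z, on_sides z -> normc (f z) <= M) ->
  normc (contour f x0 x1 y0 y1) <= 4 * M * ((x1 - x0) + (y1 - y0)).
Proof.
move=> [f1 f2 f3 f4] fM; rewrite /contour.
have i1 : normc ('i%C : R[i]) = 1 by rewrite normc_imag normr1.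
apply: le_trans (normcD_le _ _) _; rewrite normcM i1 mul1r.
have h1 : normc (cint (hside f y0) x0 x1) <= 2 * M * (x1 - x0).
  apply: cint_le => // t ht; apply: fM; rewrite /on_sides /= clampE; last by side_lra.
  by rewrite ht lexx hy eqxx !orbT.
have h2 : normc (cint (hside f y1) x0 x1) <= 2 * M * (x1 - x0).
  apply: cint_le => // t ht; apply: fM; rewrite /on_sides /= clampE; last by side_lra.
  by rewrite ht lexx hy eqxx !orbT.
have h3 : normc (cint (vside f x0) y0 y1) <= 2 * M * (y1 - y0).
  apply: cint_le => // t ht; apply: fM; rewrite /on_sides /= clampE; last by side_lra.
  by rewrite ht lexx hx eqxx.
have h4 : normc (cint (vside f x1) y0 y1) <= 2 * M * (y1 - y0).
  apply: cint_le => // t ht; apply: fM; rewrite /on_sides /= clampE; last by side_lra.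
  by rewrite ht lexx hx eqxx !orbT.
have g1 := normcD_le (cint (hside f y0) x0 x1) (- cint (hside f y1) x0 x1).
have g2 := normcD_le (cint (vside f x1) y0 y1) (- cint (vside f x0) y0 y1).
rewrite normc_opp in g1; rewrite normc_opp in g2.
lra.
Qed.

Lemma contour_affine k z : contour (fun w => z + k * w) x0 x1 y0 y1 = 0.
Proof.
have cf := affine_square_continuous k z.
have [c1 c2 c3 c4] := square_sides cf; rewrite /contour.
have E1 : hside (fun w => z + k * w) y0 = (fun t => (k * (0 +i* (y0 - y1))) +
    hside (fun w => z + k * w) y1 t).
  apply/funext => t; rewrite /hside.
  have -> : clamp t +i* y0 = clamp t +i* y1 + (0 +i* (y0 - y1)).
    by simpc; congr (_ +i* _); ring.
  ring.
have E2 : vside (fun w => z + k * w) x1 = (fun t => (k * (x1 - x0)%:C) +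
    vside (fun w => z + k * w) x0 t).
  apply/funext => t; rewrite /vside.
  have -> : x1 +i* clamp t = x0 +i* clamp t + (x1 - x0)%:C.
    by simpc; congr (_ +i* _); ring.
  ring.
have cc (c : R[i]) : curve_continuous (fun _ : R => c).
  by split=> x; exact: cvg_cst.
rewrite E1 (cintD _ _ _ (cc _) c2) // E2 (cintD _ _ _ (cc _) c3) //.
rewrite !cint_cst // !addrK.
clear E1 E2 cf c1 c2 c3 c4.
by case: k => k1 k2; simpc; congr (_ +i* _); ring.
Qed.

End on_rectangle.
End Contour.

(** * Goursat's theorem *)

Section Subdivision.
Variable R : realType.

Lemma half_pow_lt (w d : R) : 0 <= w -> 0 < d -> exists n, w / 2 ^+ n < d.
Proof.
move=> w0 d0; exists (Num.bound (w / d)).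
rewrite ltr_pdivrMr ?exprn_gt0 // mulrC -ltr_pdivrMr //.
apply: lt_le_trans (archi_boundP _) _; first by rewrite divr_ge0 // ltW.
by rewrite -natrX ler_nat ltnW // ltn_expl.
Qed.

Lemma nested_intervals (u : nat -> R) (w : R) :
  (forall n, u n <= u n.+1) ->
  (forall n, u n.+1 + w / 2 ^+ n.+1 <= u n + w / 2 ^+ n) ->
  0 <= w ->
  exists X, forall n, u n <= X <= u n + w / 2 ^+ n.
Proof.
move=> up down w0.
have incr m n : (m <= n)%N -> u m <= u n.
  by move=> /subnK <-; elim: (n - m)%N => [|k ih] //=; rewrite addSn (le_trans ih).
have decr m n : (m <= n)%N -> u n + w / 2 ^+ n <= u m + w / 2 ^+ m.
  by move=> /subnK <-; elim: (n - m)%N => [|k ih] //=; rewrite addSn (le_trans _ ih).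
have pos n : 0 <= w / 2 ^+ n by rewrite divr_ge0 // exprn_ge0.
have cross m n : u m <= u n + w / 2 ^+ n.
  have [mn|/ltnW nm] := leqP m n.
    by rewrite (le_trans (incr _ _ mn)) // lerDl.
  by rewrite (le_trans _ (decr _ _ nm)) // lerDl.
exists (sup (range u)) => n; apply/andP; split.
  apply: ub_le_sup; last by exists n.
  by exists (u 0%N + w / 2 ^+ 0) => _ [m _ <-].
apply: ge_sup; first by exists (u 0%N); exists 0%N.
by move=> _ [m _ <-].
Qed.

(** If P failed on the rectangle it would fail on one of its quarters, then on
    a quarter of that one, and so on.  These rectangles shrink to a point, near
    which P holds by the second hypothesis. *)
Lemma rectangle_bisection (P : R -> R -> R -> R -> Prop) (x0 y0 w h : R) :
  0 <= w -> 0 <= h ->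
  (forall x y w h, P x y (w / 2) (h / 2) -> P (x + w / 2) y (w / 2) (h / 2) ->
     P x (y + h / 2) (w / 2) (h / 2) -> P (x + w / 2) (y + h / 2) (w / 2) (h / 2) ->
     P x y w h) ->
  (forall X Y, x0 <= X <= x0 + w -> y0 <= Y <= y0 + h ->
     exists2 d, 0 < d & forall x y w' h', 0 <= w' < d -> 0 <= h' < d ->
       x <= X <= x + w' -> y <= Y <= y + h' ->
       x0 <= x -> x + w' <= x0 + w -> y0 <= y -> y + h' <= y0 + h ->
       P x y w' h') ->
  P x0 y0 w h.
Proof.
move=> w0 h0 quarter loc; apply: contrapT => nP0.
pose W n := w / 2 ^+ n; pose H n := h / 2 ^+ n.
have WS n : W n.+1 = W n / 2 by rewrite /W exprSr invfM mulrA.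
have HS n : H n.+1 = H n / 2 by rewrite /H exprSr invfM mulrA.
have Wge n : 0 <= W n by rewrite /W divr_ge0 // exprn_ge0.
have Hge n : 0 <= H n by rewrite /H divr_ge0 // exprn_ge0.
pose good n (p q : R * R) := ~ P p.1 p.2 (W n) (H n) ->
  [/\ ~ P q.1 q.2 (W n.+1) (H n.+1),
      p.1 <= q.1 /\ q.1 + W n.+1 <= p.1 + W n &
      p.2 <= q.2 /\ q.2 + H n.+1 <= p.2 + H n].
have step (np : nat * (R * R)) : exists q, good np.1 np.2 q.
  case: np => n [x y] /=; rewrite /good /=; have := Wge n; have := Hge n => Hn Wn.
  have [h1|h1] := pselect (P x y (W n.+1) (H n.+1)); last first.
    by exists (x, y) => _ /=; split=> //; rewrite ?WS ?HS; lra.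
  have [h2|h2] := pselect (P (x + W n.+1) y (W n.+1) (H n.+1)); last first.
    by exists (x + W n.+1, y) => _ /=; split=> //; rewrite ?WS ?HS; lra.
  have [h3|h3] := pselect (P x (y + H n.+1) (W n.+1) (H n.+1)); last first.
    by exists (x, y + H n.+1) => _ /=; split=> //; rewrite ?WS ?HS; lra.
  have [h4|h4] := pselect (P (x + W n.+1) (y + H n.+1) (W n.+1) (H n.+1)); last first.
    by exists (x + W n.+1, y + H n.+1) => _ /=; split=> //; rewrite ?WS ?HS; lra.
  exists (x, y) => /=; case; rewrite !WS !HS in h1 h2 h3 h4; exact: quarter.
have [next nextP] := choice step.
pose s := fix s n := if n is m.+1 then next (m, s m) else (x0, y0).
have bad n : ~ P (s n).1 (s n).2 (W n) (H n).
  elim: n => [|n ih]; first by rewrite /W /H !expr0 !divr1.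
  by have [] := nextP (n, s n) ih.
have sP n : [/\ (s n).1 <= (s n.+1).1, (s n.+1).1 + W n.+1 <= (s n).1 + W n,
   (s n).2 <= (s n.+1).2 & (s n.+1).2 + H n.+1 <= (s n).2 + H n].
  by have [_ [? ?] [? ?]] := nextP (n, s n) (bad n).
have [|||X HX] := @nested_intervals (fun n => (s n).1) w => //.
- by move=> n; have [] := sP n.
- by move=> n; have [] := sP n.
have [|||Y HY] := @nested_intervals (fun n => (s n).2) h => //.
- by move=> n; have [] := sP n.
- by move=> n; have [] := sP n.
have inside n : [/\ x0 <= (s n).1, (s n).1 + W n <= x0 + w, y0 <= (s n).2 &
    (s n).2 + H n <= y0 + h].
  elim: n => [|n [? ? ? ?]]; first by rewrite /W /H !expr0 !divr1 /=; split=> //; lra.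
  by have [? ? ? ?] := sP n; split; lra.
have [||d d0 Hd] := loc X Y.
- by have := HX 0%N; rewrite expr0 divr1.
- by have := HY 0%N; rewrite expr0 divr1.
have [n1 Hn1] := half_pow_lt w0 d0; have [n2 Hn2] := half_pow_lt h0 d0.
have anti (v : R) m n : 0 <= v -> (m <= n)%N -> v / 2 ^+ n <= v / 2 ^+ m.
  move=> v0 mn; rewrite ler_wpM2l // lef_pV2 ?posrE ?exprn_gt0 //.
  by rewrite ler_weXn2l // ler1n.
pose n := maxn n1 n2; apply: (bad n); have [? ? ? ?] := inside n.
apply: Hd => //; try by [exact: HX|exact: HY].
- by rewrite Wge (le_lt_trans _ Hn1) // anti // leq_maxl.
- by rewrite Hge (le_lt_trans _ Hn2) // anti // leq_maxr.
Qed.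

End Subdivision.

Section CauchyGoursat.
Variable R : realType.
Implicit Types (f g : R[i] -> R[i]) (x y : R) (k z w : R[i]).

(** Complex differentiability relative to the square. *)
Definition cdiff f z := exists k, forall e : R, 0 < e ->
  exists2 d : R, 0 < d & forall w, in_square w -> normc (w - z) < d ->
    normc (f w - f z - k * (w - z)) <= e * normc (w - z).

(** On a small rectangle f is affine up to a small error, and affine functions
    have integral 0, so the integral is at most e times the square of the
    semi-perimeter.  This bound passes from the four quarters of a rectangle to
    the rectangle. *)
Lemma goursat f x0 x1 y0 y1 : square_continuous f ->
  -1 <= x0 -> x0 <= x1 -> x1 <= 1 -> -1 <= y0 -> y0 <= y1 -> y1 <= 1 ->
  (forall z, x0 <= Re z <= x1 -> y0 <= Im z <= y1 -> cdiff f z) ->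
  contour f x0 x1 y0 y1 = 0.
Proof.
move=> cf hx0 hx hx1 hy0 hy hy1 df.
pose S := (x1 - x0) + (y1 - y0).
suff H (e : R) : 0 < e -> normc (contour f x0 x1 y0 y1) <= e * S ^+ 2.
  apply/eqP; apply: contraT; rewrite -normc_gt0 => pos.
  have S2 : 0 <= S ^+ 2 by rewrite sqr_ge0.
  have e0 : 0 < normc (contour f x0 x1 y0 y1) / (2 * (S ^+ 2 + 1)).
    by rewrite divr_gt0 // mulr_gt0 // ltr_wpDl.
  have := H _ e0; set N := normc _ in pos *.
  by rewrite mulrAC ler_pdivlMr; nra.
move=> e0.
pose P (x y w h : R) := normc (contour f x (x + w) y (y + h)) <= e * (w + h) ^+ 2.
suff : P x0 y0 (x1 - x0) (y1 - y0) by rewrite /P /S !subrKC.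
apply: (@rectangle_bisection R P); [lra|lra| |].
  move=> x y w h; rewrite /P => h1 h2 h3 h4.
  rewrite (@contour_splitx _ _ _ (x + w / 2)) (@contour_splity _ _ x _ _ (y + h / 2)).
  rewrite (@contour_splity _ _ (x + w / 2) _ _ (y + h / 2)).
  have E1 : x + w / 2 + w / 2 = x + w by field.
  have E2 : y + h / 2 + h / 2 = y + h by field.
  rewrite E1 in h2 h4; rewrite E2 in h3 h4.
  apply: le_trans (normcD_le _ _) _.
  have := normcD_le (contour f x (x + w / 2) y (y + h / 2))
    (contour f x (x + w / 2) (y + h / 2) (y + h)).
  have := normcD_le (contour f (x + w / 2) (x + w) y (y + h / 2))
    (contour f (x + w / 2) (x + w) (y + h / 2) (y + h)).
  have -> : e * (w + h) ^+ 2 = 4 * (e * (w / 2 + h / 2) ^+ 2) by field.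
  clear - h1 h2 h3 h4; lra.
move=> X Y hX hY.
have [||k Hk] := df (X +i* Y); [by rewrite /=; lra|by rewrite /=; lra|].
have e8 : 0 < e / 8 by lra.
have [d d0 Hd] := Hk _ e8; exists (d / 2); first lra.
move=> x y w h hw hh hxX hyY a1 a2 a3 a4; rewrite /P.
have [b1 b2 b3 b4] : [/\ -1 <= x, x + w <= 1, -1 <= y & y + h <= 1] by split; lra.
have b5 : x <= x + w by lra.
have b6 : y <= y + h by lra.
pose Z := X +i* Y; pose A z := (f Z - k * Z) + k * z.
pose r z := f z + ((k * Z - f Z) + (- k) * z).
have cA : square_continuous A by exact: affine_square_continuous.
have cr : square_continuous r.
  by apply: square_continuousD => //; exact: affine_square_continuous.
have -> : f = (fun z => A z + r z) by apply/funext => z; rewrite /A /r; ring.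
rewrite contourD //; try exact: square_sides.
rewrite contour_affine // add0r.
apply: le_trans (@contour_le _ _ _ _ _ _ _ _ _ _ _ r (e / 8 * (w + h)) _ _) _ => //.
- exact: square_sides.
- move=> z /and3P[zx zy _].
  have zZ : normc (z - Z) <= w + h.
    apply: le_trans (normc_ReIm _) _; move: zx zy; case: (z) => a b /= zx zy.
    by apply: lerD; rewrite ler_norml; lra.
  have -> : r z = f z - f Z - k * (z - Z) by rewrite /r; ring.
  apply: le_trans (Hd _ _ _) _.
  + by rewrite /in_square; apply/andP; split; lra.
  + by apply: le_lt_trans zZ _; lra.
  + by rewrite ler_wpM2l //; lra.
- have -> : x + w - x + (y + h - y) = w + h by ring.
  have : 0 <= e * (w + h) ^+ 2 by rewrite mulr_ge0 ?sqr_ge0 // ltW.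
  have -> : 4 * (e / 8 * (w + h)) * (w + h) = (e * (w + h) ^+ 2) / 2 by field.
  lra.
Qed.

End CauchyGoursat.

(** * Rules for complex differentiability; exceptional points *)

Section SquareContinuity.
Variable R : realType.
Implicit Types (f g : R[i] -> R[i]) (k z w a : R[i]).

Lemma scont_cst k z : scont (fun=> k) z.
Proof. by move=> e e0; exists 1 => // w _ _; rewrite subrr normc0. Qed.

Lemma scont_id z : scont id z.
Proof. by move=> e e0; exists e. Qed.

Lemma scont_local f g z (d : R) : 0 < d ->
  (forall w, in_square w -> normc (w - z) < d -> f w = g w) -> in_square z ->
  scont f z -> scont g z.
Proof.
move=> d0 fg hz cf e e0; have [d1 d10 H] := cf e e0.
exists (Num.min d d1); first by rewrite lt_min d0.
move=> w hw; rewrite lt_min => /andP[h1 h2].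
by rewrite -!fg ?subrr ?normc0 //; exact: H.
Qed.

Lemma scontM f g z : scont f z -> scont g z -> scont (fun w => f w * g w) z.
Proof.
move=> cf cg e e0; pose A := normc (f z) + 1; pose B := normc (g z) + 1.
have A0 : 0 < A by rewrite ltr_wpDl ?normc_ge0.
have B0 : 0 < B by rewrite ltr_wpDl ?normc_ge0.
have eA : 0 < e / 2 / A by rewrite !divr_gt0.
have eB : 0 < e / 2 / B by rewrite !divr_gt0.
have [d1 d10 H1] := cf _ eB; have [d2 d20 H2] := cg _ eA.
have [d3 d30 H3] := cg _ ltr01.
exists (Num.min d1 (Num.min d2 d3)); first by rewrite !lt_min d10 d20.
move=> w hw; rewrite !lt_min => /and3P[/(H1 _ hw) h1 /(H2 _ hw) h2 /(H3 _ hw) h3].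
have -> : f w * g w - f z * g z = (f w - f z) * g w + f z * (g w - g z) by ring.
apply: le_lt_trans (normcD_le _ _) _; rewrite !normcM.
have gB : normc (g w) <= B.
  by have := normcD_le (g w - g z) (g z); rewrite subrK /B; lra.
have fA : normc (f z) <= A by rewrite /A; lra.
move: h1 h2; rewrite !ltr_pdivlMr // => h1 h2.
have : normc (f w - f z) * normc (g w) <= normc (f w - f z) * B.
  by rewrite ler_wpM2l ?normc_ge0.
have : normc (f z) * normc (g w - g z) <= A * normc (g w - g z).
  by rewrite ler_wpM2r ?normc_ge0.
lra.
Qed.

Lemma scontV f z : f z != 0 -> scont f z -> scont (fun w => (f w)^-1) z.
Proof.
rewrite -normc_gt0; set n := normc (f z) => n0 cf e e0.
have n2 : 0 < n / 2 by rewrite divr_gt0.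
have en : 0 < e * (n ^+ 2 / 2) by rewrite mulr_gt0 // divr_gt0 // exprn_gt0.
have [d1 d10 H1] := cf _ n2; have [d2 d20 H2] := cf _ en.
exists (Num.min d1 d2); first by rewrite lt_min d10.
move=> w hw; rewrite lt_min => /andP[/(H1 _ hw) h1 /(H2 _ hw) h2].
have fw : n / 2 < normc (f w).
  by have := normcD_le (f z - f w) (f w); rewrite subrK normc_subC -/n; lra.
have fw0 : f w != 0 by rewrite -normc_gt0 (lt_trans n2).
have fz0 : f z != 0 by rewrite -normc_gt0.
have -> : (f w)^-1 - (f z)^-1 = - (f w - f z) / (f w * f z).
  by field; rewrite fw0 fz0.
rewrite normcM normcV normc_opp normcM -/n ltr_pdivrMr; last first.
  by rewrite mulr_gt0 // (lt_trans n2).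
apply: lt_trans h2 _; rewrite ltr_pM2l // expr2 mulrAC ltr_pM2r //.
Qed.

Lemma scont_invB a z : z != a -> scont (fun w => (w - a)^-1) z.
Proof.
move=> za; apply: (@scontV (fun w => w - a)); first by rewrite subr_eq0.
apply: scontD; [exact: scont_id|exact: scont_cst].
Qed.

(** Caratheodory's form of differentiability, from which the rules for sums,
    products and inverses follow from those for continuity. *)
Lemma cdiffP f z : in_square z -> cdiff f z ->
  exists2 phi, scont phi z & forall w, f w - f z = phi w * (w - z).
Proof.
move=> hz [k Hk].
exists (fun w => if w == z then k else (f w - f z) / (w - z)).
  move=> e e0; have e2 : 0 < e / 2 by rewrite divr_gt0.
  have [d d0 Hd] := Hk _ e2; exists d => // w hw wz.
  rewrite /= eqxx; case: eqVneq => [_|nwz]; first by rewrite subrr normc0.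
  have wz0 : w - z != 0 by rewrite subr_eq0.
  have -> : (f w - f z) / (w - z) - k = (f w - f z - k * (w - z)) / (w - z).
    by field.
  rewrite normcM normcV ltr_pdivrMr ?normc_gt0 //.
  apply: le_lt_trans (Hd w hw wz) _; rewrite ltr_pM2r ?normc_gt0 //; lra.
move=> w; have [->|nwz] := eqVneq w z; first by rewrite !subrr mulr0.
by rewrite divfK // subr_eq0.
Qed.

Lemma caratheodory_cdiff f phi z (d : R) : 0 < d -> scont phi z ->
  (forall w, in_square w -> normc (w - z) < d -> f w - f z = phi w * (w - z)) ->
  cdiff f z.
Proof.
move=> d0 cphi H; exists (phi z) => e e0; have [d1 d10 H1] := cphi e e0.
exists (Num.min d d1); first by rewrite lt_min d0.
move=> w hw; rewrite lt_min => /andP[/(H _ hw) E /(H1 _ hw) h1]; rewrite E.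
by rewrite -mulrBl normcM ler_wpM2r ?normc_ge0 // ltW.
Qed.

Lemma cdiff_scont f z : in_square z -> cdiff f z -> scont f z.
Proof.
move=> hz /(cdiffP hz)[phi cphi H].
apply: (@scont_local (fun w => f z + phi w * (w - z)) _ _ 1) => //.
  by move=> w _ _; rewrite -H subrKC.
apply: scontD; first exact: scont_cst.
apply: scontM => //; apply: scontD; [exact: scont_id|exact: scont_cst].
Qed.

Lemma cdiffM f g z : in_square z -> cdiff f z -> cdiff g z ->
  cdiff (fun w => f w * g w) z.
Proof.
move=> hz df dg; have cf := cdiff_scont hz df.
have [phi cphi H1] := cdiffP hz df; have [psi cpsi H2] := cdiffP hz dg.
apply: (@caratheodory_cdiff _ (fun w => f w * psi w + g z * phi w) _ 1) => //.
  by apply: scontD; apply: scontM => //; exact: scont_cst.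
move=> w _ _; rewrite mulrDl -!mulrA -H1 -H2; ring.
Qed.

Lemma cdiffD f g z : in_square z -> cdiff f z -> cdiff g z ->
  cdiff (fun w => f w + g w) z.
Proof.
move=> hz df dg.
have [phi cphi H1] := cdiffP hz df; have [psi cpsi H2] := cdiffP hz dg.
apply: (@caratheodory_cdiff _ (fun w => phi w + psi w) _ 1) => //.
  exact: scontD.
move=> w _ _; rewrite mulrDl -H1 -H2; ring.
Qed.

Lemma cdiffV f z : in_square z -> cdiff f z -> f z != 0 ->
  cdiff (fun w => (f w)^-1) z.
Proof.
move=> hz df fz0; have cf := cdiff_scont hz df.
have [phi cphi H1] := cdiffP hz df.
have n0 : 0 < normc (f z) by rewrite normc_gt0.
have [d d0 Hd] := cf _ n0.
apply: (@caratheodory_cdiff _ (fun w => - (f w)^-1 * ((f z)^-1 * phi w)) _ d) => //.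
  apply: scontM; last by apply: scontM => //; exact: scont_cst.
  apply: (@scont_local (fun w => (-1) * (f w)^-1) _ _ 1) => //.
    by move=> w _ _; rewrite mulN1r.
  by apply: scontM; [exact: scont_cst|exact: scontV].
move=> w hw /(Hd _ hw) h.
have fw0 : f w != 0.
  by apply: contraTneq h => ->; rewrite sub0r normc_opp ltxx.
by rewrite -!mulrA -H1; field; rewrite fw0 fz0.
Qed.

Lemma cdiff_affine k a z : cdiff (fun w => a + k * w) z.
Proof.
exists k => e e0; exists 1 => // w _ _.
have -> : a + k * w - (a + k * z) - k * (w - z) = 0 by ring.
by rewrite normc0 mulr_ge0 ?normc_ge0 // ltW.
Qed.

Lemma cdiff_local f g z (d : R) : 0 < d -> in_square z ->
  (forall w, normc (w - z) < d -> f w = g w) -> cdiff f z -> cdiff g z.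
Proof.
move=> d0 hz fg [k Hk]; exists k => e e0; have [d1 d10 H1] := Hk e e0.
exists (Num.min d d1); first by rewrite lt_min d0.
move=> w hw; rewrite lt_min => /andP[h1 h2].
by rewrite -!fg ?subrr ?normc0 //; exact: H1.
Qed.

Lemma cdiff_ext f g z : (forall w, f w = g w) -> cdiff f z -> cdiff g z.
Proof. by move=> fg; have -> : f = g by apply/funext. Qed.

End SquareContinuity.

Section Cauchy.
Variable R : realType.
Implicit Types (f g : R[i] -> R[i]) (k z w a : R[i]).

Lemma cut_near (x0 x1 b e : R) : 0 < e -> x0 <= b <= x1 ->
  exists xl xr, [/\ x0 <= xl <= b, b <= xr <= x1, b - xl <= e /\ xr - b <= e,
    xl = x0 \/ xl < b & xr = x1 \/ b < xr].
Proof.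
move=> e0 hb; exists (if x0 <= b - e then b - e else x0).
exists (if b + e <= x1 then b + e else x1).
case: (leP x0 (b - e)) => ?; case: (leP (b + e) x1) => ?; split; try split; try lra;
  first [left; lra|right; lra].
Qed.

Lemma contour_flatx f x y0 y1 : contour f x x y0 y1 = 0.
Proof. by rewrite /contour !cint0 !subrr mulr0 addr0. Qed.

Lemma contour_flaty f x0 x1 y : contour f x0 x1 y y = 0.
Proof. by rewrite /contour !cint0 !subrr mulr0 addr0. Qed.

(** The complement of the small rectangle around b is cut into four strips, on
    which the integral vanishes; a strip degenerates where the small rectangle
    touches a side of the large one. *)
Lemma contour_shrink f b (x0 x1 y0 y1 xl xr yl yr : R) :
  (forall u0 u1 v0 v1, x0 <= u0 -> u0 <= u1 -> u1 <= x1 ->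
    y0 <= v0 -> v0 <= v1 -> v1 <= y1 ->
    ~ (u0 <= Re b <= u1 /\ v0 <= Im b <= v1) -> contour f u0 u1 v0 v1 = 0) ->
  x0 <= xl <= Re b -> Re b <= xr <= x1 -> y0 <= yl <= Im b -> Im b <= yr <= y1 ->
  xl = x0 \/ xl < Re b -> xr = x1 \/ Re b < xr ->
  yl = y0 \/ yl < Im b -> yr = y1 \/ Im b < yr ->
  contour f x0 x1 y0 y1 = contour f xl xr yl yr.
Proof.
move: (Re b) (Im b) => c d off /andP[a1 a2] /andP[a3 a4] /andP[a5 a6] /andP[a7 a8] cxl cxr cyl cyr.
rewrite (@contour_splitx _ _ x0 xl) (@contour_splitx _ _ xl xr).
have -> : contour f x0 xl y0 y1 = 0.
  case: cxl => [->|h]; first exact: contour_flatx.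
  by apply: off; try lra; case=> ? ?; lra.
have -> : contour f xr x1 y0 y1 = 0.
  case: cxr => [->|h]; first exact: contour_flatx.
  by apply: off; try lra; case=> ? ?; lra.
rewrite add0r addr0 (@contour_splity _ _ _ _ y0 yl) (@contour_splity _ _ _ _ yl yr).
have -> : contour f xl xr y0 yl = 0.
  case: cyl => [->|h]; first exact: contour_flaty.
  by apply: off; try lra; case=> ? ?; lra.
have -> : contour f xl xr yr y1 = 0.
  case: cyr => [->|h]; first exact: contour_flaty.
  by apply: off; try lra; case=> ? ?; lra.
by rewrite add0r addr0.
Qed.

(** Induction on the exceptional points.  By [contour_shrink] the integral is the
    one over a rectangle of size e around b, which is O(e) because f is bounded
    near b. *)
Lemma goursat_except f (s : seq R[i]) (x0 x1 y0 y1 : R) : square_continuous f ->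
  -1 <= x0 -> x0 <= x1 -> x1 <= 1 -> -1 <= y0 -> y0 <= y1 -> y1 <= 1 ->
  (forall z, x0 <= Re z <= x1 -> y0 <= Im z <= y1 -> z \notin s -> cdiff f z) ->
  contour f x0 x1 y0 y1 = 0.
Proof.
move=> cf; elim: s x0 x1 y0 y1 => [|b s ih] x0 x1 y0 y1 hx0 hx hx1 hy0 hy hy1 df.
  by apply: goursat => // z zx zy; exact: df.
have ih' u0 u1 v0 v1 : x0 <= u0 -> u0 <= u1 -> u1 <= x1 ->
    y0 <= v0 -> v0 <= v1 -> v1 <= y1 ->
    ~ (u0 <= Re b <= u1 /\ v0 <= Im b <= v1) -> contour f u0 u1 v0 v1 = 0.
  move=> a1 a2 a3 a4 a5 a6 nb; apply: ih; try lra.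
  move=> z zu zv zs; apply: df; [lra|lra|].
  rewrite inE negb_or zs andbT; apply/eqP => zb.
  by apply: nb; rewrite -zb.
have [[bx by_]|nb] := pselect (x0 <= Re b <= x1 /\ y0 <= Im b <= y1); last first.
  by apply: ih' => //; lra.
have bsq : in_square b by rewrite /in_square; apply/andP; split; lra.
have [d0 d00 Hd] := cf b bsq _ ltr01.
pose M := normc (f b) + 1.
have M0 : 0 < M by rewrite /M ltr_wpDl ?normc_ge0.
suff H (e : R) : 0 < e -> 2 * e < d0 -> normc (contour f x0 x1 y0 y1) <= 16 * M * e.
  apply/eqP; apply: contraT; rewrite -normc_gt0; set N := normc _ => N0.
  pose e := Num.min (N / (32 * M)) (d0 / 4).
  have e0 : 0 < e by rewrite lt_min !divr_gt0 // mulr_gt0.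
  have e1 : e <= N / (32 * M) by rewrite ge_min lexx.
  have e2 : e <= d0 / 4 by rewrite ge_min lexx orbT.
  have := H e e0; rewrite -/N.
  have : 2 * e < d0 by lra.
  move=> h1 /(_ h1) h2; rewrite ler_pdivlMr in e1; last by rewrite mulr_gt0.
  lra.
move=> e0 ed.
have [xl [xr [hxl hxr [hl hr] cxl cxr]]] := cut_near e0 bx.
have [yl [yr [hyl hyr [gl gr] cyl cyr]]] := cut_near e0 by_.
rewrite (contour_shrink ih' hxl hxr hyl hyr cxl cxr cyl cyr) {ih' ih df}.
have [a1 a2 a3] : [/\ -1 <= xl, xl <= xr & xr <= 1] by split; lra.
have [a4 a5 a6] : [/\ -1 <= yl, yl <= yr & yr <= 1] by split; lra.
apply: le_trans (@contour_le _ xl xr yl yr a1 a2 a3 a4 a5 a6 f M _ _) _.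
- exact: square_sides.
- move=> z /and3P[zx zy _].
  have zb : normc (z - b) < d0.
    apply: le_lt_trans (normc_ReIm _) _.
    have -> : Re (z - b) = Re z - Re b by case: (z) (b) => [? ?] [? ?].
    have -> : Im (z - b) = Im z - Im b by case: (z) (b) => [? ?] [? ?].
    have : `|Re z - Re b| <= e by rewrite ler_norml; lra.
    have : `|Im z - Im b| <= e by rewrite ler_norml; lra.
    lra.
  have zsq : in_square z by rewrite /in_square; apply/andP; split; lra.
  have := Hd z zsq zb; have := normcD_le (f z - f b) (f b).
  rewrite subrK /M; lra.
- have -> : 16 * M * e = 4 * M * (4 * e) by ring.
  have M4 : 0 <= 4 * M by rewrite mulr_ge0 // ltW.
  rewrite ler_wpM2l //; clear - hl hr gl gr; lra.
Qed.

End Cauchy.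

(** * Cauchy's formula on a square *)

Section CauchyFormula.
Variable R : realType.
Implicit Types (f g : R[i] -> R[i]) (k z w a : R[i]).

Definition oint f : R[i] := contour f (-1) 1 (-1) 1.

Definition on_boundary z := @on_sides R (-1) 1 (-1) 1 z.

Let leN11 : (-1 : R) <= 1. Proof. lra. Qed.

Lemma boundary_square z : on_boundary z -> in_square z.
Proof. by case/and3P => h1 h2 _; rewrite /in_square h1 h2. Qed.

Lemma boundary_normc z : on_boundary z -> 1 <= normc z.
Proof.
case/and3P => _ _ h; have [hr hi] := (Re_normc z, Im_normc z).
have one (t : R) : t = 1 \/ t = -1 -> 1 <= `|t|.
  by case=> ->; rewrite ?normrN normr1.
have [/one|/one] : (Re z = 1 \/ Re z = -1) \/ (Im z = 1 \/ Im z = -1).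
- by case/or4P: h => /eqP; tauto.
- by move=> h1; apply: le_trans hr.
- by move=> h1; apply: le_trans hi.
Qed.

Lemma boundaryB_normc z a : on_boundary z -> normc a <= 2^-1 -> 2^-1 <= normc (z - a).
Proof.
move=> /boundary_normc hz ha; have := normcD_le (z - a) a; rewrite subrK; lra.
Qed.

Lemma boundary_neq z a : on_boundary z -> normc a <= 2^-1 -> z != a.
Proof.
move=> hz ha; rewrite -subr_eq0 -normc_gt0.
by apply: lt_le_trans (boundaryB_normc hz ha); rewrite invr_gt0.
Qed.

Lemma boundary_sides f : (forall z, on_boundary z -> scont f z) ->
  sides_continuous (-1) 1 (-1) 1 f.
Proof.
have b1 : -1 <= (-1 : R) <= 1 by lra.
have b2 : -1 <= (1 : R) <= 1 by lra.
move=> cf; split; [apply: hside_continuous|apply: hside_continuous|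
  apply: vside_continuous|apply: vside_continuous] => // t; apply: cf;
  by rewrite /on_boundary /on_sides /= clamp_itv ?b1 ?b2 ?eqxx ?orbT.
Qed.

Lemma eq_oint f g : (forall z, on_boundary z -> f z = g z) -> oint f = oint g.
Proof.
have b1 : -1 <= (-1 : R) <= 1 by lra.
have b2 : -1 <= (1 : R) <= 1 by lra.
have bd : [/\ forall t : R, on_boundary (clamp t +i* (-1)),
  forall t : R, on_boundary (clamp t +i* 1),
  forall t : R, on_boundary ((-1) +i* clamp t) &
  forall t : R, on_boundary (1 +i* clamp t)].
  by split=> t; rewrite /on_boundary /on_sides /= clamp_itv ?b1 ?b2 ?eqxx ?orbT.
case: bd => h1 h2 h3 h4 fg; rewrite /oint /contour.
have -> : hside f (-1) = hside g (-1) by apply/funext => t; exact: fg.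
have -> : hside f 1 = hside g 1 by apply/funext => t; exact: fg.
have -> : vside f (-1) = vside g (-1) by apply/funext => t; exact: fg.
by have -> : vside f 1 = vside g 1 by apply/funext => t; exact: fg.
Qed.

Lemma ointD f g : (forall z, on_boundary z -> scont f z) ->
  (forall z, on_boundary z -> scont g z) ->
  oint (fun z => f z + g z) = oint f + oint g.
Proof. by move=> cf cg; apply: contourD => //; exact: boundary_sides. Qed.

Lemma ointZ k f : (forall z, on_boundary z -> scont f z) ->
  oint (fun z => k * f z) = k * oint f.
Proof. by move=> cf; apply: contourZ => //; exact: boundary_sides. Qed.

Lemma oint_le f (M : R) : (forall z, on_boundary z -> scont f z) ->
  (forall z, on_boundary z -> normc (f z) <= M) -> normc (oint f) <= 16 * M.
Proof.
move=> cf fM; apply: le_trans (@contour_le _ _ _ _ _ _ _ _ _ _ _ f M _ fM) _ => //.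
  exact: boundary_sides.
have -> : 4 * M * (1 - -1 + (1 - -1)) = 16 * M by ring.
by [].
Qed.

Lemma in_square_half a : normc a <= 2^-1 -> in_square a.
Proof.
move=> ha; have := Re_normc a; have := Im_normc a.
by rewrite !ler_norml => h1 h2; rewrite /in_square; apply/andP; split; lra.
Qed.

(** For a inside the square this is 2 i pi.  The estimates below rest on its
    being close to its value at a = 0, which is not zero. *)
Definition cauchy_kernel a := oint (fun z => (z - a)^-1).

Lemma scont_kernel a z : on_boundary z -> normc a <= 2^-1 ->
  scont (fun w => (w - a)^-1) z.
Proof. by move=> hz ha; apply/scont_invB/boundary_neq. Qed.

(** The quotient (g z - g a) / (z - a) extends continuously to a, so its
    integral vanishes by [goursat_except] even if the extension is not
    differentiable at a.  The list s allows the formula to be applied to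
    functions which are themselves such quotients. *)
Lemma cauchy_formula g (s : seq R[i]) a : square_continuous g ->
  (forall z, in_square z -> z \notin s -> cdiff g z) ->
  normc a <= 2^-1 -> cdiff g a ->
  oint (fun z => g z * (z - a)^-1) = g a * cauchy_kernel a.
Proof.
move=> cg dg ha ga; have asq := in_square_half ha.
have [phi cphi phiE] := cdiffP asq ga.
have phiq z : z != a -> phi z = (g z + (- g a)) * (z - a)^-1.
  by move=> za; rewrite phiE mulfK // subr_eq0.
have near_neq z : z != a -> exists2 d : R, 0 < d & forall w, normc (w - z) < d -> w != a.
  move=> za; exists (normc (z - a)); first by rewrite normc_gt0 subr_eq0.
  by move=> w; apply: contraTneq => ->; rewrite normc_subC ltxx.
have Dquot z : in_square z -> z != a -> cdiff g z -> cdiff phi z.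
  move=> hz za gz; have [d d0 Hd] := near_neq z za.
  apply: (@cdiff_local _ (fun w => (g w + (- g a)) * (w - a)^-1) _ _ d) => //.
    by move=> w /Hd wa; rewrite -phiq.
  apply: cdiffM => //.
    apply: cdiffD => //.
    by apply: cdiff_ext (cdiff_affine 0 (- g a) z) => w; rewrite mul0r addr0.
  apply: (@cdiffV _ (fun w => w - a)) => //; last by rewrite subr_eq0.
  by apply: cdiff_ext (cdiff_affine 1 (- a) z) => w; rewrite mul1r addrC.
have sphi : square_continuous phi.
  move=> z hz; have [->//|za] := eqVneq z a; have [d d0 Hd] := near_neq z za.
  apply: (@scont_local _ (fun w => (g w + (- g a)) * (w - a)^-1) _ _ d) => //.
    by move=> w _ /Hd wa; rewrite -phiq.
  apply: scontM; last exact: scont_invB.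
  by apply: scontD; [exact: cg|exact: scont_cst].
have : oint phi = 0.
  apply: (@goursat_except _ _ (a :: s)) => //; try lra.
  move=> z zx zy; rewrite inE negb_or => /andP[za zs].
  have zsq : in_square z by rewrite /in_square zx zy.
  by apply: Dquot => //; exact: dg.
have ck z : on_boundary z -> scont (fun w => (w - a)^-1) z.
  by move=> hz; exact: scont_kernel.
have cgk z : on_boundary z -> scont (fun w => g w * (w - a)^-1) z.
  by move=> hz; apply: scontM; [exact/cg/boundary_square|exact: ck].
have E : oint (fun z => g z * (z - a)^-1) = oint (fun z => phi z + g a * (z - a)^-1).
  apply: eq_oint => z hz; rewrite phiq ?boundary_neq //; ring.
rewrite {}E ointD; first by move=> ->; rewrite add0r ointZ.
  by move=> z hz; exact/sphi/boundary_square.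
by move=> z hz; apply: scontM; [exact: scont_cst|exact: ck].
Qed.

(** On each side of the square the integral of 1 / z contributes an integral of
    1 / (1 + t^2) to the imaginary part, and these add up. *)
Lemma cauchy_kernel0_neq0 : cauchy_kernel 0 != 0.
Proof.
suff : Im (cauchy_kernel 0) != 0 by apply: contraNneq => ->.
have sc : sides_continuous (-1) 1 (-1) 1 (fun z : R[i] => (z - 0)^-1).
  apply: boundary_sides => z hz; apply: scont_kernel => //.
  by rewrite normc0 invr_ge0.
case: sc => [[_ c1] [_ c2] [c3 _] [c4 _]].
have ImE (b1 b2 b3 b4 b5 b6 b7 b8 : R) :
    Im (b1 +i* b2 - (b3 +i* b4) + 'i%C * (b5 +i* b6 - (b7 +i* b8))) =
    b2 - b4 + (b5 - b7) by simpc => /=; ring.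
pose F z : R[i] := (z - 0)^-1.
have -> : Im (cauchy_kernel 0) =
    rint (fun t => Im (hside F (-1) t)) (-1) 1 - rint (fun t => Im (hside F 1 t)) (-1) 1
    + (rint (fun t => Re (vside F 1 t)) (-1) 1 - rint (fun t => Re (vside F (-1) t)) (-1) 1).
  by rewrite /cauchy_kernel /oint /contour /cint ImE.
have [t1 _ ->] := rint_MVT (lexx (-1)) leN11 (lexx 1) c1.
have [t2 _ ->] := rint_MVT (lexx (-1)) leN11 (lexx 1) c2.
have [t3 _ ->] := rint_MVT (lexx (-1)) leN11 (lexx 1) c3.
have [t4 _ ->] := rint_MVT (lexx (-1)) leN11 (lexx 1) c4.
rewrite /hside /vside !subr0 /=.
have pos (t : R) : 0 < (clamp t ^+ 2 + 1)^-1.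
  by rewrite invr_gt0 ltr_wpDl // sqr_ge0.
have := pos t1; have := pos t2; have := pos t3; have := pos t4.
rewrite !sqrrN !expr1n ![1 + _ ^+ 2]addrC !mulNr !mul1r ?opprK.
set u1 := (_ + 1)^-1; set u2 := (_ + 1)^-1; set u3 := (_ + 1)^-1; set u4 := (_ + 1)^-1.
by move=> *; apply: lt0r_neq0; lra.
Qed.

Lemma normc0_half : normc (0 : R[i]) <= 2^-1.
Proof. by rewrite normc0 invr_ge0. Qed.

#[local] Hint Resolve normc0_half : core.

(** 1 / (z - a) = 1 / z + a / (z (z - a)). *)
Lemma oint_kernel_step f a : (forall z, on_boundary z -> scont f z) ->
  normc a <= 2^-1 ->
  oint (fun z => f z * (z - a)^-1) = oint (fun z => f z * (z - 0)^-1)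
    + a * oint (fun z => f z * (z - 0)^-1 * (z - a)^-1).
Proof.
move=> cf ha.
have cf0 z : on_boundary z -> scont (fun w => f w * (w - 0)^-1) z.
  by move=> hz; apply: scontM; [exact: cf|exact: scont_kernel].
have cfa z : on_boundary z -> scont (fun w => f w * (w - 0)^-1 * (w - a)^-1) z.
  by move=> hz; apply: scontM; [exact: cf0|exact: scont_kernel].
rewrite -ointZ // -ointD //; last first.
  by move=> z hz; apply: scontM; [exact: scont_cst|exact: cfa].
apply: eq_oint => z hz.
have za := boundary_neq hz ha; have z0 := boundary_neq hz normc0_half.
rewrite subr0; field; rewrite subr_eq0 z0 za //.
Qed.

Lemma oint_kernel_le f (M : R) a : (forall z, on_boundary z -> scont f z) ->
  (forall z, on_boundary z -> normc (f z) <= M) -> normc a <= 2^-1 ->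
  normc (oint (fun z => f z * (z - a)^-1)) <= 32 * M.
Proof.
move=> cf fM ha; have -> : 32 * M = 16 * (M * 2) by ring.
apply: oint_le => z hz.
  by apply: scontM; [exact: cf|exact: scont_kernel].
rewrite normcM normcV ler_pM ?invr_ge0 ?normc_ge0 ?fM //.
rewrite -[2]invrK lef_pV2 ?posrE ?invr_gt0 ?boundaryB_normc //.
by apply: lt_le_trans (boundaryB_normc hz ha); rewrite invr_gt0.
Qed.

Lemma div_boundary f (M : R) : (forall z, on_boundary z -> scont f z) ->
  (forall z, on_boundary z -> normc (f z) <= M) ->
  (forall z, on_boundary z -> scont (fun w => f w * (w - 0)^-1) z) /\
  (forall z, on_boundary z -> normc (f z * (z - 0)^-1) <= M).
Proof.
move=> cf fM; split=> z hz; first by apply: scontM; [exact: cf|exact: scont_kernel].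
rewrite subr0 normcM normcV -[M]mulr1 ler_pM ?invr_ge0 ?normc_ge0 ?fM //.
rewrite -[1]invr1 lef_pV2 ?posrE ?boundary_normc //.
by apply: lt_le_trans (boundary_normc hz).
Qed.

Lemma cauchy_kernel_lip a : normc a <= 2^-1 ->
  normc (cauchy_kernel a - cauchy_kernel 0) <= 32 * normc a.
Proof.
move=> ha; have c1 z : on_boundary z -> scont (fun=> 1 : R[i]) z.
  by move=> *; exact: scont_cst.
have b1 z : on_boundary z -> normc (1 : R[i]) <= 1 by rewrite normc1.
have oneE b : oint (fun z => 1 * (z - b)^-1) = cauchy_kernel b.
  by apply: eq_oint => z _; rewrite mul1r.
have E := oint_kernel_step c1 ha; rewrite !oneE in E.
rewrite E addrAC subrr add0r normcM mulrC ler_wpM2r ?normc_ge0 //.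
have [c2 b2] := div_boundary c1 b1.
by have := oint_kernel_le c2 b2 ha; rewrite mulr1.
Qed.

(** A positive number (in fact 2 pi); it serves as the unit for the radii and
    the bounds of the estimates. *)
Definition kappa : R := normc (cauchy_kernel 0).

Lemma kappa_gt0 : 0 < kappa.
Proof. by rewrite normc_gt0 cauchy_kernel0_neq0. Qed.

Lemma cauchy_kernel_lower a : normc a <= 2^-1 -> normc a <= kappa / 64 ->
  kappa / 2 <= normc (cauchy_kernel a).
Proof.
move=> /cauchy_kernel_lip h1 h2.
have := normcD_le (cauchy_kernel 0 - cauchy_kernel a) (cauchy_kernel a).
rewrite subrK normc_subC -/kappa; lra.
Qed.

(** A Schwarz-type estimate: g - g 0 vanishes at 0, so in its Cauchy integral
    at a only the term with the factor a of [oint_kernel_step] remains. *)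
Lemma holomorphic_lip : exists K rho : R, [/\ 0 < K, 0 < rho &
  forall g (M : R) a, (forall z, in_square z -> cdiff g z) ->
    (forall z, in_square z -> normc (g z) <= M) -> normc a <= rho ->
    normc (g a - g 0) <= K * M * normc a].
Proof.
have k0 := kappa_gt0.
exists (128 / kappa), (Num.min 2^-1 (kappa / 64)); split.
- by rewrite divr_gt0.
- by rewrite lt_min invr_gt0 ltr0n divr_gt0.
move=> g M a dg gM; rewrite le_min => /andP[ha hk].
have h0 := normc0_half.
have sq0 := in_square_half h0; have sqa := in_square_half ha.
pose f z := g z + (- g 0).
have df z : in_square z -> cdiff f z.
  move=> hz; apply: cdiffD => //; first exact: dg.
  by apply: cdiff_ext (cdiff_affine 0 (- g 0) z) => w; rewrite mul0r addr0.
have cf : square_continuous f by move=> z hz; apply: cdiff_scont => //; exact: df.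
have df' z : in_square z -> z \notin [::] -> cdiff f z by move=> ? _; exact: df.
have Ea := cauchy_formula cf df' ha (df a sqa).
have E0 := cauchy_formula cf df' h0 (df 0 sq0).
have f0 : f 0 = 0 by rewrite /f subrr.
rewrite f0 mul0r in E0.
have fM z : on_boundary z -> normc (f z) <= 2 * M.
  move=> /boundary_square hz; apply: le_trans (normcD_le _ _) _.
  rewrite normc_opp; have := gM z hz; have := gM 0 sq0; lra.
have cfb z : on_boundary z -> scont f z by move/boundary_square; exact: cf.
have := oint_kernel_step cfb ha; set T := oint (fun z => f z * _ * _).
rewrite Ea E0 add0r => E.
have [c2 b2] := div_boundary cfb fM; have hT := oint_kernel_le c2 b2 ha.
have kl := cauchy_kernel_lower ha hk.
have : normc (f a) * (kappa / 2) <= normc a * (32 * (2 * M)).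
  apply: le_trans (_ : normc (f a) * normc (cauchy_kernel a) <= _).
    by rewrite ler_wpM2l ?normc_ge0.
  by rewrite -normcM E normcM ler_wpM2l ?normc_ge0.
rewrite -ler_pdivlMr ?divr_gt0 // => h; apply: le_trans h _.
have -> : normc a * (32 * (2 * M)) / (kappa / 2) = 128 / kappa * M * normc a.
  by field; rewrite gt_eqF.
by [].
Qed.

(** The minimum principle, by Cauchy's formula for 1 / g.  It will be used to
    prove the existence of zeros. *)
Lemma nonvanishing_lower g (m : R) : (forall z, in_square z -> cdiff g z) ->
  (forall z, in_square z -> g z != 0) -> 0 < m ->
  (forall z, on_boundary z -> m <= normc (g z)) ->
  m * (kappa / 16) <= normc (g 0).
Proof.
move=> dg g0 m0 gm.
have h0 := normc0_half.
have sq0 := in_square_half h0.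
have df z : in_square z -> cdiff (fun w => (g w)^-1) z.
  by move=> hz; apply: cdiffV => //; [exact: dg|exact: g0].
have cf : square_continuous (fun w => (g w)^-1).
  by move=> z hz; apply: cdiff_scont => //; exact: df.
have df' z : in_square z -> z \notin [::] -> cdiff (fun w => (g w)^-1) z.
  by move=> ? _; exact: df.
have E := cauchy_formula cf df' h0 (df 0 sq0).
have : normc (oint (fun z => (g z)^-1 * (z - 0)^-1)) <= 16 * m^-1.
  apply: oint_le => z hz.
    by apply: scontM; [exact/cf/boundary_square|exact: scont_kernel].
  rewrite normcM !normcV subr0 -[m^-1]mulr1 ler_pM ?invr_ge0 ?normc_ge0 //.
    rewrite lef_pV2 ?posrE ?gm //; exact: lt_le_trans (gm z hz).
  rewrite -[1]invr1 lef_pV2 ?posrE ?boundary_normc //.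
  by apply: lt_le_trans (boundary_normc hz).
have n0 : 0 < normc (g 0) by rewrite normc_gt0 g0.
rewrite E normcM normcV -/kappa mulrC ler_pdivrMr // => h.
have -> : m * (kappa / 16) = kappa * m / 16 by field.
rewrite ler_pdivrMr // -ler_pdivlMr //.
apply: le_trans h _.
have -> : 16 / m * normc (g 0) = normc (g 0) * 16 / m by field; rewrite gt_eqF.
by [].
Qed.

End CauchyFormula.

Section SecondOrder.
Variable R : realType.
Implicit Types (f g : R[i] -> R[i]) (k z w a : R[i]).

(** The quotient f z = g z / z is differentiable off 0 and continuous at 0.
    Expanding 1 / (z - a) twice in its Cauchy integral gives
    f a * cauchy_kernel a = C0 + a C1 + O(a^2), where C0 = 0 because f vanishes
    at 0, and the kernel is constant up to O(a).  So g a = c a^2 + o(a^2) with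
    c = C1 / cauchy_kernel 0. *)
Lemma second_order_expansion g (M : R) : (forall z, in_square z -> cdiff g z) ->
  (forall z, in_square z -> normc (g z) <= M) -> g 0 = 0 ->
  (forall e : R, 0 < e -> exists2 d : R, 0 < d & forall z,
     normc z < d -> normc (g z) <= e * normc z) ->
  exists c, forall e : R, 0 < e -> exists2 d : R, 0 < d & forall z,
     normc z < d -> normc (g z - c * z ^+ 2) <= e * normc z ^+ 2.
Proof.
move=> dg gM g0 g'0.
pose f z := g z * (z - 0)^-1.
have k0 := (kappa_gt0 R).
have h0 := (normc0_half R).
have sq0 := in_square_half h0.
have f0 : f 0 = 0 by rewrite /f g0 mul0r.
have df z : in_square z -> z != 0 -> cdiff f z.
  move=> hz z0; apply: cdiffM => //; first exact: dg.
  apply: (@cdiffV _ (fun w => w - 0)) => //; last by rewrite subr0.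
  by apply: cdiff_ext (cdiff_affine 1 0 z) => w; rewrite mul1r add0r subr0.
have fsmall (e : R) : 0 < e -> exists2 d : R, 0 < d & forall z,
    normc z < d -> normc (f z) <= e.
  move=> e0; have [d d0 Hd] := g'0 e e0; exists d => // z zd.
  have [->|z0] := eqVneq z 0; first by rewrite f0 normc0 ltW.
  by rewrite /f subr0 normcM normcV ler_pdivrMr ?normc_gt0 ?Hd.
have cf : square_continuous f.
  move=> z hz; have [->|z0] := eqVneq z 0; last first.
    by apply: cdiff_scont => //; exact: df.
  move=> e e0; have e2 : 0 < e / 2 by rewrite divr_gt0.
  have [d d0 Hd] := fsmall _ e2; exists d => // w _.
  rewrite f0 !subr0 => /Hd; lra.
have df' z : in_square z -> z \notin [:: 0] -> cdiff f z.
  by move=> hz; rewrite inE => ?; exact: df.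
have cfb z : on_boundary z -> scont f z by move/boundary_square; exact: cf.
have M0 : 0 <= M by apply: le_trans (gM 0 sq0); rewrite ?normc_ge0.
have [_ fM] := div_boundary (fun z hz => cdiff_scont (boundary_square hz) (dg z (boundary_square hz)))
  (fun z hz => gM z (boundary_square hz)).
have {}fM z : on_boundary z -> normc (f z) <= M by exact: fM.
have [cf1 f1M] := div_boundary cfb fM; have [cf2 f2M] := div_boundary cf1 f1M.
set f1 := fun z => f z * (z - 0)^-1 in cf1 f1M cf2 f2M.
set f2 := fun z => f1 z * (z - 0)^-1 in cf2 f2M.
pose N0 : R[i] := cauchy_kernel 0.
(* The Cauchy integral of f at a, expanded in powers of a. *)
have E a : normc a <= 2^-1 -> a != 0 -> f a * cauchy_kernel a =
    oint f1 + a * oint (fun z => f1 z * (z - a)^-1).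
  move=> ha a0; have := cauchy_formula cf df' ha (df a (in_square_half ha) a0).
  by move=> <-; exact: oint_kernel_step.
have E1 a : normc a <= 2^-1 -> oint (fun z => f1 z * (z - a)^-1) =
    oint f2 + a * oint (fun z => f2 z * (z - a)^-1).
  by move=> ha; exact: oint_kernel_step.
have kle a : normc a <= 2^-1 -> normc (cauchy_kernel a) <= (kappa R) + 32.
  move=> ha; have := cauchy_kernel_lip ha; have := normcD_le (cauchy_kernel a - N0) N0.
  rewrite subrK -/N0 /(kappa R) -/N0; lra.
(* If C = |oint f1| were positive, a small real a = r would make both terms of
   oint f1 = f a * cauchy_kernel a - a * (...) at most C / 4. *)
have C0 : oint f1 = 0.
  apply/eqP; apply: contraT; rewrite -normc_gt0; set C := normc _ => C0.
  have k32 : 0 < (kappa R) + 32 by lra.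
  have e0 : 0 < C / 4 / ((kappa R) + 32) by rewrite !divr_gt0.
  have [d d0 Hd] := fsmall _ e0.
  have M32 : 0 < 32 * M + 1 by lra.
  have c4 : 0 < C / 4 / (32 * M + 1) by rewrite !divr_gt0.
  pose r := Num.min (d / 2) (Num.min 2^-1 (C / 4 / (32 * M + 1))).
  have r0 : 0 < r by rewrite !lt_min c4 andbT invr_gt0 ltr0n andbT; lra.
  have [r1 [r2 r3]] : r <= d / 2 /\ r <= 2^-1 /\ r <= C / 4 / (32 * M + 1).
    by rewrite /r !ge_min !lexx ?orbT.
  pose a : R[i] := r%:C.
  have na : normc a = r by rewrite normc_real gtr0_norm.
  have a0 : a != 0 by rewrite -normc_gt0 na.
  have ha : normc a <= 2^-1 by rewrite na.
  have had : normc a < d by rewrite na; lra.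
  have h1 := Hd _ had.
  have h2 := kle _ ha; have h3 := oint_kernel_le cf1 f1M ha.
  have CE : oint f1 = f a * cauchy_kernel a + - (a * oint (fun z => f1 z * (z - a)^-1)).
    by rewrite E //; ring.
  have : C <= C / 4 + C / 4.
    rewrite {1}/C CE; apply: le_trans (normcD_le _ _) _; rewrite normc_opp
      [normc (f a * _)]normcM [normc (a * _)]normcM na.
    apply: lerD.
      have -> : C / 4 = C / 4 / ((kappa R) + 32) * ((kappa R) + 32) by field; rewrite gt_eqF.
      by apply: ler_pM h1 h2; exact: normc_ge0.
    have -> : C / 4 = C / 4 / (32 * M + 1) * (32 * M + 1) by field; rewrite gt_eqF.
    apply: ler_pM; [exact: ltW|exact: normc_ge0|exact: r3|clear - h3; lra].
  lra.
exists (oint f2 / N0) => e e0.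
have N00 : N0 != 0 by exact: (cauchy_kernel0_neq0 R).
pose B := 32 * M * (kappa R) + 16 * M * 32.
have B0 : 0 <= B by rewrite /B addr_ge0 // !mulr_ge0 // ltW.
have kk : 0 < (kappa R) / 2 * (kappa R) by rewrite mulr_gt0 // divr_gt0.
have eB : 0 < e * ((kappa R) / 2 * (kappa R)) / (B + 1) by rewrite divr_gt0 ?mulr_gt0 // ltr_wpDl.
exists (Num.min (Num.min 2^-1 ((kappa R) / 64)) (e * ((kappa R) / 2 * (kappa R)) / (B + 1))).
  by rewrite !lt_min eB andbT invr_gt0 ltr0n /= divr_gt0.
move=> a; rewrite !lt_min => /andP[/andP[/ltW ha /ltW hk] had].
have [->|a0] := eqVneq a 0.
  by rewrite g0 expr0n mulr0 subrr normc0 mulr_ge0 // ltW.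
have kl := cauchy_kernel_lower ha hk.
have ka0 : cauchy_kernel a != 0 by rewrite -normc_gt0 (lt_le_trans _ kl) // divr_gt0.
have := E a ha a0; rewrite C0 add0r E1 //.
set T := oint (fun z => f2 z * _); move=> Ea.
have hT : normc T <= 32 * M by exact: oint_kernel_le.
have hC : normc (oint f2) <= 16 * M by apply: oint_le.
have fE : f a = a * (oint f2 + a * T) / cauchy_kernel a by rewrite -Ea mulfK.
have gE : g a = f a * a by rewrite /f subr0 divfK.
have -> : g a - oint f2 / N0 * a ^+ 2 =
    a ^+ 2 * (a * T * N0 + oint f2 * (N0 - cauchy_kernel a)) / (cauchy_kernel a * N0).
  by rewrite gE fE; field; rewrite N00 ka0.
have num : normc (a * T * N0 + oint f2 * (N0 - cauchy_kernel a)) <= normc a * B.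
  apply: le_trans (normcD_le _ _) _; rewrite !normcM -/(kappa R) /B mulrDr.
  apply: lerD; first by rewrite -mulrA ler_wpM2l ?normc_ge0 // ler_wpM2r // ltW.
  have -> : normc a * (16 * M * 32) = 16 * M * (32 * normc a) by ring.
  by rewrite ler_pM ?normc_ge0 // normc_subC cauchy_kernel_lip.
have den : (kappa R) / 2 * (kappa R) <= normc (cauchy_kernel a * N0).
  rewrite normcM; apply: ler_pM kl (lexx _); apply: ltW; [exact: divr_gt0|exact: k0].
rewrite normcM normcV normcM ler_pdivrMr; last exact: lt_le_trans den.
have -> : normc (a ^+ 2) = normc a ^+ 2 by rewrite !expr2 normcM.
rewrite [e * normc a ^+ 2]mulrC -[leRHS]mulrA; apply: ler_wpM2l; first exact: sqr_ge0.
apply: le_trans num _; apply: le_trans (_ : e * ((kappa R) / 2 * (kappa R)) <= _); last first.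
  by apply: ler_wpM2l => //; exact: ltW.
move: had; rewrite ltr_pdivlMr ?ltr_wpDl // => /ltW h; apply: le_trans h.
by rewrite ler_wpM2l ?normc_ge0 // lerDl.
Qed.

End SecondOrder.

(** * Derivatives at the origin of maps between row spaces *)

Section RealNorm.
Variable R : realType.
Local Notation C := (Cplx R).

(** The norm of a complex normed module is a real complex number; [rnorm] is
    that number in R. *)
Definition rnorm (V : normedModType C) (v : V) : R := Re (`|v| : R[i]).

Section any_module.
Variable V : normedModType C.
Implicit Types u v : V.

Lemma rnormE v : `|v| = ((rnorm v)%:C : R[i]) :> C.
Proof. by rewrite /rnorm (@RRe_real R (`|v| : R[i])) //; exact: (@normr_real C V v). Qed.

Lemma rnorm_ge0 v : 0 <= rnorm v.
Proof. by rewrite -lecR -rnormE; exact: (@normr_ge0 C V). Qed.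

Lemma rnormD u v : rnorm (u + v) <= rnorm u + rnorm v.
Proof. by rewrite -lecR rmorphD /= -!rnormE; exact: (@ler_normD C V). Qed.

Lemma rnormN v : rnorm (- v) = rnorm v.
Proof. by rewrite /rnorm (@normrN C V). Qed.

Lemma rnormZ (k : C) v : rnorm (k *: v) = normc (k : R[i]) * rnorm v.
Proof.
apply: complexI; rewrite rmorphM /= -!rnormE (@normrZ C V).
by rewrite (normr_normc (k : R[i])).
Qed.

Lemma rnorm0 : rnorm (0 : V) = 0.
Proof. by rewrite /rnorm (@normr0 C V). Qed.

Lemma rnorm0_eq0 v : rnorm v = 0 -> v = 0.
Proof. by move=> h; apply/eqP; rewrite -(@normr_eq0 C V) rnormE h. Qed.

Lemma near0P (P : V -> Prop) :
  (\forall v \near (0 : V), P v) <->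
  (exists2 d : R, 0 < d & forall v, rnorm v < d -> P v).
Proof.
split=> [/nbhs_norm0P [e /= e0 He]|[d d0 Hd]].
  have er : e = (Re (e : R[i]))%:C :> R[i].
    by rewrite (@RRe_real R (e : R[i])) //; apply: ger0_real; exact: ltW.
  exists (Re (e : R[i])); first by rewrite -ltcR -er.
  by move=> v hv; apply: He; rewrite /= rnormE er; rewrite (@ltcR R).
apply/nbhs_norm0P; exists (d%:C : R[i]); first by rewrite /= (@ltcR R 0 d).
by move=> v /=; rewrite rnormE (@ltcR R) => /Hd.
Qed.

End any_module.

Lemma rnorm_scalar (z : R[i]) : rnorm (z : C^o) = normc z.
Proof. exact: (congr1 (@complex.Re R) (normr_normc z)). Qed.

Lemma differentiable_expansion (V W : normedModType C) (f : V -> W) (x : V) :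
  differentiable f x -> forall e : R, 0 < e -> exists2 d : R, 0 < d &
  forall h, rnorm h < d -> rnorm (f (h + x) - f x - 'd f x h) <= e * rnorm h.
Proof.
move=> /diff_locally /eqaddoP H e e0.
have ec : (0 : C) < (e%:C : R[i]) by rewrite (@ltcR R 0 e).
have /near0P [d d0 Hd] := H _ ec; exists d => // h /Hd.
by rewrite !rnormE -rmorphM (@lecR R) !fctE /= opprD addrA.
Qed.

Lemma expansion_diff (V W : normedModType C) (f : V -> W) (L : {linear V -> W}) x :
  continuous L -> (forall e : R, 0 < e -> exists2 d : R, 0 < d &
  forall h, rnorm h < d -> rnorm (f (h + x) - f x - L h) <= e * rnorm h) ->
  'd f x = L :> (V -> W).
Proof.
move=> cL H; apply: diff_unique => //; apply/eqaddoP => e e0.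
have er : e = (Re (e : R[i]))%:C :> R[i].
  by rewrite (@RRe_real R (e : R[i])) //; apply: ger0_real; exact: ltW.
have e0' : 0 < Re (e : R[i]) by rewrite -ltcR -er.
have [d d0 Hd] := H _ e0'; apply/near0P; exists d => // h /Hd.
by rewrite er !rnormE -rmorphM (@lecR R) !fctE /= opprD addrA.
Qed.

Lemma differentiable_cdiff (g : C -> C) (z : C) : differentiable g z ->
  cdiff (g : R[i] -> R[i]) z.
Proof.
move=> dg; exists ('d g z 1 : R[i]) => e e0.
have [d d0 Hd] := differentiable_expansion dg e0; exists d => // w _ wz.
have := Hd (w - z); rewrite -[X in X < _]/(rnorm ((w - z) : C^o)) rnorm_scalar => /(_ wz).
rewrite subrK.
have -> : 'd g z (w - z) = (w - z) *: ('d g z 1) :> C.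
  apply: etrans (linearZZ ('d g z) (w - z) (1 : C)).
  by congr ('d g z _); exact/esym/mulr1.
by rewrite -[X in X <= _ -> _]rnorm_scalar [_ *: _]mulrC.
Qed.

Section Matrices.
Implicit Types m n : nat.

Lemma rnorm_coord m n (v : 'M[C]_(m, n)) i j : normc (v i j : R[i]) <= rnorm v.
Proof.
have E : (`|v i j| <= mx_norm v :> C).
  rewrite mx_normE.
  rewrite -[leLHS]nngE num_le.
  exact: (le_bigmax _ (fun ij : 'I_m * 'I_n => `|v ij.1 ij.2|%:nng) (i, j)).
have {}E : (`|v i j| <= `|v| :> C) by exact: E.
by rewrite -lecR -normr_normc; rewrite (rnormE v) in E; exact: E.
Qed.

Lemma rnorm_le m n (v : 'M[C]_(m, n)) (e : R) : 0 <= e ->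
  (forall i j, normc (v i j : R[i]) <= e) -> rnorm v <= e.
Proof.
move=> e0 H; have [->|v0] := eqVneq v 0; first by rewrite rnorm0.
have : mx_norm v != 0 by apply: contraNneq v0 => /mx_norm_eq0 ->.
move=> /mx_norm_neq0 [[i j] /= E].
by rewrite -lecR -rnormE [leLHS]E (normr_normc (v i j : R[i])) lecR H.
Qed.

Lemma normc_sum (I : Type) (r : seq I) (P : pred I) (F : I -> R[i]) :
  normc (\sum_(i <- r | P i) F i) <= \sum_(i <- r | P i) normc (F i).
Proof.
elim/big_rec2: _ => [|i y x _ h]; first by rewrite normc0.
by apply: le_trans (normcD_le _ _) _; rewrite lerD2l.
Qed.

Lemma rnorm_mulmx m n k (T : 'M[C]_(n, k)) : exists2 K : R, 0 < K &
  forall v : 'M[C]_(m, n), rnorm (v *m T) <= K * rnorm v.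
Proof.
exists (1 + \sum_j \sum_i normc (T j i : R[i])).
  by rewrite ltr_pwDl // sumr_ge0 // => j _; rewrite sumr_ge0 // => i _; exact: normc_ge0.
move=> v; apply: rnorm_le => [|i j].
  rewrite mulr_ge0 ?rnorm_ge0 // addr_ge0 // sumr_ge0 // => j _.
  by rewrite sumr_ge0 // => i _; exact: normc_ge0.
rewrite mxE; apply: le_trans (normc_sum _ _ _) _.
rewrite mulrDl mul1r ler_wpDl ?rnorm_ge0 // mulr_suml; apply: ler_sum => l _.
rewrite normcM mulrC ler_pM ?normc_ge0 ?rnorm_coord //.
by rewrite (bigD1 j) //= lerDl sumr_ge0 // => *; exact: normc_ge0.
Qed.

Lemma rnorm_row_mx n1 n2 (u : 'rV[C]_n1) (v : 'rV[C]_n2) :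
  rnorm (row_mx u v) <= rnorm u + rnorm v.
Proof.
apply: rnorm_le; first by rewrite addr_ge0 ?rnorm_ge0.
move=> i j; rewrite mxE; case: splitP => l _.
  by apply: le_trans (rnorm_coord _ _ _) _; rewrite lerDl rnorm_ge0.
by apply: le_trans (rnorm_coord _ _ _) _; rewrite lerDr rnorm_ge0.
Qed.

Lemma rnorm_lsubmx n1 n2 (u : 'rV[C]_(n1 + n2)) : rnorm (lsubmx u) <= rnorm u.
Proof.
apply: rnorm_le; first exact: rnorm_ge0.
by move=> i j; rewrite mxE; exact: rnorm_coord.
Qed.

Lemma normc_conj (z : R[i]) : normc (Num.conj (z : C) : R[i]) = normc z.
Proof.
apply: complexI; rewrite -!normr_normc; exact: (@norm_conjC C).
Qed.

Lemma rnorm_conj n (v : 'rV[C]_n) : rnorm (conj_rV v) = rnorm v.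
Proof.
apply/eqP; rewrite eq_le; apply/andP; split; apply: rnorm_le; try exact: rnorm_ge0.
  by move=> i j; rewrite mxE normc_conj; exact: rnorm_coord.
by move=> i j; rewrite -normc_conj; have := rnorm_coord (conj_rV v) i j; rewrite mxE.
Qed.

Lemma rnorm_rho0 n (v : 'rV[C]_(n + n)) : rnorm (rho0 v) = rnorm v.
Proof.
have le (u : 'rV[C]_(n + n)) : rnorm (rho0 u) <= rnorm u.
  apply: rnorm_le; first exact: rnorm_ge0.
  move=> i j; rewrite mxE; case: splitP => l _; rewrite !mxE normc_conj;
  exact: rnorm_coord.
apply/eqP; rewrite eq_le le /=.
have E : v = rho0 (rho0 v).
  rewrite /rho0 row_mxKl row_mxKr -[v in LHS]hsubmxK.
  by congr row_mx; apply/rowP => j; rewrite !mxE conjCK.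
by rewrite {1}E; exact: le.
Qed.

End Matrices.

Section LinearPart.

(** T is the derivative of F at 0, where F 0 = 0.  The form by estimates also
    makes sense for maps built from [rho0], which is antiholomorphic. *)
Definition linear_part n m (F : 'rV[C]_n -> 'rV[C]_m) (T : 'M[C]_(n, m)) :=
  forall e : R, 0 < e -> exists2 d : R, 0 < d & forall v, rnorm v < d ->
  rnorm (F v - v *m T) <= e * rnorm v.

Lemma linear_part0 n m (F : 'rV[C]_n -> 'rV[C]_m) T : linear_part F T -> F 0 = 0.
Proof.
move=> /(_ 1 ltr01) [d d0 /(_ 0)]; rewrite rnorm0 mul0mx subr0 mulr0 => /(_ d0) h.
by apply: rnorm0_eq0; apply/eqP; rewrite eq_le h rnorm_ge0.
Qed.

Lemma linear_part_le n m (F : 'rV[C]_n -> 'rV[C]_m) T : linear_part F T ->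
  exists K d : R, [/\ 0 < K, 0 < d & forall v, rnorm v < d -> rnorm (F v) <= K * rnorm v].
Proof.
move=> /(_ 1 ltr01) [d d0 H]; have [K K0 HK] := rnorm_mulmx 1 T.
exists (1 + K), d; split=> // [|v /H h]; first by rewrite addr_gt0.
have := rnormD (F v - v *m T) (v *m T); rewrite subrK; have := HK v; lra.
Qed.

Lemma linear_part_comp n m k (F : 'rV[C]_n -> 'rV[C]_m) (G : 'rV[C]_m -> 'rV[C]_k) T S :
  linear_part F T -> linear_part G S -> linear_part (G \o F) (T *m S).
Proof.
move=> lF lG e e0; have [K [d1 [K0 d10 HF]]] := linear_part_le lF.
have [L L0 HL] := rnorm_mulmx 1 S.
have eK : 0 < e / 2 / K by rewrite !divr_gt0.
have eL : 0 < e / 2 / L by rewrite !divr_gt0.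
have [d2 d20 H2] := lG _ eK; have [d3 d30 H3] := lF _ eL.
have dK : 0 < d2 / K by rewrite divr_gt0.
exists (Num.min d1 (Num.min d3 (d2 / K))); first by rewrite !lt_min d10 d30 dK.
move=> v; rewrite !lt_min => /and3P[v1 v2 v3].
have h1 := HF v v1; have h2 := H3 v v2.
have h3 : rnorm (F v) < d2.
  by apply: le_lt_trans h1 _; rewrite mulrC -ltr_pdivlMr.
have h4 := H2 _ h3; have h5 := HL (F v - v *m T).
have -> : (G \o F) v - v *m (T *m S) = (G (F v) - F v *m S) + (F v - v *m T) *m S.
  by rewrite mulmxBl mulmxA addrA subrK.
apply: le_trans (rnormD _ _) _.
have -> : e * rnorm v = e / 2 / K * (K * rnorm v) + L * (e / 2 / L * rnorm v).
  by field; rewrite !gt_eqF.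
apply: lerD.
  by apply: le_trans h4 _; apply: ler_wpM2l => //; exact: ltW.
by apply: le_trans h5 _; apply: ler_wpM2l => //; exact: ltW.
Qed.

Lemma linear_part_unique n m (F : 'rV[C]_n -> 'rV[C]_m) T S :
  linear_part F T -> linear_part F S -> T = S.
Proof.
move=> lT lS; apply/row_matrixP => i; rewrite !rowE; set u := delta_mx 0 i.
apply/eqP; rewrite -subr_eq0; apply/eqP/rnorm0_eq0/eqP.
rewrite eq_le rnorm_ge0 andbT; apply/ler_addgt0Pl => e e0; rewrite addr0.
pose e' := e / 2 / (rnorm u + 1).
have u1 : 0 < rnorm u + 1 by rewrite ltr_wpDl // rnorm_ge0.
have e'0 : 0 < e' by rewrite !divr_gt0.
have [d1 d10 H1] := lT _ e'0; have [d2 d20 H2] := lS _ e'0.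
pose d := Num.min d1 d2; have d0 : 0 < d by rewrite lt_min d10.
pose t : R := d / 2 / (rnorm u + 1).
have t0 : 0 < t by rewrite !divr_gt0.
pose v : 'rV[C]_n := (t%:C : R[i]) *: u.
have vn : rnorm v = t * rnorm u by rewrite rnormZ normc_real gtr0_norm.
have vd : rnorm v < d.
  rewrite vn /t.
  have -> : d / 2 / (rnorm u + 1) * rnorm u = d * rnorm u / (2 * (rnorm u + 1)).
    by field; rewrite gt_eqF.
  rewrite ltr_pdivrMr ?mulr_gt0 // ltr_pM2l //.
  by have := rnorm_ge0 u; lra.
move: vd; rewrite lt_min => /andP[/H1 h1 /H2 h2].
have E : v *m T - v *m S = (t%:C : R[i]) *: (u *m T - u *m S).
  by rewrite -!scalemxAl -scalerBr.
have : rnorm (v *m T - v *m S) <= e' * rnorm v + e' * rnorm v.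
  have -> : v *m T - v *m S = - (F v - v *m T) + (F v - v *m S).
    by rewrite opprB addrA subrK.
  by apply: le_trans (rnormD _ _) _; rewrite rnormN lerD.
rewrite E rnormZ normc_real gtr0_norm // vn.
have -> : e' * (t * rnorm u) + e' * (t * rnorm u) = t * (e' * 2 * rnorm u) by ring.
rewrite ler_pM2l // => h; apply: le_trans h _.
rewrite /e'; have -> : e / 2 / (rnorm u + 1) * 2 * rnorm u = e * rnorm u / (rnorm u + 1).
  by field; rewrite gt_eqF.
by rewrite ler_pdivrMr // ler_pM2l // lerDl.
Qed.

Lemma linear_part_germ n m (F G : 'rV[C]_n -> 'rV[C]_m) T :
  germ_eq F G -> linear_part F T -> linear_part G T.
Proof.
move=> /near0P [d d0 H] lF e e0; have [d1 d10 H1] := lF _ e0.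
exists (Num.min d d1); first by rewrite lt_min d0.
by move=> v; rewrite lt_min => /andP[/H <- /H1].
Qed.

Lemma linear_part_id n : linear_part (@id 'rV[C]_n) 1%:M.
Proof.
move=> e e0; exists 1 => // v _.
by rewrite mulmx1 subrr rnorm0 mulr_ge0 ?rnorm_ge0 // ltW.
Qed.

Lemma differentiable_linear_part n m (F : 'rV[C]_n -> 'rV[C]_m) :
  differentiable F 0 -> F 0 = 0 -> linear_part F (jacobian F 0).
Proof.
move=> dF F0 e e0; have [d d0 H] := differentiable_expansion dF e0.
by exists d => // v /H; rewrite addr0 F0 subr0 /jacobian mul_rV_lin1.
Qed.

Lemma linear_part_jacobian n m (F : 'rV[C]_n -> 'rV[C]_m) T :
  linear_part F T -> jacobian F 0 = T.
Proof.
move=> lF; have F0 := linear_part0 lF.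
have cT : continuous (mulmxr T : 'rV[C]_n -> 'rV[C]_m).
  have [K K0 HK] := rnorm_mulmx 1 T.
  apply/bounded_linear_continuous/linear_boundedP.
  have Kr : ((K%:C : R[i]) : C) \is Num.real.
    by apply: ger0_real; rewrite (@lecR R 0 K) ltW.
  near=> r => v /=; apply: le_trans (_ : (K%:C : R[i]) * `|v| <= _).
    by rewrite !rnormE -rmorphM lecR; exact: HK.
  by apply: ler_wpM2r => //; near: r; exact: nbhs_pinfty_ge.
have D : 'd F 0 = (mulmxr T : {linear 'rV[C]_n -> 'rV[C]_m}) :> ('rV[C]_n -> 'rV[C]_m).
  apply: expansion_diff => // e e0; have [d d0 H] := lF _ e0; exists d => // h /H.
  by rewrite addr0 F0 subr0.
by apply/row_matrixP => i; rewrite !rowE /jacobian mul_rV_lin1 D.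
Unshelve. all: by end_near. Qed.

Lemma rho0E n (v : 'rV[C]_(n + n)) : rho0 v = conj_rV v *m swap_mx C n.
Proof.
rewrite -[v in RHS]hsubmxK /conj_rV map_row_mx mul_row_block.
by rewrite !mulmx0 !mulmx1 add0r addr0.
Qed.

Lemma linear_part_rho0 n (F : 'rV[C]_(n + n) -> 'rV[C]_(n + n)) T :
  linear_part F T ->
  linear_part (@rho0 R n \o F \o @rho0 R n) (swap_mx C n *m map_mx Num.conj T *m swap_mx C n).
Proof.
move=> lF e e0; have [d d0 H] := lF _ e0; exists d => // v.
rewrite -rnorm_rho0 => /H h /=; rewrite rnorm_rho0 in h.
suff -> : rho0 (F (rho0 v)) - v *m (swap_mx C n *m map_mx Num.conj T *m swap_mx C n)
    = rho0 (F (rho0 v) - rho0 v *m T) by rewrite !rnorm_rho0.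
have rB (x y : 'rV[C]_(n + n)) : rho0 (x - y) = rho0 x - rho0 y.
  by rewrite !rho0E /conj_rV map_mxB mulmxBl.
rewrite rB; congr (_ - _); rewrite !rho0E /conj_rV !map_mxM !mulmxA.
have -> : map_mx Num.conj (swap_mx C n) = swap_mx C n.
  by rewrite /swap_mx map_block_mx !map_mx1 !map_mx0.
have -> : map_mx Num.conj (map_mx Num.conj v) = v.
  by apply/rowP => j; rewrite !mxE conjCK.
by [].
Qed.

End LinearPart.

End RealNorm.

(** * Tangents of fixed hypersurfaces *)

Section HolomorphicMaps.
Variable R : realType.
Local Notation C := (Cplx R).

Lemma square_normc (z : R[i]) : in_square z -> normc z <= 2.
Proof.
move=> /andP[h1 h2]; apply: le_trans (normc_ReIm _) _.
have : `|Re z| <= 1 by rewrite ler_norml.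
have : `|Im z| <= 1 by rewrite ler_norml.
lra.
Qed.

(** Discs and curves with prescribed derivatives of order one and two. *)
Definition curve n (X Y Z : 'rV[C]_n) (z : R[i]) : 'rV[C]_n :=
  X + (z : C) *: Y + ((z : C) ^+ 2) *: Z.

Lemma rnorm_curve n (X Y Z : 'rV[C]_n) z : in_square z ->
  rnorm (curve X Y Z z) <= rnorm X + 2 * rnorm Y + 4 * rnorm Z.
Proof.
move=> /square_normc hz; apply: le_trans (rnormD _ _) _.
apply: lerD; last first.
  rewrite rnormZ ler_wpM2r ?rnorm_ge0 // expr2 normcM.
  have -> : 4 = 2 * 2 :> R by ring.
  by rewrite ler_pM ?normc_ge0.
apply: le_trans (rnormD _ _) _; rewrite lerD2l rnormZ.
by rewrite ler_wpM2r ?rnorm_ge0.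
Qed.

Lemma holomorphic_ball n m (F : 'rV[C]_n -> 'rV[C]_m) : holomorphic_at0 F ->
  exists2 d : R, 0 < d & forall v, rnorm v < d -> differentiable F v.
Proof. by move/near0P. Qed.

Lemma curve_cdiff n m (F : 'rV[C]_n -> 'rV[C]_m) (d : R) (X Y Z : 'rV[C]_n) j z :
  (forall v, rnorm v < d -> differentiable F v) ->
  rnorm X + 2 * rnorm Y + 4 * rnorm Z < d -> in_square z ->
  cdiff (fun w : R[i] => F (curve X Y Z w) 0 j : R[i]) z.
Proof.
move=> dF hd hz.
have dF' : differentiable F (curve X Y Z z).
  by apply: dF; apply: le_lt_trans hd; exact: rnorm_curve.
apply: (@differentiable_cdiff _ (fun w : C => F (curve X Y Z w) 0 j) z).
have dc : differentiable (curve X Y Z : C -> 'rV[C]_n) (z : C).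
  rewrite /curve; apply: differentiableD; [apply: differentiableD|].
  - exact: differentiable_cst.
  - exact: differentiableZl.
  - apply: differentiableZl; apply/derivable1_diffP; exact: exprn_derivable.
apply: (@differentiable_comp _ _ _ _ (F \o (curve X Y Z : C -> 'rV[C]_n)) (fun N : 'rV[C]_m => N 0 j)).
  exact: differentiable_comp.
exact: differentiable_coord.
Qed.

Lemma linear_part_curve n m (F : 'rV[C]_n -> 'rV[C]_m) T (X Y Z : 'rV[C]_n) j z :
  cdiff (fun w : R[i] => F (curve X Y Z w) 0 j : R[i]) z -> in_square z ->
  cdiff (fun w : R[i] => (F (curve X Y Z w) - curve X Y Z w *m T) 0 j : R[i]) z.
Proof.
move=> dF hz.
pose x : R[i] := (X *m T) 0 j.
pose y : R[i] := (Y *m T) 0 j.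
pose t : R[i] := (Z *m T) 0 j.
apply: (@cdiff_ext _ (fun w => (F (curve X Y Z w) 0 j : R[i]) + ((- x + (- y) * w) + (0 + (- t) * w) * (0 + 1 * w)))).
  have aD (M N : 'rV[C]_m) : (M + N) 0 j = M 0 j + N 0 j by rewrite mxE.
  have aN (M : 'rV[C]_m) : (- M) 0 j = - M 0 j by rewrite mxE.
  have aZ k (M : 'rV[C]_m) : (k *: M) 0 j = k * M 0 j by rewrite mxE.
  move=> w; rewrite /curve !mulmxDl -!scalemxAl aD aN !aD !aZ -/x -/y -/t.
  move: (F _ 0 j : R[i]) => v; ring.
apply: cdiffD => //; apply: cdiffD => //; first exact: cdiff_affine.
by apply: cdiffM => //; exact: cdiff_affine.
Qed.

(** Let f define the hypersurface, with derivative a at 0, and let b a = 1 and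
    u a = 0.  For small s the function z |-> f (s (u + z rho b)) / s is close
    to rho z on the square, so by [nonvanishing_lower] it has a zero there.
    Thus t fixes a point s (u + O(rho)), with s and rho as small as desired,
    and u T = u follows. *)
Lemma fixes_hypersurface_tangent n (t : 'rV[C]_n -> 'rV[C]_n) T :
  fixes_hypersurface t -> linear_part t T ->
  exists2 a : 'cV[C]_n, a != 0 & forall u : 'rV[C]_n, u *m a = 0 -> u *m T = u.
Proof.
case=> f [/holomorphic_ball [d d0 df] f0 a0 /near0P [d1 d10 Hfix]] lt.
set a := jacobian f 0 in a0.
have lf : linear_part f a.
  by apply: differentiable_linear_part => //; apply: df; rewrite rnorm0.
exists a => // u ua.
have [b bE] : exists b : 'rV[C]_n, b *m a = 1%:M.
  have /row_freeP [b' b'E] : row_free a^T.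
    rewrite /row_free mxrank_tr; apply/eqP; apply: anti_leq.
    by rewrite rank_leq_col lt0n mxrank_eq0.
  by exists b'^T; rewrite -[a]trmxK -trmx_mul b'E trmx1.
apply/eqP; rewrite -subr_eq0; apply/eqP/rnorm0_eq0/eqP.
rewrite eq_le rnorm_ge0 andbT; apply/ler_addgt0Pl => e e0; rewrite addr0.
pose U := rnorm u; pose B := rnorm b; pose B' := rnorm (b *m T - b).
have [U0 B0 B'0] : [/\ 0 <= U, 0 <= B & 0 <= B'] by split; exact: rnorm_ge0.
pose rho : R := Num.min 1 (e / 2 / (2 * B' + 1)).
have rho0 : 0 < rho by rewrite lt_min ltr01 !divr_gt0 //; lra.
have rho1 : rho <= 1 by rewrite ge_min lexx.
have rho2 : rho * (2 * B' + 1) <= e / 2.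
  by rewrite -ler_pdivlMr; [rewrite ge_min lexx orbT|lra].
pose W := U + 2 * B + 1; have W0 : 0 < W by rewrite /W; lra.
pose q := Num.min (rho / 2) (rho * kappa R / 64).
have q0 : 0 < q by rewrite lt_min !divr_gt0 ?mulr_gt0 ?kappa_gt0.
have q1 : q <= rho / 2 by rewrite ge_min lexx.
have q2 : q <= rho * kappa R / 64 by rewrite ge_min lexx orbT.
have eps0 : 0 < q / W by rewrite divr_gt0.
have [d2 d20 Hf] := lf _ eps0.
have eps1 : 0 < e / 2 / W by rewrite !divr_gt0.
have [d3 d30 Ht] := lt _ eps1.
pose dd := Num.min (Num.min d d1) (Num.min d2 d3).
have dd0 : 0 < dd by rewrite !lt_min d0 d10 d20.
pose s : R := dd / 2 / W.
have s0 : 0 < s by rewrite !divr_gt0.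
have sW : s * W < dd by rewrite /s divfK ?gt_eqF //; lra.
pose sc : C := (s%:C : R[i]); pose rc : C := (rho%:C : R[i]).
have sc0 : sc != 0 by rewrite -normc_gt0 normc_real gtr0_norm.
pose c (z : R[i]) := curve u (rc *: b) 0 z.
have cW z : in_square z -> rnorm (c z) <= W.
  move=> /rnorm_curve h; apply: le_trans (h _ _ _ _) _.
  rewrite rnormZ rnorm0 mulr0 addr0 normc_real gtr0_norm // -/U -/B /W.
  have : 2 * (rho * B) <= 2 * B by rewrite ler_pM2l // ler_piMl.
  lra.
have cd z : in_square z -> rnorm (sc *: c z) < dd.
  move=> /cW h; rewrite rnormZ normc_real gtr0_norm //.
  by apply: le_lt_trans sW; rewrite ler_pM2l.
have cs z : sc *: c z = curve (sc *: u) (sc *: (rc *: b)) 0 z.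
  by rewrite /c /curve !scaler0 !addr0 scalerDr !scalerA [sc * _]mulrC -mulrA [sc * _]mulrC !mulrA.
pose g (z : R[i]) : R[i] := sc^-1 * (f (sc *: c z) 0 0).
have [z zsq gz] : exists2 z, in_square z & g z = 0.
  apply: contrapT => noz.
  have g0 z : in_square z -> g z != 0.
    by move=> hz; apply/eqP => gz; apply: noz; exists z.
  have dg z : in_square z -> cdiff g z.
    move=> hz; apply: cdiffM => //.
      by apply: cdiff_ext (cdiff_affine 0 (sc^-1 : R[i]) z) => w; rewrite mul0r addr0.
    have := @curve_cdiff n 1 f d (sc *: u) (sc *: (rc *: b)) 0 0 z df _ hz.
    rewrite !rnormZ rnorm0 !normc_real !gtr0_norm // -/U -/B => H.
    apply: cdiff_ext (H _) => [w|]; first by rewrite -cs.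
    have lt_dd : dd <= d by rewrite /dd !ge_min lexx.
    apply: lt_le_trans lt_dd; apply: le_lt_trans sW; rewrite mulr0 addr0 /W.
    have : s * (rho * B) <= s * B by rewrite ler_pM2l // ler_piMl.
    nra.
  have close z : in_square z -> normc (g z - z * rho%:C) <= q.
    move=> hz.
    have v2 : rnorm (sc *: c z) < d2.
      by apply: lt_le_trans (cd z hz) _; rewrite /dd !ge_min lexx orbT.
    have va : (sc *: c z) *m a = (sc * (z * rho%:C))%:M.
      rewrite -scalemxAl /c /curve scaler0 addr0 mulmxDl ua add0r -!scalemxAl bE.
      by rewrite !scalerA scalemx1 mulrA.
    have E : g z - z * rho%:C = sc^-1 * ((f (sc *: c z) - (sc *: c z) *m a) 0 0).
      rewrite va; set fv := f _; have -> : (fv - (sc * (z * rho%:C))%:M) 0 0 = fv 0 0 - sc * (z * rho%:C).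
        by rewrite !mxE eqxx mulr1n.
      by rewrite /g mulrBr -/fv [sc^-1 * (sc * _)]mulKf.
    rewrite E normcM normcV normc_real gtr0_norm // ler_pdivrMl //.
    apply: le_trans (rnorm_coord _ _ _) _; apply: le_trans (Hf _ v2) _.
    rewrite rnormZ normc_real gtr0_norm //.
    have -> : q / W * (s * rnorm (c z)) = s * q * (rnorm (c z) / W) by field; rewrite gt_eqF.
    apply: ler_piMr; first by rewrite mulr_ge0 // ltW.
    by rewrite ler_pdivrMr // mul1r cW.
  have sq0 : in_square (0 : R[i]) by apply: in_square_half; rewrite normc0 invr_ge0.
  have rho2' : 0 < rho / 2 by rewrite divr_gt0.
  have := nonvanishing_lower dg g0 rho2'.
  have bd z : on_boundary z -> rho / 2 <= normc (g z).
    move=> hz; have := close z (boundary_square hz); have := boundary_normc hz.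
    have := normcD_le (z * rho%:C - g z) (g z).
    rewrite subrK normc_subC normcM normc_real gtr0_norm // => h1 h2 h3.
    have : rho <= normc z * rho by rewrite ler_peMl // ltW.
    lra.
  move=> /(_ bd); have := close 0 sq0; rewrite mul0r subr0 => h1 h2.
  have : 0 < rho * kappa R by rewrite mulr_gt0 // kappa_gt0.
  have : rho / 2 * (kappa R / 16) = rho * kappa R / 32 by field.
  clear - h1 h2 q2; lra.
have fv : f (sc *: c z) = 0.
  apply/rowP => j; rewrite ord1 [RHS]mxE; apply: (mulfI (invr_neq0 sc0)).
  by rewrite mulr0; exact: gz.
have v1 : rnorm (sc *: c z) < d1.
  by apply: lt_le_trans (cd z zsq) _; rewrite /dd !ge_min lexx orbT.
have v3 : rnorm (sc *: c z) < d3.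
  by apply: lt_le_trans (cd z zsq) _; rewrite /dd !ge_min lexx !orbT.
have := Ht _ v3; rewrite (Hfix _ v1 fv) -scalemxAl -scalerBr !rnormZ !normc_real gtr0_norm //.
rewrite mulrCA ler_pM2l // => h.
have h1 : rnorm (c z - c z *m T) <= e / 2.
  apply: le_trans h _.
  have -> : e / 2 / W * rnorm (c z) = e / 2 * (rnorm (c z) / W) by field; rewrite gt_eqF.
  apply: ler_piMr; first by rewrite divr_ge0 // ltW.
  by rewrite ler_pdivrMr // mul1r cW.
have cE : c z = u + ((z : C) * rc) *: b.
  by rewrite /c /curve scaler0 addr0 scalerA.
have -> : u *m T - u = - (c z - c z *m T) - ((z : C) * rc) *: (b *m T - b).
  rewrite cE mulmxDl -!scalemxAl scalerBr !opprD !opprK !addrA.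
  set x := u *m T; set y := _ *: (b *m T); set w := _ *: b.
  by clearbody x y w; apply/rowP => k; rewrite !mxE; ring.
apply: le_trans (rnormD _ _) _; rewrite !rnormN rnormZ normcM normc_real gtr0_norm // -/B'.
have z2 := square_normc zsq.
have : normc z * rho * B' <= 2 * rho * B'.
  by rewrite ler_wpM2r // ler_wpM2r // ltW.
lra.
Qed.

End HolomorphicMaps.

(** * Second-order behaviour of holomorphic maps on curves *)

Section SecondOrder.
Variable R : realType.
Local Notation C := (Cplx R).
Variables (n m : nat) (F : 'rV[C]_n -> 'rV[C]_m) (T : 'M[C]_(n, m)).
Hypotheses (hF : holomorphic_at0 F) (lF : linear_part F T).
Implicit Types X Y Z : 'rV[C]_n.

Lemma curve_reparam X Z (k z : R[i]) :
  curve 0 ((k : C) *: X) ((k : C) ^+ 2 *: Z) z = curve 0 X Z (z * k).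
Proof. by rewrite /curve !add0r !scalerA -exprMn. Qed.

Lemma rnorm_curve0 X Z (z : R[i]) :
  rnorm (curve 0 X Z z) <= normc z * rnorm X + normc z ^+ 2 * rnorm Z.
Proof.
rewrite /curve add0r; apply: le_trans (rnormD _ _) _.
by rewrite !rnormZ !expr2 normcM.
Qed.

(** Since X T = 0, the restriction of F to the disc z |-> z X + z^2 Z vanishes
    to first order. *)
Lemma quadratic_expansion X Z j : X *m T = 0 ->
  exists c : R[i], forall e : R, 0 < e -> exists2 d : R, 0 < d & forall z : R[i],
    normc z < d ->
    normc ((F (curve 0 X Z z) 0 j : R[i]) - c * z ^+ 2) <= e * normc z ^+ 2.
Proof.
move=> XT; have [d0 d00 dF] := holomorphic_ball hF.
have [K [d1 [K0 d10 HK]]] := linear_part_le lF.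
pose A := rnorm X; pose B := rnorm Z.
have [A0 B0] : 0 <= A /\ 0 <= B by split; exact: rnorm_ge0.
pose D := Num.min d0 d1; have D0 : 0 < D by rewrite lt_min d00.
pose r := Num.min 1 (D / 2 / (2 * A + 4 * B + 1)).
have W0 : 0 < 2 * A + 4 * B + 1 by lra.
have r0 : 0 < r by rewrite lt_min ltr01 !divr_gt0.
have r1 : r <= 1 by rewrite ge_min lexx.
have r2 : r * (2 * A + 4 * B + 1) <= D / 2.
  by rewrite -ler_pdivlMr // ge_min lexx orbT.
pose rc : R[i] := r%:C.
have rcn : normc rc = r by rewrite normc_real gtr0_norm.
have rc0 : rc != 0 by rewrite -normc_gt0 rcn.
pose X' := (rc : C) *: X; pose Z' := (rc : C) ^+ 2 *: Z.
have nX' : rnorm X' = r * A by rewrite rnormZ rcn.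
have nZ' : rnorm Z' <= r * B.
  rewrite rnormZ expr2 normcM rcn -/B -mulrA ler_pM2l // ler_piMl //.
have small : rnorm (0 : 'rV[C]_n) + 2 * rnorm X' + 4 * rnorm Z' < D.
  rewrite rnorm0 nX'; nra.
pose g (z : R[i]) : R[i] := F (curve 0 X' Z' z) 0 j.
have dg z : in_square z -> cdiff g z.
  move=> hz; apply: curve_cdiff hz; first exact: dF.
  by apply: lt_le_trans small _; rewrite ge_min lexx.
have gM z : in_square z -> normc (g z) <= K * D.
  move=> hz; have vD := le_lt_trans (rnorm_curve _ _ _ hz) small.
  apply: le_trans (rnorm_coord _ _ _) _; apply: le_trans (HK _ _) _.
    by apply: lt_le_trans vD _; rewrite ge_min lexx orbT.
  by rewrite ler_pM2l // ltW.
have g0 : g 0 = 0.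
  have -> : g 0 = F 0 0 j by rewrite /g /curve expr0n !scale0r !addr0.
  by rewrite (linear_part0 lF) mxE.
have [L L0 HL] := rnorm_mulmx 1 T.
have g'0 (e : R) : 0 < e -> exists2 d : R, 0 < d & forall z,
    normc z < d -> normc (g z) <= e * normc z.
  move=> e0; pose V := A + B + 1; have V0 : 0 < V by rewrite /V; lra.
  have e1 : 0 < e / 2 / V by rewrite !divr_gt0.
  have [d2 d20 H2] := lF e1.
  have LB : 0 < L * B + 1 by rewrite ltr_wpDl // mulr_ge0 // ltW.
  exists (Num.min 1 (Num.min (d2 / V) (e / 2 / (L * B + 1)))).
    by rewrite !lt_min ltr01 !divr_gt0.
  move=> z; rewrite !lt_min => /and3P[z1 z2 z3].
  have nz := normc_ge0 z.
  have vz : rnorm (curve 0 X' Z' z) <= normc z * V.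
    apply: le_trans (rnorm_curve0 _ _ _) _; rewrite nX' /V.
    have : normc z ^+ 2 * rnorm Z' <= normc z * B.
      rewrite expr2 -mulrA ler_wpM2l //.
      apply: le_trans (_ : 1 * rnorm Z' <= _); first by rewrite ler_wpM2r ?rnorm_ge0 // ltW.
      by rewrite mul1r; apply: le_trans nZ' _; rewrite ler_piMl.
    have : normc z * (r * A) <= normc z * A by rewrite ler_wpM2l // ler_piMl.
    lra.
  have vd : rnorm (curve 0 X' Z' z) < d2.
    by apply: le_lt_trans vz _; rewrite -ltr_pdivlMr.
  have h := H2 _ vd.
  have vT : curve 0 X' Z' z *m T = (z : C) ^+ 2 *: (Z' *m T).
    by rewrite /curve add0r mulmxDl -!scalemxAl XT !scaler0 add0r.
  apply: le_trans (rnorm_coord (F (curve 0 X' Z' z)) 0 j) _.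
  have := rnormD (F (curve 0 X' Z' z) - curve 0 X' Z' z *m T) (curve 0 X' Z' z *m T).
  rewrite subrK => H; apply: le_trans H _.
  have -> : e * normc z = e / 2 / V * (normc z * V) + normc z * (e / 2).
    by field; rewrite gt_eqF.
  apply: lerD; first by apply: le_trans h _; rewrite ler_wpM2l // ltW.
  rewrite vT rnormZ expr2 normcM -mulrA ler_wpM2l //.
  apply: le_trans (_ : normc z * (L * B + 1) <= _); last first.
    by rewrite -ler_pdivlMr // ltW.
  rewrite ler_wpM2l //; apply: le_trans (HL _) _.
  apply: le_trans (_ : L * B <= _); last by rewrite lerDl.
  by rewrite ler_pM2l //; apply: le_trans nZ' _; rewrite ler_piMl.
have [c Hc] := second_order_expansion dg gM g0 g'0.
exists (c / rc ^+ 2) => e e0.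
have e1 : 0 < e * r ^+ 2 by rewrite mulr_gt0 // exprn_gt0.
have [d d_gt0 Hd] := Hc _ e1; exists (d * r); first by rewrite mulr_gt0.
move=> z zd; have := Hd (z / rc); rewrite normcM normcV rcn => H.
have : normc z / r < d by rewrite ltr_pdivrMr.
move=> /H; rewrite /g /X' /Z' curve_reparam divfK // => {H}H.
have -> : c / rc ^+ 2 * z ^+ 2 = c * (z / rc) ^+ 2 by field.
have <- : e * r ^+ 2 * (normc z / r) ^+ 2 = e * normc z ^+ 2 by field; rewrite gt_eqF.
exact: H.
Qed.

(** The difference of the two curves is s^2 (Z1 - Z2), and F - T varies little
    along the disc joining them by [holomorphic_lip]. *)
Lemma second_slot X Z1 Z2 j (e : R) : 0 < e -> exists2 d : R, 0 < d &
  forall s : R, 0 < s < d ->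
    normc (((F (curve 0 X Z1 s%:C) - F (curve 0 X Z2 s%:C)) 0 j : R[i])
       - s%:C ^+ 2 * (((Z1 - Z2) *m T) 0 j : R[i])) <= e * s ^+ 2.
Proof.
move=> e0; have [K [rho [K0 rho0 HL]]] := holomorphic_lip R.
have [d0 d00 dF] := holomorphic_ball hF.
pose W := rnorm X + rnorm Z2 + 2 * rnorm (Z1 - Z2) + 1.
have nX := rnorm_ge0 X; have nZ2 := rnorm_ge0 Z2; have nZ := rnorm_ge0 (Z1 - Z2).
have W0 : 0 < W by rewrite /W; lra.
have e1 : 0 < e / K / W by rewrite !divr_gt0.
have [d1 d10 H1] := lF e1.
exists (Num.min (Num.min 1 rho) (Num.min (d0 / W) (d1 / W))).
  by rewrite !lt_min ltr01 rho0 !divr_gt0.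
move=> s /andP[s0]; rewrite !lt_min => /andP[/andP[s1 srho] /andP[sd0 sd1]].
pose sc : R[i] := s%:C.
have scn : normc sc = s by rewrite normc_real gtr0_norm.
pose P := curve 0 X Z2 sc; pose Q := (sc : C) *: (Z1 - Z2).
have PQ : rnorm P + 2 * rnorm Q + 4 * rnorm (0 : 'rV[C]_n) <= s * W.
  have := rnorm_curve0 X Z2 sc; rewrite -/P rnorm0 mulr0 addr0 scn.
  rewrite /Q rnormZ scn /W => h.
  have : s ^+ 2 * rnorm Z2 <= s * rnorm Z2.
    by rewrite ler_wpM2r // expr2 ler_piMr // ltW.
  lra.
pose k (z : R[i]) : R[i] := (F (curve P Q 0 z) - curve P Q 0 z *m T) 0 j.
have PQd0 : rnorm P + 2 * rnorm Q + 4 * rnorm (0 : 'rV[C]_n) < d0.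
  by apply: le_lt_trans PQ _; rewrite -ltr_pdivlMr.
have dk z : in_square z -> cdiff k z.
  by move=> hz; apply: linear_part_curve => //; exact: curve_cdiff PQd0 hz.
have kM z : in_square z -> normc (k z) <= e / K * s.
  move=> hz; have h := le_trans (rnorm_curve _ _ _ hz) PQ.
  apply: le_trans (rnorm_coord _ _ _) _; apply: le_trans (H1 _ _) _.
    by apply: le_lt_trans h _; rewrite -ltr_pdivlMr.
  have -> : e / K * s = e / K / W * (s * W) by field; rewrite !gt_eqF.
  by apply: ler_wpM2l => //; exact: ltW.
have srho' : normc sc <= rho by rewrite scn ltW.
have := HL k (e / K * s) sc dk kM srho'; rewrite scn.
have -> : K * (e / K * s) * s = e * s ^+ 2 by field; rewrite gt_eqF.
have E1 : curve P Q 0 sc = curve 0 X Z1 sc.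
  rewrite /curve /P /Q /curve scaler0 addr0 scalerA -expr2 scalerBr.
  by rewrite [RHS]addrC -addrA subrKC addrC.
have E2 : curve P Q 0 0 = curve 0 X Z2 sc by rewrite /curve scale0r scaler0 !addr0.
rewrite /k E1 E2.
have E3 : (curve 0 X Z1 sc - curve 0 X Z2 sc) *m T = (sc : C) ^+ 2 *: ((Z1 - Z2) *m T).
  by rewrite scalemxAl; congr (_ *m _); rewrite /curve scalerBr opprD addrACA subrr add0r.
suff -> : (F (curve 0 X Z1 sc) - F (curve 0 X Z2 sc)) 0 j - sc ^+ 2 * ((Z1 - Z2) *m T) 0 j =
  (F (curve 0 X Z1 sc) - curve 0 X Z1 sc *m T) 0 j -
  (F (curve 0 X Z2 sc) - curve 0 X Z2 sc *m T) 0 j by [].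
have -> : sc ^+ 2 * ((Z1 - Z2) *m T) 0 j = ((sc : C) ^+ 2 *: ((Z1 - Z2) *m T)) 0 j.
  by rewrite [RHS]mxE.
rewrite -E3 mulmxBl.
set x := F _; set y := F _; set u := _ *m T; set v := _ *m T.
clearbody x y u v; rewrite !mxE; ring.
Qed.

(** On the disc z |-> z X + z^2 Z the map F is c z^2 + o(z^2), where c = P is
    found by letting z be real.  Hence F is about w^2 P s^2 at z = w s, that is,
    on the curve with coefficients w X and w^2 Z; passing from w^2 Z to Z' adds
    (Z' - w^2 Z) T s^2. *)
Lemma rotation_identity X Z Z' (w : R[i]) (P P' : 'rV[C]_m) :
  X *m T = 0 -> normc w = 1 ->
  (forall e : R, 0 < e -> exists2 d : R, 0 < d & forall s : R, 0 < s < d ->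
     rnorm (F (curve 0 X Z s%:C) - ((s%:C : R[i]) : C) ^+ 2 *: P) <= e * s ^+ 2) ->
  (forall e : R, 0 < e -> exists2 d : R, 0 < d & forall s : R, 0 < s < d ->
     rnorm (F (curve 0 ((w : C) *: X) Z' s%:C) - ((s%:C : R[i]) : C) ^+ 2 *: P') <= e * s ^+ 2) ->
  P' - (w : C) ^+ 2 *: P = (Z' - (w : C) ^+ 2 *: Z) *m T.
Proof.
move=> XT w1 HP HP'; apply/rowP => j.
have [c Hc] := quadratic_expansion Z j XT.
have half (s : R) : 0 < s -> normc (s%:C : R[i]) = s by move=> ?; rewrite normc_real gtr0_norm.
(* x s^2 = o(s^2) forces x = 0. *)
have uniq (x : R[i]) : (forall e : R, 0 < e -> exists2 d : R, 0 < d &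
    forall s : R, 0 < s < d -> normc (x * s%:C ^+ 2) <= e * s ^+ 2) -> x = 0.
  move=> H; apply/eqP; apply: contraT; rewrite -normc_gt0 => x0.
  have [|d d0 Hd] := H (normc x / 2); first by rewrite divr_gt0.
  have := Hd (d / 2); have d2 : 0 < d / 2 < d by lra.
  move=> /(_ d2); rewrite normcM expr2 normcM half; last by case/andP: d2.
  rewrite -expr2 ler_pM2r; last by rewrite exprn_gt0 //; case/andP: d2.
  lra.
have cP : c = P 0 j :> R[i].
  apply/eqP; rewrite -subr_eq0; apply/eqP/uniq => e e0.
  have e2 : 0 < e / 2 by rewrite divr_gt0.
  have [d1 d10 H1] := Hc _ e2; have [d2 d20 H2] := HP _ e2.
  exists (Num.min d1 d2); first by rewrite lt_min d10.
  move=> s /andP[s0]; rewrite lt_min => /andP[s1 s2].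
  have h1 := H1 (s%:C); rewrite half // in h1; have {}h1 := h1 s1.
  have h2 := H2 s; rewrite s0 s2 in h2; have {}h2 := h2 isT.
  have h3 := le_trans (rnorm_coord _ 0 j) h2.
  have -> : (c - P 0 j) * s%:C ^+ 2 = - ((F (curve 0 X Z s%:C) 0 j : R[i]) - c * s%:C ^+ 2)
     + ((F (curve 0 X Z s%:C) - ((s%:C : R[i]) : C) ^+ 2 *: P) 0 j : R[i]).
    set f := F _; clearbody f; rewrite !mxE; ring.
  apply: le_trans (normcD_le _ _) _; rewrite normc_opp; lra.
apply/eqP; rewrite -subr_eq0; apply/eqP/uniq => e e0.
have e3 : 0 < e / 3 by rewrite divr_gt0.
have [d1 d10 H1] := Hc _ e3; have [d2 d20 H2] := HP' _ e3.
have [d3 d30 H3] := second_slot ((w : C) *: X) Z' ((w : C) ^+ 2 *: Z) j e3.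
exists (Num.min d1 (Num.min d2 d3)); first by rewrite !lt_min d10 d20.
move=> s /andP[s0]; rewrite !lt_min => /and3P[s1 s2 s3].
have ws : normc (s%:C * w) = s by rewrite normcM w1 mulr1 half.
have h1 := H1 (s%:C * w); rewrite ws in h1; have {}h1 := h1 s1.
have h2 := H2 s; rewrite s0 s2 in h2; have {}h2 := h2 isT.
have {}h2 := le_trans (rnorm_coord _ 0 j) h2.
have h3 := H3 s; rewrite s0 s3 in h3; have {}h3 := h3 isT.
rewrite curve_reparam in h3.
have -> : ((P' - (w : C) ^+ 2 *: P) 0 j - ((Z' - (w : C) ^+ 2 *: Z) *m T) 0 j) * s%:C ^+ 2 =
  ((F (curve 0 ((w : C) *: X) Z' s%:C) - F (curve 0 X Z (s%:C * w))) 0 j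
       - s%:C ^+ 2 * ((Z' - (w : C) ^+ 2 *: Z) *m T) 0 j)
  + ((F (curve 0 X Z (s%:C * w)) 0 j : R[i]) - c * (s%:C * w) ^+ 2)
  - ((F (curve 0 ((w : C) *: X) Z' s%:C) - ((s%:C : R[i]) : C) ^+ 2 *: P') 0 j : R[i]) :> R[i].
  rewrite cP; set f := F _; set f' := F _; set q := (_ *m T) 0 j.
  clearbody f f' q; rewrite !mxE; ring.
apply: le_trans (normcD_le _ _) _; rewrite normc_opp.
apply: le_trans (lerD (normcD_le _ _) (lexx _)) _; lra.
Qed.

End SecondOrder.

(** * Derivatives of deck transformations *)

Section QuadraticForms.
Variable R : realType.
Local Notation C := (Cplx R).

Lemma bilinear_bound n (M : 'M[C]_n) : exists2 K : R, 0 < K &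
  forall x y : 'rV[C]_n, normc ((x *m M *m y^T) 0 0 : R[i]) <= K * rnorm x * rnorm y.
Proof.
have [L L0 HL] := rnorm_mulmx 1 M.
exists (L * n.+1%:R); first by rewrite mulr_gt0.
move=> x y; rewrite mxE; apply: le_trans (normc_sum _ _ _) _.
apply: le_trans (_ : \sum_(j < n) L * rnorm x * rnorm y <= _).
  apply: ler_sum => j _; rewrite normcM [y^T j 0]mxE ler_pM ?normc_ge0 ?rnorm_coord //.
  by apply: le_trans (HL x); exact: rnorm_coord.
rewrite sumr_const card_ord -[leLHS]mulr_natl.
rewrite [leRHS](_ : _ = n.+1%:R * (L * rnorm x * rnorm y)); last by ring.
by apply: ler_wpM2r; [rewrite !mulr_ge0 ?rnorm_ge0 // ltW|rewrite ler_nat].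
Qed.

Lemma quad_map_lip n m (M : 'I_m -> 'M[C]_n) : exists2 K : R, 0 < K &
  forall x y : 'rV[C]_n, rnorm (quad_map M x - quad_map M y)
    <= K * rnorm (x - y) * (rnorm x + rnorm y).
Proof.
have /choice [k kP] : forall j, exists K : R, 0 < K /\ forall x y : 'rV[C]_n,
    normc ((x *m M j *m y^T) 0 0 : R[i]) <= K * rnorm x * rnorm y.
  by move=> j; have [K K0 H] := bilinear_bound (M j); exists K.
have S0 : 0 <= \sum_j k j by apply: sumr_ge0 => j _; apply: ltW; case: (kP j).
exists (1 + \sum_j k j); first by rewrite ltr_wpDr.
move=> x y; have w0 : 0 <= rnorm (x - y) * (rnorm x + rnorm y).
  by rewrite mulr_ge0 ?addr_ge0 ?rnorm_ge0.
apply: rnorm_le => [|i j]; first by rewrite -mulrA mulr_ge0 // addr_ge0.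
have [kj0 H] := kP j.
have -> : (quad_map M x - quad_map M y) i j = quad_map M x 0 j - quad_map M y 0 j.
  by rewrite ord1 [LHS]mxE [X in _ + X]mxE.
rewrite !quad_mapE form_diff.
apply: le_trans (normcD_le _ _) _; apply: le_trans (lerD (H _ _) (H _ _)) _.
rewrite [k j * rnorm y * _]mulrAC -mulrDr -!mulrA ler_wpM2r //.
rewrite (bigD1 j) //= addrCA lerDl addr_ge0 // sumr_ge0 // => l _.
by apply: ltW; case: (kP l).
Qed.

(** f s = o(s^k) as s decreases to 0. *)
Definition small_order (k m : nat) (f : R -> 'rV[C]_m) :=
  forall e : R, 0 < e -> exists2 d : R, 0 < d & forall s : R, 0 < s < d -> rnorm (f s) <= e * s ^+ k.

Lemma small_order_const k m (x : 'rV[C]_m) :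
  small_order k (fun s => ((s%:C : R[i]) : C) ^+ k *: x) -> x = 0.
Proof.
move=> H; apply: rnorm0_eq0; apply/eqP; rewrite eq_le rnorm_ge0 andbT.
apply/ler_addgt0Pl => e e0; rewrite addr0; have [d d0 Hd] := H _ e0.
have d2 : 0 < d / 2 < d by lra.
have := Hd _ d2; have s0 : 0 < d / 2 by case/andP: d2.
rewrite rnormZ -rmorphXn normc_real ger0_norm ?exprn_ge0 ?(ltW s0) //.
by rewrite mulrC ler_pM2r // exprn_gt0.
Qed.

(** A curve that is s^2 y up to o(s^2) has no term of first order. *)
Lemma small_order_shift m (f : R -> 'rV[C]_m) (x y : 'rV[C]_m) :
  small_order 1 (fun s => f s - ((s%:C : R[i]) : C) *: x) ->
  small_order 2 (fun s => f s - ((s%:C : R[i]) : C) ^+ 2 *: y) -> x = 0.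
Proof.
move=> H1 H2; apply: (@small_order_const 1) => e e0.
have e3 : 0 < e / 3 by rewrite divr_gt0.
have [d1 d10 {}H1] := H1 _ e3; have [d2 d20 {}H2] := H2 _ e3.
have y1 : 0 < rnorm y + 1 by rewrite ltr_wpDl // rnorm_ge0.
have e4 : 0 < e / 3 / (rnorm y + 1) by rewrite divr_gt0.
exists (Num.min 1 (Num.min (e / 3 / (rnorm y + 1)) (Num.min d1 d2))).
  by rewrite !lt_min ltr01 e4 d10.
move=> s /andP[s0]; rewrite !lt_min => /and4P[s1 sy sd1 sd2].
have h1 := H1 s; rewrite s0 sd1 in h1; have {}h1 := h1 isT.
have h2 := H2 s; rewrite s0 sd2 in h2; have {}h2 := h2 isT.
rewrite expr1; set X := (_ : C) *: x; set Y := (_ : C) *: y in h2 *.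
have -> : X = - (f s - X) + (f s - Y) + Y.
  by rewrite opprB addrA subrK addrNK.
apply: le_trans (rnormD _ _) _.
apply: le_trans (lerD (rnormD _ _) (lexx _)) _; rewrite rnormN.
have hY : rnorm Y <= e / 3 * s.
  rewrite /Y rnormZ expr2 normcM normc_real gtr0_norm // -mulrA mulrC ler_pM2r //.
  rewrite ltr_pdivlMr // in sy; apply: le_trans (ltW sy).
  by rewrite ler_pM2l // lerDl.
have hs : e / 3 * s ^+ 2 <= e / 3 * s.
  by rewrite ler_pM2l // expr2 ler_piMl // ltW.
rewrite expr1 in h1 *; lra.
Qed.

Lemma quad_map_small_order n m (M : 'I_m -> 'M[C]_n) (g : R -> 'rV[C]_n) y :
  small_order 1 (fun s => g s - ((s%:C : R[i]) : C) *: y) ->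
  small_order 2 (fun s => quad_map M (g s) - ((s%:C : R[i]) : C) ^+ 2 *: quad_map M y).
Proof.
move=> H e e0; have [K K0 HK] := quad_map_lip M.
have y1 : 0 < 2 * rnorm y + 1 by rewrite ltr_wpDl // mulr_ge0 ?rnorm_ge0.
pose e' := Num.min 1 (e / K / (2 * rnorm y + 1)).
have e'0 : 0 < e' by rewrite lt_min ltr01 !divr_gt0.
have [d d0 Hd] := H _ e'0; exists d => // s /[dup] sd /Hd; case/andP: sd => s0 _.
rewrite expr1 => h; rewrite -quad_mapZ; apply: le_trans (HK _ _) _.
have sy : rnorm (((s%:C : R[i]) : C) *: y) = s * rnorm y by rewrite rnormZ normc_real gtr0_norm.
have hg : rnorm (g s) <= s * rnorm y + s.
  rewrite -[g s](subrK (((s%:C : R[i]) : C) *: y)).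
  apply: le_trans (rnormD _ _) _; rewrite sy addrC lerD2l.
  apply: le_trans h _; rewrite ler_piMl //; first exact: ltW.
  by rewrite ge_min lexx.
apply: le_trans (_ : K * (e' * s) * (s * (2 * rnorm y + 1)) <= _).
  apply: ler_pM.
  - by rewrite mulr_ge0 ?rnorm_ge0 // ltW.
  - by rewrite addr_ge0 ?rnorm_ge0.
  - by rewrite ler_pM2l.
  - by rewrite sy; lra.
have -> : K * (e' * s) * (s * (2 * rnorm y + 1)) = e' * (2 * rnorm y + 1) * K * s ^+ 2 by ring.
apply: ler_wpM2r; first by rewrite exprn_ge0 // ltW.
rewrite -!ler_pdivlMr //.
by rewrite ge_min lexx orbT.
Qed.

Lemma curve_first_order n m (F : 'rV[C]_n -> 'rV[C]_m) T X Z : linear_part F T ->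
  small_order 1 (fun s => F (curve 0 X Z s%:C) - ((s%:C : R[i]) : C) *: (X *m T)).
Proof.
move=> lF e e0; have [L L0 HL] := rnorm_mulmx 1 T.
pose W := rnorm X + rnorm Z + 1.
have [X0 Z0] : 0 <= rnorm X /\ 0 <= rnorm Z by split; exact: rnorm_ge0.
have W0 : 0 < W by rewrite /W; lra.
have e2 : 0 < e / 2 / W by rewrite !divr_gt0.
have [d d0 Hd] := lF _ e2.
have LZ : 0 < L * (rnorm Z + 1) by rewrite mulr_gt0 //; lra.
exists (Num.min 1 (Num.min (d / W) (e / 2 / (L * (rnorm Z + 1))))).
  by rewrite !lt_min ltr01 !divr_gt0.
move=> s /andP[s0]; rewrite !lt_min => /and3P[s1 sd sZ].
rewrite expr1; set u := curve _ _ _ _.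
have sn : normc (s%:C : R[i]) = s by rewrite normc_real gtr0_norm.
have s2 : s ^+ 2 <= s by rewrite expr2 ler_piMl // ltW.
have hu : rnorm u <= s * W.
  rewrite /u /curve add0r; apply: le_trans (rnormD _ _) _.
  rewrite !rnormZ expr2 normcM sn -expr2 /W mulrDr mulrDr mulr1 -addrA lerD2l.
  by apply: le_trans (_ : s * rnorm Z <= _); [rewrite ler_wpM2r|rewrite lerDl ltW].
have ud : rnorm u < d.
  by apply: le_lt_trans hu _; rewrite -ltr_pdivlMr.
have h := Hd _ ud.
have uT : u *m T = ((s%:C : R[i]) : C) *: (X *m T) + ((s%:C : R[i]) : C) ^+ 2 *: (Z *m T).
  by rewrite /u /curve add0r mulmxDl -!scalemxAl.
have -> : F u - ((s%:C : R[i]) : C) *: (X *m T) = (F u - u *m T) + ((s%:C : R[i]) : C) ^+ 2 *: (Z *m T).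
  by rewrite uT opprD addrA subrK.
apply: le_trans (rnormD _ _) _.
have h1 : rnorm (F u - u *m T) <= e / 2 * s.
  apply: le_trans h _; apply: le_trans (_ : e / 2 / W * (s * W) <= _).
    by rewrite ler_pM2l.
  by rewrite [s * W]mulrC mulrA divfK // gt_eqF.
have h2 : rnorm (((s%:C : R[i]) : C) ^+ 2 *: (Z *m T)) <= e / 2 * s.
  rewrite rnormZ expr2 normcM sn -mulrA mulrC ler_pM2r //.
  rewrite ltr_pdivlMr // in sZ; apply: le_trans (ltW sZ); rewrite ler_pM2l //.
  apply: le_trans (HL Z) _; rewrite ler_pM2l //; lra.
lra.
Qed.

(** At s v the germ t differs from s v T by o(s), so the two values of the
    quadratic map differ by o(s^2); both are multiples of s^2. *)
Lemma quad_map_linear_part n m (M : 'I_m -> 'M[C]_n) (t : 'rV[C]_n -> 'rV[C]_n) T :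
  linear_part t T -> (\forall v \near (0 : 'rV[C]_n), quad_map M (t v) = quad_map M v) ->
  forall v, quad_map M (v *m T) = quad_map M v.
Proof.
move=> lt /near0P [d d0 H] v; apply/esym/subr0_eq/(@small_order_const 2) => e e0.
have [d1 d10 H1] := quad_map_small_order M (curve_first_order v 0 lt) e0.
have v1 : 0 < rnorm v + 1 by rewrite ltr_wpDl // rnorm_ge0.
exists (Num.min d1 (d / (rnorm v + 1))); first by rewrite lt_min d10 divr_gt0.
move=> s /andP [s0]; rewrite lt_min => /andP [s1 sd].
have := H1 s; rewrite s0 s1 => /(_ isT).
have cE : curve 0 v 0 s%:C = ((s%:C : R[i]) : C) *: v by rewrite /curve scaler0 addr0 add0r.
rewrite cE H ?quad_mapZ -?scalerBr // rnormZ normc_real gtr0_norm //.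
apply: le_lt_trans (_ : s * (rnorm v + 1) < _); last by rewrite -ltr_pdivlMr.
by rewrite ler_pM2l // lerDl.
Qed.

End QuadraticForms.

Section Decks.
Variables (R : realType) (p : nat).
Local Notation C := (Cplx R).
Variable M : 'I_p -> 'M[C]_(p + p).
Let E : 'rV[C]_p -> 'rV[C]_p -> 'rV[C]_p := fun z w => quad_map M (row_mx z w).

Lemma biholomorphism_linear_part n (t : 'rV[C]_n -> 'rV[C]_n) :
  local_biholomorphism t -> linear_part t (jacobian t 0).
Proof.
by case=> t0 /nbhs_singleton dt _; exact: differentiable_linear_part.
Qed.

Lemma linear_part_mulmx n m (P : 'M[C]_(n, m)) : linear_part (mulmx^~ P : 'rV[C]_n -> 'rV[C]_m) P.
Proof.
move=> e e0; exists 1 => // v _.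
by rewrite subrr rnorm0 mulr_ge0 ?rnorm_ge0 // ltW.
Qed.

Lemma deck_linear_part (t : 'rV[C]_(p + p) -> 'rV[C]_(p + p)) T :
  deck_transformation E t -> linear_part t T ->
  exists A B, T = block_mx 1%:M A 0 B /\ forall v, quad_map M (v *m T) = quad_map M v.
Proof.
move=> [_ dt] lt.
have piE v : pi1 E v = row_mx (lsubmx v) (quad_map M v) by rewrite /pi1 /= /E hsubmxK.
pose P : 'M[C]_(p + p, p) := col_mx 1%:M 0.
have PE (v : 'rV[C]_(p + p)) : v *m P = lsubmx v.
  by rewrite -[v in LHS]hsubmxK mul_row_col mulmx1 mulmx0 addr0.
have TP : T *m P = P.
  apply: linear_part_unique (linear_part_comp lt (linear_part_mulmx P)) _.
  apply: linear_part_germ (linear_part_mulmx P).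
  apply: filterS dt => v /= h; rewrite !PE.
  by move: h; rewrite !piE => /eq_row_mx [->].
have qT : forall v, quad_map M (v *m T) = quad_map M v.
  apply: quad_map_linear_part lt _; apply: filterS dt => v /= h.
  by move: h; rewrite !piE => /eq_row_mx [_].
exists (ursubmx T), (drsubmx T); split=> //.
have : block_mx (ulsubmx T) (ursubmx T) (dlsubmx T) (drsubmx T) *m P = P by rewrite submxK.
rewrite /P mul_block_col !mulmx1 !mulmx0 !addr0 => /eq_col_mx [e1 e2].
by rewrite -[LHS]submxK e1 e2.
Qed.

(** The derivatives of the generating involutions are commuting reflections
    that preserve the quadratic map exactly, by homogeneity, so the linear
    theory applies to them. *)
Lemma deck_structure : sigma_distinct_eigenvalues E ->
  exists (A U : 'M[C]_p) (A_ B_ : 'I_p -> 'M[C]_p) (nu : 'I_p -> C),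
  [/\ A \in unitmx /\ U \in unitmx,
      forall k, U *m B_ k = (1%:M - 2 *: delta_mx k k) *m U,
      forall k, block_mx 1%:M (A_ k) 0 (B_ k) *m block_mx 1%:M A 0 (- 1%:M)
        = block_mx 1%:M A 0 (- 1%:M) *m block_mx 1%:M (A_ k) 0 (B_ k),
      (forall k v, quad_map M (v *m block_mx 1%:M (A_ k) 0 (B_ k)) = quad_map M v) /\
      (forall v, quad_map M (v *m block_mx 1%:M A 0 (- 1%:M)) = quad_map M v) &
      injective nu /\ forall j, eigenvalue (map_mx Num.conj (invmx A) *m invmx A) (nu j)
        /\ nu j != 4^-1].
Proof.
case=> t [tdeck tinv tcom _] [l linj lS].
pose T j := jacobian (t j) 0.
have lt j : linear_part (t j) (T j).
  by apply: biholomorphism_linear_part; case: (tdeck j).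
have data j : exists AB : 'M[C]_p * 'M[C]_p, T j = block_mx 1%:M AB.1 0 AB.2 /\
    forall v, quad_map M (v *m T j) = quad_map M v.
  by have [A [B h]] := deck_linear_part (tdeck j) (lt j); exists (A, B).
have [AB ABP] := choice data.
pose A_ j := (AB j).1; pose B_ j := (AB j).2.
have TE j : T j = block_mx 1%:M (A_ j) 0 (B_ j) by have [] := ABP j.
have qT j v : quad_map M (v *m T j) = quad_map M v by have [_] := ABP j.
have TT j : T j *m T j = 1%:M.
  have [[gt _] _] := tinv j.
  apply: linear_part_unique (linear_part_id _).
  exact: linear_part_germ gt (linear_part_comp (lt j) (lt j)).
have Tcom j k : T j *m T k = T k *m T j.
  apply: linear_part_unique (linear_part_comp (lt j) (lt k)) _.
  exact: linear_part_germ (tcom j k) (linear_part_comp (lt k) (lt j)).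
have Trk j : (\rank (T j - 1%:M)%R <= 1)%N.
  have [_ fx] := tinv j; have [a a0 H] := fixes_hypersurface_tangent fx (lt j).
  exact: hyperplane_rank H.
have lY : linear_part (\big[comp/id]_(j < p) t j) (total_deck T).
  rewrite /total_deck; elim/big_rec2: _ => [|j Z f _ lf]; first exact: linear_part_id.
  exact: linear_part_comp lf (lt j).
have lsigma : linear_part (sigma_of t) (sigma_mx (total_deck T)).
  exact: linear_part_comp (linear_part_rho0 lY) lY.
have lS' i : eigenvalue (sigma_mx (total_deck T)) (l i).
  by rewrite -(linear_part_jacobian lsigma); exact: lS.
have [A [U [nu [AU UB comT qA nuP]]]] := linear_deck_structure TE TT Tcom Trk qT linj lS'.
exists A, U, A_, B_, nu; split=> //; first by move=> k; rewrite -TE.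
by split=> [k v|//]; rewrite -TE qT.
Qed.

End Decks.

(** * Shears *)

Section Shear.
Variable R : realType.
Local Notation C := (Cplx R).

Lemma differentiable_row n m (f : 'rV[C]_n -> 'rV[C]_m) x :
  (forall j, differentiable (fun v => f v 0 j : C^o) x) -> differentiable f x.
Proof.
move=> H.
have -> : f = (fun v => \sum_j f v 0 j *: delta_mx 0 j).
  by apply/funext => v; rewrite -row_sum_delta.
have -> : (fun v => \sum_j f v 0 j *: delta_mx 0 j : 'rV[C]_m) =
    \sum_j (fun v => f v 0 j *: delta_mx 0 j).
  by apply/funext => v; rewrite fct_sumE.
apply: differentiable_sum => j; exact: differentiableZl.
Qed.

Lemma differentiable_mulmxr n m (P : 'M[C]_(n, m)) x :
  differentiable (mulmx^~ P : 'rV[C]_n -> 'rV[C]_m) x.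
Proof.
apply: differentiable_row => j.
have -> : (fun v : 'rV[C]_n => (v *m P) 0 j : C^o) = \sum_i ((fun v : 'rV[C]_n => v 0 i : C^o) * (fun=> P i j : C^o)).
  by apply/funext => v; rewrite fct_sumE mxE.
apply: differentiable_sum => i.
apply: differentiableM; first exact: differentiable_coord.
exact: differentiable_cst.
Qed.

Lemma differentiable_quad_map n m (M : 'I_m -> 'M[C]_n) x : differentiable (quad_map M) x.
Proof.
apply: differentiable_row => j.
have dM i : differentiable (fun v : 'rV[C]_n => (v *m M j) 0 i : C^o) x.
  apply: (@differentiable_comp _ _ _ _ (mulmx^~ (M j)) (fun u : 'rV[C]_n => u 0 i : C^o)).
    exact: differentiable_mulmxr.
  exact: differentiable_coord.
have -> : (fun v : 'rV[C]_n => quad_map M v 0 j : C^o) =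
    \sum_i ((fun v : 'rV[C]_n => (v *m M j) 0 i : C^o) * (fun v => v 0 i : C^o)).
  by apply/funext => v; rewrite fct_sumE quad_mapE mxE; apply: eq_bigr => i _; rewrite [_^T _ _]mxE.
apply: differentiable_sum => i.
apply: differentiableM; [exact: dM|exact: differentiable_coord].
Qed.

Lemma differentiable_row_mx n m k (f : 'rV[C]_n -> 'rV[C]_m) (g : 'rV[C]_n -> 'rV[C]_k) x :
  differentiable f x -> differentiable g x -> differentiable (fun v => row_mx (f v) (g v)) x.
Proof.
move=> df dg.
have -> : (fun v => row_mx (f v) (g v)) =
    (fun v => f v *m row_mx 1%:M 0) + (fun v => g v *m row_mx 0 1%:M).
  apply/funext => v; rewrite -[RHS]/(f v *m row_mx 1%:M 0 + g v *m row_mx 0 1%:M).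
  by rewrite !mul_mx_row !mulmx1 !mulmx0 add_row_mx addr0 add0r.
apply: differentiableD.
  by apply: (@differentiable_comp _ _ _ _ f (mulmx^~ _)) => //; exact: differentiable_mulmxr.
by apply: (@differentiable_comp _ _ _ _ g (mulmx^~ _)) => //; exact: differentiable_mulmxr.
Qed.

Lemma differentiable_lsubmx n m (x : 'rV[C]_(n + m)) :
  differentiable (lsubmx : 'rV[C]_(n + m) -> 'rV[C]_n) x.
Proof.
have -> : (lsubmx : 'rV[C]_(n + m) -> 'rV[C]_n) = mulmx^~ (col_mx 1%:M 0).
  apply/funext => v; rewrite -[v in RHS]hsubmxK mul_row_col mulmx1 mulmx0 addr0 //.
exact: differentiable_mulmxr.
Qed.

Lemma differentiable_rsubmx n m (x : 'rV[C]_(n + m)) :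
  differentiable (rsubmx : 'rV[C]_(n + m) -> 'rV[C]_m) x.
Proof.
have -> : (rsubmx : 'rV[C]_(n + m) -> 'rV[C]_m) = mulmx^~ (col_mx 0 1%:M).
  apply/funext => v; rewrite -[v in RHS]hsubmxK mul_row_col mulmx1 mulmx0 add0r //.
exact: differentiable_mulmxr.
Qed.

Lemma holomorphic_shear n (P Q : 'M[C]_n) r : (forall x, differentiable r x) ->
  holomorphic_at0 (shear P Q r).
Proof.
move=> dr; apply/near0P; exists 1 => // x _; apply: differentiable_row_mx.
  apply: (@differentiable_comp _ _ _ _ lsubmx (mulmx^~ P)); last exact: differentiable_mulmxr.
  exact: differentiable_lsubmx.
apply: (@differentiable_comp _ _ _ _ (fun v => rsubmx v - r (lsubmx v)) (mulmx^~ Q)).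
  apply: differentiableB; first exact: differentiable_rsubmx.
  by apply: (@differentiable_comp _ _ _ _ lsubmx r) => //; exact: differentiable_lsubmx.
exact: differentiable_mulmxr.
Qed.

(** The inverse is again a shear. *)
Lemma shear_biholomorphism n (P Q : 'M[C]_n) r : P \in unitmx -> Q \in unitmx ->
  (forall x, differentiable r x) -> r 0 = 0 -> local_biholomorphism (shear P Q r).
Proof.
move=> Pu Qu dr r0.
pose r' := shear_inverse P Q r.
have r'0 : r' 0 = 0 by exact: shear_inverse0.
have dr' x : differentiable r' x.
  apply: differentiableN.
  apply: (@differentiable_comp _ _ _ _ (fun y => r (y *m invmx P)) (mulmx^~ Q)).
    apply: (@differentiable_comp _ _ _ _ (mulmx^~ (invmx P)) r) => //.
    exact: differentiable_mulmxr.
  exact: differentiable_mulmxr.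
split; [exact: shear0|exact: holomorphic_shear|].
exists (shear (invmx P) (invmx Q) r'); split; [exact: shear0|exact: holomorphic_shear| |];
  apply/near0P; exists 1 => // v _; [exact: shearK|exact: shearKV].
Qed.

End Shear.

(** * Existence of the normal form *)

Section Normalization.
Variables (R : realType) (p : nat).
Local Notation C := (Cplx R).

Lemma hq_mapE (h q : 'I_p -> 'M[C]_p) :
  hq_map h q = (fun z w => quad_map (fun j => block_mx 0 (h j) 0 (q j)) (row_mx z w)).
Proof. by apply/funext => z; apply/funext => w; exact: quad_map_hq. Qed.

Lemma Lsq_mapE (B gamma : 'M[C]_p) :
  Lsq_map B gamma = (fun z w => quad_map (square_forms_mx B gamma) (row_mx z w)).
Proof.
apply/funext => z; apply/funext => w; rewrite -square_forms_quad_map -squares_linear_forms //.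
Qed.

(** The change of coordinates of [normal_coordinates] is a shear, and it maps
    one quadric onto the other exactly because no terms of higher order
    occur. *)
Lemma normalization_exists (hc qc : 'I_p -> 'M[C]_p) :
  nondegenerate_quadric (hq_map hc qc) ->
  exists (e h s : nat) (p_ehs : (e + h + (s + s) = p)%N)
         (ge : 'rV[C]_e) (gh : 'rV[C]_h) (gs : 'rV[C]_s) (B : 'M[C]_p),
  [/\ gamma_range ge gh gs, B \in unitmx &
      holomorphically_equivalent (quadric (hq_map hc qc))
        (quadric (Lsq_map B (gamma_mx p_ehs ge gh gs)))].
Proof.
rewrite hq_mapE; set M := fun j : 'I_p => block_mx _ _ _ _; move=> [anti _ sg].
have [A [U [A_ [B_ [nu [AU UB comT [qT _] nuP]]]]]] := deck_structure sg.
have anti' (w : 'rV[C]_p) : quad_map M (row_mx 0 w) = 0 -> w = 0.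
  move=> h; have : (antihol_part (fun z w => quad_map M (row_mx z w)) @^-1` [set 0]) w by exact: h.
  by rewrite anti.
have [e [h [s [E [ge [gh [gs [B [P [Q [N [rg Bu [Pu Qu] ME]]]]]]]]]]]] :=
  normal_coordinates AU UB comT qT nuP anti'.
exists e, h, s, E, ge, gh, gs, B; split=> //.
  by have [h1 h2 h3] := rg; split=> i; rewrite div1r; [exact: h1|exact: h2|exact: h3].
exists (shear P (invmx Q) (quad_map N)).
  apply: shear_biholomorphism => //; first by rewrite unitmx_inv.
    by move=> x; exact: differentiable_quad_map.
  exact: quad_map0.
apply/near0P; exists 1 => // v _.
rewrite /quadric /= ME /shear row_mxKl row_mxKr.
have -> : Lsq_map B (gamma_mx E ge gh gs) (lsubmx v *m P) (conj_rV (lsubmx v *m P)) =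
  sqr_row ((lsubmx v *m P - 2 *: (conj_rV (lsubmx v *m P) *m (gamma_mx E ge gh gs)^T)) *m B^T).
  exact: squares_linear_forms.
set y := sqr_row _; split=> [->|<-].
  by rewrite addrC addKr mulmxK.
by rewrite mulmxKV // addrC subrK.
Qed.

End Normalization.

(** * Equivalences of quadrics to second order *)

Section QuadricEquivalence.
Variables (R : realType) (p : nat).
Local Notation C := (Cplx R).

Lemma lsubmx_curve (v y : 'rV[C]_p) z :
  lsubmx (curve 0 (row_mx v 0) (row_mx 0 y) z) = (z : C) *: v.
Proof.
by rewrite /curve add0r !scale_row_mx !scaler0 add_row_mx row_mxKl addr0.
Qed.

Lemma rsubmx_curve (v y : 'rV[C]_p) z :
  rsubmx (curve 0 (row_mx v 0) (row_mx 0 y) z) = (z : C) ^+ 2 *: y.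
Proof.
by rewrite /curve add0r !scale_row_mx !scaler0 add_row_mx row_mxKr add0r.
Qed.

Lemma conj_rV_real n (s : R) (v : 'rV[C]_n) :
  conj_rV (((s%:C : R[i]) : C) *: v) = ((s%:C : R[i]) : C) *: conj_rV v.
Proof.
rewrite /conj_rV map_mxZ; congr (_ *: _).
apply/CrealP; rewrite realE.
by rewrite -[0]/((0%:C : R[i]) : C) !(@lecR R); case: (lerP 0 s) => // /ltW ->.
Qed.

Variables (M M' : 'I_p -> 'M[C]_(p + p)).
Local Notation E := (fun z w : 'rV[C]_p => quad_map M (row_mx z w)).
Local Notation E' := (fun z w : 'rV[C]_p => quad_map M' (row_mx z w)).
Local Notation real_row v := (row_mx v (conj_rV v)).
Local Notation tangent v := (row_mx v (0 : 'rV[C]_p)).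
Local Notation normal v := (row_mx (0 : 'rV[C]_p) (quad_map M (real_row v))).

Lemma curve_on_quadric (s : R) v : quadric E (curve 0 (tangent v) (normal v) s%:C).
Proof.
rewrite /quadric /= lsubmx_curve rsubmx_curve conj_rV_real.
by rewrite -scale_row_mx quad_mapZ.
Qed.

Variables (F : 'rV[C]_(p + p) -> 'rV[C]_(p + p)) (J : 'M[C]_(p + p)).
Hypothesis lF : linear_part F J.
Hypothesis HF : \forall z \near (0 : 'rV[C]_(p + p)), quadric E z <-> quadric E' (F z).

(** F maps the curve into the second quadric, on which the last components are
    quadratic in the first ones; the first components of the image are
    s (v c) + o(s), where c is the upper left block of J. *)
Lemma image_second_order v : small_order 2 (fun s =>
  rsubmx (F (curve 0 (tangent v) (normal v) s%:C))
  - ((s%:C : R[i]) : C) ^+ 2 *: quad_map M' (real_row (v *m ulsubmx J))).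
Proof.
pose u s := curve 0 (tangent v) (normal v) s%:C.
pose x s := lsubmx (F (u s)); pose y := v *m ulsubmx J.
have yE : y = lsubmx (tangent v *m J).
  by rewrite -[J in RHS]submxK mul_row_block !mul0mx !addr0 row_mxKl.
have first : small_order 1 (fun s => real_row (x s) - ((s%:C : R[i]) : C) *: real_row y).
  move=> e e0; have e2 : 0 < e / 2 by rewrite divr_gt0.
  have [d d0 Hd] := curve_first_order (tangent v) (normal v) lF e2.
  exists d => // s /Hd; rewrite -/(u s) => h.
  rewrite scale_row_mx -conj_rV_real opp_row_mx add_row_mx.
  have -> : conj_rV (x s) - conj_rV (((s%:C : R[i]) : C) *: y) = conj_rV (x s - ((s%:C : R[i]) : C) *: y).
    by rewrite /conj_rV map_mxB.
  have -> : x s - ((s%:C : R[i]) : C) *: y = lsubmx (F (u s) - ((s%:C : R[i]) : C) *: (tangent v *m J)).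
    by rewrite yE /x; apply/rowP => j; rewrite !mxE.
  apply: le_trans (rnorm_row_mx _ _) _; rewrite rnorm_conj.
  have := le_trans (rnorm_lsubmx _) h; lra.
have second := quad_map_small_order M' first.
have /near0P [d d0 Hd] := HF.
pose W := rnorm (tangent v) + rnorm (normal v) + 1.
have [X0 Z0] : 0 <= rnorm (tangent v) /\ 0 <= rnorm (normal v) by split; exact: rnorm_ge0.
have W0 : 0 < W by rewrite /W; lra.
move=> e e0; have [d1 d10 H1] := second _ e0.
exists (Num.min (Num.min 1 (d / W)) d1); first by rewrite !lt_min ltr01 divr_gt0.
move=> s /andP[s0]; rewrite !lt_min => /andP[/andP[s1 sd] sd1].
have ud : rnorm (u s) < d.
  apply: le_lt_trans (_ : s * W < _); last by rewrite -ltr_pdivlMr.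
  apply: le_trans (rnorm_curve0 _ _ _) _; rewrite normc_real gtr0_norm //.
  have ss : s * s <= s by rewrite ler_piMl; [|exact: ltW|exact: ltW].
  by have := ler_wpM2r Z0 ss; rewrite expr2 /W !mulrDr mulr1; lra.
have -> : rsubmx (F (u s)) = quad_map M' (real_row (x s)).
  by have [+ _] := Hd _ ud; apply; exact: curve_on_quadric.
by apply: H1; rewrite s0.
Qed.

End QuadricEquivalence.

Section EquivalenceLinearData.
Variables (R : realType) (p : nat).
Local Notation C := (Cplx R).
Variables (M M' : 'I_p -> 'M[C]_(p + p)).
Local Notation E := (fun z w : 'rV[C]_p => quad_map M (row_mx z w)).
Local Notation E' := (fun z w : 'rV[C]_p => quad_map M' (row_mx z w)).
Local Notation real_row v := (row_mx v (conj_rV v)).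

Lemma normc_unit (w : C) : w * w^* = 1 -> normc (w : R[i]) = 1.
Proof.
move=> h; apply: (complexI (R := R)); rewrite -normr_normc; apply/eqP.
have : `|w : C| ^+ 2 == 1 by rewrite normCK h.
by rewrite sqrp_eq1 // normr_ge0.
Qed.

(** Along the quadric the last components of F are of second order, so the
    upper right block of J vanishes and the matrices c and b are its diagonal
    blocks.  The last components then satisfy the hypotheses of
    [rotation_identity]. *)
Lemma equivalence_linear_data : holomorphically_equivalent (quadric E) (quadric E') ->
  exists c b : 'M[C]_p, c \in unitmx /\ forall w : C, w * w^* = 1 -> forall v : 'rV[C]_p,
    quad_map M' (real_row (w *: v *m c)) - w ^+ 2 *: quad_map M' (real_row (v *m c))
    = (quad_map M (real_row (w *: v)) - w ^+ 2 *: quad_map M (real_row v)) *m b.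
Proof.
move=> [F [F0 hF [G [G0 hG GF _]]] HF]; pose J := jacobian F 0.
have lF : linear_part F J by exact: differentiable_linear_part (nbhs_singleton hF) F0.
have lG := differentiable_linear_part (nbhs_singleton hG) G0.
have Ju : J \in unitmx.
  apply: (proj1 (mulmx1_unit (B := jacobian G 0) _)).
  apply: linear_part_unique (linear_part_id _).
  exact: linear_part_germ GF (linear_part_comp lF lG).
pose f v := rsubmx (F v); pose T := J *m col_mx 0 1%:M.
have fE : f = (mulmx^~ (col_mx 0 1%:M)) \o F.
  apply/funext => v; rewrite /f /= -[F v in RHS]hsubmxK.
  by rewrite mul_row_col mulmx0 mulmx1 add0r.
have lf : linear_part f T by rewrite fE; exact: linear_part_comp lF (linear_part_mulmx _).
have hf : holomorphic_at0 f.
  apply: filterS hF => v dF; rewrite fE.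
  exact: differentiable_comp dF (differentiable_mulmxr _ _).
clearbody J; have XT (v : 'rV[C]_p) : row_mx v 0 *m T = 0.
  apply: (@small_order_shift R _
    (fun s => f (curve 0 (row_mx v 0) (row_mx 0 (quad_map M (real_row v))) s%:C))).
    exact: curve_first_order lf.
  exact: image_second_order lF HF v.
have cu : ulsubmx J \in unitmx.
  apply: lower_block_unit Ju _ => v.
  by rewrite -(XT v) /T tangent_normal_part mul0mx addr0.
exists (ulsubmx J), (drsubmx J); split=> // w w1 v.
have HP := image_second_order lF HF v.
have HP' := image_second_order lF HF (w *: v).
have e : row_mx (w *: v) (0 : 'rV[C]_p) = w *: row_mx v 0 by rewrite scale_row_mx scaler0.
rewrite {1}e in HP'.
have := rotation_identity hf lf (XT v) (normc_unit w1) HP HP'.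
rewrite scale_row_mx scaler0 opp_row_mx oppr0 add_row_mx add0r.
by rewrite /T tangent_normal_part mul0mx add0r.
Qed.

End EquivalenceLinearData.

(** * Classification *)

Section Classification.
Variables (R : realType) (p : nat).
Local Notation C := (Cplx R).

Lemma Lsq_map_real (B gamma : 'M[C]_p) v :
  Lsq_map B gamma v (conj_rV v) = sqr_row (real_forms B gamma v).
Proof. exact: squares_linear_forms. Qed.

(** Squaring commutes with a monomial matrix if the entries of the matrix are
    squared, so the equivalence is the linear map which applies the inverse of
    D to z' and these squares to z''. *)
Lemma monomial_equivalence (A B D gamma : 'M[C]_p) : monomial_mx A -> D \in unitmx ->
  D^T = D -> D *m gamma = gamma *m map_mx Num.conj D ->
  holomorphically_equivalent (quadric (Lsq_map B gamma)) (quadric (Lsq_map (A *m B *m D) gamma)).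
Proof.
move=> [Au /(monomial_rowP Au) Arow] Du DT Dg.
pose Q := (map_mx (fun y => y ^+ 2) A)^T.
have Qu : Q \in unitmx := monomial_squares_unit Au Arow.
exists (shear (invmx D) Q (fun=> 0)).
  by apply: shear_biholomorphism => //; rewrite unitmx_inv.
apply/near0P; exists 1; [exact: ltr01|move=> v _].
rewrite /quadric /= /shear row_mxKl row_mxKr subr0 !Lsq_map_real real_forms_monomial //.
rewrite mulmxKV // monomial_sqr_row //.
by split=> [->|/(can_inj (mulmxK Qu))].
Qed.

Lemma nondegenerate_gamma_unit (B gamma : 'M[C]_p) :
  nondegenerate_quadric (Lsq_map B gamma) -> gamma \in unitmx.
Proof.
case=> anti _ _; apply: (@antiholomorphic_unit _ _ B) => w h.
have : (antihol_part (Lsq_map B gamma) @^-1` [set 0]) w.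
  exact: etrans (squares_linear_forms B gamma 0 w) h.
by rewrite anti.
Qed.

(** For a quadric in normal form the product of the generating involutions is
    (z, w) |-> (z, z A - w) with A = (gamma^T)^-1, so the simple spectrum of
    sigma is a condition on gamma. *)
Lemma nondegenerate_deck (B gamma : 'M[C]_p) : B \in unitmx ->
  nondegenerate_quadric (Lsq_map B gamma) ->
  exists (A : 'M[C]_p) (nu : 'I_p -> C), [/\ A *m gamma^T = 1%:M, injective nu &
    forall j, eigenvalue (map_mx Num.conj (invmx A) *m invmx A) (nu j)].
Proof.
move=> Bu nd; have gu := nondegenerate_gamma_unit nd.
case: nd => _ _; rewrite Lsq_mapE => sg.
have [A [U [A_ [B_ [nu [_ _ _ [_ qA] [nui nuP]]]]]]] := deck_structure sg.
exists A, nu; split=> // [|j]; last by case: (nuP j).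
exact: deck_inverse Bu gu qA.
Qed.

(** An equivalence is not assumed to be linear; only its derivative enters, and
    [quadric_rotations_scaling] extracts D from the block acting on z'. *)
Lemma equivalence_monomial (B B' gamma : 'M[C]_p) :
  B \in unitmx -> B' \in unitmx -> gamma \in unitmx ->
  holomorphically_equivalent (quadric (Lsq_map B gamma)) (quadric (Lsq_map B' gamma)) ->
  exists A D : 'M[C]_p, [/\ monomial_mx A, D \in unitmx,
    D *m gamma = gamma *m map_mx Num.conj D & B' = A *m B *m D].
Proof.
move=> Bu Bu' gu; rewrite !Lsq_mapE => /equivalence_linear_data [c [b [cu H]]].
have [A [D [Au Arow BE Dg]]] := quadric_rotations_scaling Bu Bu' gu cu H.
exists A, D; split=> //; first by split=> //; apply/monomial_rowP.
by move: Bu'; rewrite BE !unitmx_mul => /andP [].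
Qed.

End Classification.

Theorem theorem1p1 (R : realType) (p : nat) (p_gt0 : (0 < p)%N) :
  (forall hc qc : 'I_p -> 'M[Cplx R]_p,
     nondegenerate_quadric (hq_map hc qc) ->
     exists (e h s : nat) (p_ehs : (e + h + (s + s) = p)%N)
            (ge : 'rV[Cplx R]_e) (gh : 'rV[Cplx R]_h) (gs : 'rV[Cplx R]_s)
            (B : 'M[Cplx R]_p),
       [/\ gamma_range ge gh gs,
           B \in unitmx &
           holomorphically_equivalent
             (quadric (hq_map hc qc))
             (quadric (Lsq_map B (gamma_mx p_ehs ge gh gs)))])
  /\
  (forall (e h s : nat) (p_ehs : (e + h + (s + s) = p)%N)
          (ge : 'rV[Cplx R]_e) (gh : 'rV[Cplx R]_h) (gs : 'rV[Cplx R]_s)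
          (B B' : 'M[Cplx R]_p),
     let gamma := gamma_mx p_ehs ge gh gs in
     gamma_range ge gh gs ->
     B \in unitmx -> B' \in unitmx ->
     nondegenerate_quadric (Lsq_map B gamma) ->
     nondegenerate_quadric (Lsq_map B' gamma) ->
     (holomorphically_equivalent
        (quadric (Lsq_map B gamma)) (quadric (Lsq_map B' gamma))
      <->
      exists A D : 'M[Cplx R]_p,
        [/\ monomial_mx A, scaling_mx p_ehs D & B' = A *m B *m D])).
Proof.
split; first exact: normalization_exists.
move=> e h s p_ehs ge gh gs B B' gamma [re rh rs] Bu Bu' nd _.
subst p.
have gE : gamma = gamma_block ge gh gs by rewrite /gamma /gamma_mx castmx_id.
have ge_gt0 i : 0 < ge 0 i by have /andP [] := re i.
have gh_gt0 i : 0 < gh 0 i by apply: lt_trans (rh i); rewrite div1r invr_gt0.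
have gs_neq0 i : gs 0 i != 0.
  by have [_] := rs i; apply: contraTneq => ->; rewrite raddf0 ltxx.
split=> [eqv|[A [D [mA [a [b [c [ra rb c0 DE]]]] BE]]]].
  have [A [D [mA Du Dg BE]]] := equivalence_monomial Bu Bu' (nondegenerate_gamma_unit nd) eqv.
  have [A' [nu [Ag nui nuP]]] := nondegenerate_deck Bu nd.
  rewrite gE in Dg Ag.
  have [a [b [c [ra rb c0 DE]]]] := scaling_of_commutation ge_gt0 gh_gt0 gs_neq0 Du Dg Ag nui nuP.
  by exists A, D; split=> //; exists a, b, c; rewrite castmx_id.
rewrite castmx_id in DE.
rewrite BE; apply: monomial_equivalence => //.
- by move: Bu'; rewrite BE !unitmx_mul => /andP [].
- by rewrite DE tr_diag_mx.
rewrite gE DE; apply: scaling_commutation => // i; [by case: (ra i)|by case: (rb i)].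
Qed.
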